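(* Let $k$ be a commutative ring, let $\mathcal{A}$ be a small additive category, let $B,C:\mathcal{A}\times\mathcal{A}\to k\text{-}\mathbf{Mod}$ be two bifunctors of AP-type and let $B':\mathcal{A}^{\mathrm{op}}\times\mathcal{A}^{\mathrm{op}}\to k\text{-}\mathbf{Mod}$ be a bifunctor of AP-type which is contravariant in both variables. Restriction along the diagonal functor $\Delta:\mathcal{A}\to\mathcal{A}\times\mathcal{A}$, $\Delta(a)=(a,a)$, yields isomorphisms $$\mathrm{Ext}^*_{k[\mathcal{A}\times\mathcal{A}]}(B,C)\simeq \mathrm{Ext}^*_{k[\mathcal{A}]}(\Delta^*B,\Delta^*C),$$ $$\mathrm{Tor}_*^{k[\mathcal{A}]}(\Delta^*B',\Delta^*C)\simeq \mathrm{Tor}_*^{k[\mathcal{A}\times\mathcal{A}]}(B',C).$$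
   Context: ''Small'' means that isomorphism classes of objects form a set; additive categories have a zero object and finite biproducts. For a small category $\mathcal{C}$, $k[\mathcal{C}]\text{-}\mathbf{Mod}$ is the abelian category of all (not necessarily additive) functors $\mathcal{C}\to k\text{-}\mathbf{Mod}$ and natural transformations, and $\mathbf{Mod}\text{-}k[\mathcal{C}]=k[\mathcal{C}^{\mathrm{op}}]\text{-}\mathbf{Mod}$. $\mathrm{Ext}^*_{k[\mathcal{C}]}$ is computed in $k[\mathcal{C}]\text{-}\mathbf{Mod}$. For $F$ contravariant and $G$ covariant, $F\otimes_{k[\mathcal{C}]}G=\int^{x}F(x)\otimes_k G(x)$ (coend) and $\mathrm{Tor}_*^{k[\mathcal{C}]}$ denotes its left derived functors. For a functor $\phi:\mathcal{C}\to\mathcal{D}$, $\phi^*F=F\circ\phi$; restriction induces maps $\phi^*:\mathrm{Ext}^*_{k[\mathcal{D}]}(G,F)\to\mathrm{Ext}^*_{k[\mathcal{C}]}(\phi^*G,\phi^*F)$ and $\mathrm{res}^\phi:\mathrm{Tor}_*^{k[\mathcal{C}]}(\phi^*F,\phi^*G)\to\mathrm{Tor}_*^{k[\mathcal{D}]}(F,G)$ (derived from the map sending the class of $s\otimes s'\in F(\phi(x))\otimes G(\phi(x))$ to its class in $F\otimes_{k[\mathcal{D}]}G$). An additive category $\mathcal{B}$ is $k$-trivial if for all objects $x,y$ the abelian group $\mathcal{B}(x,y)$ is finite and $k\otimes_{\mathbb{Z}}\mathcal{B}(x,y)=0$. An ideal $\mathcal{I}$ of $\mathcal{A}$ is a subfunctor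 of $\mathcal{A}(-,-):\mathcal{A}^{\mathrm{op}}\times\mathcal{A}\to\mathbf{Ab}$; $\mathcal{A}/\mathcal{I}$ has the same objects and morphisms $\mathcal{A}(x,y)/\mathcal{I}(x,y)$. The ideal is $k$-cotrivial if $\mathcal{A}/\mathcal{I}$ is $k$-trivial. A functor $F:\mathcal{A}\to k\text{-}\mathbf{Mod}$ is antipolynomial if it factors through the quotient functor $\mathcal{A}\to\mathcal{A}/\mathcal{I}$ for some $k$-cotrivial ideal $\mathcal{I}$. $F$ is polynomial (Eilenberg–Mac Lane) if its $d$-th cross-effect vanishes for some $d\ge 0$, where for $d\geq 1$ the $d$-th cross-effect at $(x_1,\dots,x_d)$ is the intersection of the kernels of the maps $F(x_1\oplus\cdots\oplus x_d)\to F(\bigoplus_{i\neq j}x_i)$, $1\le j\le d$, induced by the projections. A bifunctor $B$ on $\mathcal{A}\times\mathcal{A}$ is of AP-type if for every object $x$ the functor $y\mapsto B(y,x)$ is antipolynomial and the functor $y\mapsto B(x,y)$ is polynomial. The same definitions are applied to $\mathcal{A}^{\mathrm{op}}$ for contravariant bifunctors. *)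

(* Defs.v *)
From HB Require Import structures.
From mathcomp Require Import all_boot all_order all_algebra.
From mathcomp Require Import generic_quotient ring_quotient.
From mathcomp Require Import boolp classical_sets functions cardinality fsbigop.

Set Implicit Arguments.
Unset Strict Implicit.
Unset Printing Implicit Defensive.

Import GRing.Theory.
Local Open Scope classical_set_scope.
Local Open Scope ring_scope.
Local Open Scope quotient_scope.

Section Linear.
Context {k : pzRingType}.
Implicit Types L M N : lmodType k.

Definition mklin M N (f : M -> N) (fL : linear f) : {linear M -> N} :=
  HB.pack f (GRing.isLinear.Build k M N *:%R f fL).

Lemma linear_ext M N (f g : {linear M -> N}) : f =1 g -> f = g.
Proof.
case: f g => [f cf] [g cg] /funext /= fg; subst g; congr GRing.Linear.Pack.
case: cf cg => [[a] [b]] [[c] [d]].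
by rewrite (Prop_irrelevance a c) (Prop_irrelevance b d).
Qed.

Definition lin_id M : {linear M -> M} := idfun.
Definition lin_comp L M N (g : {linear M -> N}) (f : {linear L -> M}) :
  {linear L -> N} := g \o f.
Lemma lin_compE L M N (g : {linear M -> N}) (f : {linear L -> M}) x :
  lin_comp g f x = g (f x).
Proof. by []. Qed.

End Linear.

Section Submodules.
Context {k : comPzRingType}.
Implicit Types L M N : lmodType k.

(** Predicates are boolean, but classical logic makes any submodule boolean;
    likewise for [ideal] below. *)
Record submod M := Submod {
  smem :> {pred M};
  smemP : submod_closed smem
}.

HB.instance Definition _ M (S : submod M) :=
  GRing.isSubmodClosed.Build k M (smem S) (smemP S).

Definition submodT M (S : submod M) : Type := {x : M | x \in smem S}.
HB.instance Definition _ M (S : submod M) := SubType.on (submodT S).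
HB.instance Definition _ M (S : submod M) := [Choice of submodT S by <:].
HB.instance Definition _ M (S : submod M) :=
  [SubChoice_isSubLmodule of submodT S by <:].

Definition sub_incl M (S : submod M) : {linear submodT S -> M} := val.

Lemma sub_corestr_linear M N (S : submod N) (f : {linear M -> N})
  (fS : forall x, f x \in smem S) :
  linear (fun x => exist _ (f x) (fS x) : submodT S).
Proof. by move=> a x y; apply: val_inj => /=; rewrite linearP. Qed.
Definition sub_corestr M N S f fS : {linear M -> submodT S} :=
  mklin (@sub_corestr_linear M N S f fS).

Lemma zero_submod_closed M : submod_closed (fun x : M => x == 0).
Proof.
split=> [|a x y]; rewrite unfold_in ?eqxx //.
by move=> /eqP-> /eqP->; rewrite unfold_in scaler0 addr0.
Qed.
Definition zero_submod M := Submod (@zero_submod_closed M).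
Lemma mem_zero_submod M x : x \in smem (zero_submod M) <-> x = 0.
Proof. by split=> /eqP. Qed.

Lemma full_submod_closed M : submod_closed (fun _ : M => true).
Proof. by []. Qed.
Definition full_submod M := Submod (@full_submod_closed M).
Lemma mem_full_submod M x : x \in smem (full_submod M). Proof. by []. Qed.

Lemma kerm_closed M N (f : {linear M -> N}) :
  submod_closed (fun x => f x == 0).
Proof.
split=> [|a x y]; rewrite !unfold_in ?linear0 //.
by move=> /eqP fx /eqP fy; rewrite linearP fx fy scaler0 addr0.
Qed.
Definition kerm M N (f : {linear M -> N}) := Submod (kerm_closed f).
Lemma mem_kerm M N (f : {linear M -> N}) x : x \in smem (kerm f) <-> f x = 0.
Proof. by split=> /eqP. Qed.

Lemma imm_closed M N (f : {linear M -> N}) :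
  submod_closed (fun y => `[< exists x, f x = y >]).
Proof.
split=> [|a x y]; rewrite !unfold_in.
  by apply/asboolP; exists 0; exact: linear0.
move=> /asboolP[u <-] /asboolP[v <-]; apply/asboolP.
by exists (a *: u + v); rewrite linearP.
Qed.
Definition imm M N (f : {linear M -> N}) := Submod (imm_closed f).
Lemma mem_imm M N (f : {linear M -> N}) y :
  y \in smem (imm f) <-> exists x, f x = y.
Proof. by split=> /asboolP. Qed.

Lemma preim_submod_closed M N (f : {linear M -> N}) (S : submod N) :
  submod_closed (fun x => f x \in smem S).
Proof.
split=> [|a x y]; first by have := rpred0 (smem S); rewrite -(linear0 f).
move=> fx fy; suff: f (a *: x + y) \in smem S by [].
by rewrite linearP rpredD ?rpredZ.
Qed.
Definition preim_submod M N (f : {linear M -> N}) (S : submod N) :=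
  Submod (preim_submod_closed f S).

Inductive spanned M (X : set M) : M -> Prop :=
  | span0 : spanned X 0
  | span_gen x : X x -> spanned X x
  | span_lin a u v : spanned X u -> spanned X v -> spanned X (a *: u + v).

Lemma span_closed M (X : set M) : submod_closed (fun x => `[< spanned X x >]).
Proof.
split=> [|a x y]; rewrite !unfold_in; first by apply/asboolP; exact: span0.
by move=> /asboolP ? /asboolP ?; apply/asboolP; exact: span_lin.
Qed.
Definition span_submod M (X : set M) := Submod (span_closed X).
Lemma mem_span_submod M (X : set M) x :
  x \in smem (span_submod X) <-> spanned X x.
Proof. by split=> /asboolP. Qed.

Definition quotm M (S : submod M) : Type := Quotient.quot (smem S).
HB.instance Definition _ M (S : submod M) := GRing.Zmodule.on (quotm S).
HB.instance Definition _ M (S : submod M) :=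
  EqQuotient.on (quotm S).

Section QuotLmod.
Variables (M : lmodType k) (S : submod M).
Implicit Types (x y : M) (q : quotm S).

Lemma quotm_eq x y : \pi_(quotm S) x = \pi_(quotm S) y <-> x - y \in smem S.
Proof. by rewrite (rwP eqP) piE. Qed.

Lemma quotm_surj q : exists x, \pi_(quotm S) x = q.
Proof. by exists (repr q); rewrite reprK. Qed.

Lemma quotmP (x : M) : repr (\pi_(quotm S) x) - x \in smem S.
Proof. by apply/quotm_eq; rewrite reprK. Qed.

Lemma quotmD x y : \pi_(quotm S) (x + y) = \pi_(quotm S) x + \pi_(quotm S) y.
Proof. by rewrite !piE. Qed.

Definition quotm_scale (a : k) q : quotm S := \pi_(quotm S) (a *: repr q).

Lemma quotm_scale_pi a x :
  quotm_scale a (\pi_(quotm S) x) = \pi_(quotm S) (a *: x).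
Proof. by apply/quotm_eq; rewrite -scalerBr rpredZ // quotmP. Qed.

Lemma quotm_scaleA a b q :
  quotm_scale a (quotm_scale b q) = quotm_scale (a * b) q.
Proof. by have [x <-] := quotm_surj q; rewrite !quotm_scale_pi scalerA. Qed.
Lemma quotm_scale1 : left_id 1 quotm_scale.
Proof.
by move=> q; have [x <-] := quotm_surj q; rewrite quotm_scale_pi scale1r.
Qed.
Lemma quotm_scaleDr : right_distributive quotm_scale +%R.
Proof.
move=> a p q; have [x <-] := quotm_surj p; have [y <-] := quotm_surj q.
by rewrite -quotmD !quotm_scale_pi scalerDr quotmD.
Qed.
Lemma quotm_scaleDl q : {morph quotm_scale^~ q : a b / a + b}.
Proof.
move=> a b; have [x <-] := quotm_surj q.
by rewrite !quotm_scale_pi scalerDl quotmD.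
Qed.
HB.instance Definition _ := GRing.Zmodule_isLmodule.Build k (quotm S)
  quotm_scaleA quotm_scale1 quotm_scaleDr quotm_scaleDl.

Lemma quotm_pi_linear : linear (\pi_(quotm S) : M -> quotm S).
Proof. by move=> a x y; rewrite quotmD -quotm_scale_pi. Qed.
Definition quotm_pi : {linear M -> quotm S} := mklin quotm_pi_linear.

Section Lift.
Variables (N : lmodType k) (f : {linear M -> N}).
Hypothesis fS : forall x, x \in smem S -> f x = 0.

Lemma quotm_lift_pi x : f (repr (\pi_(quotm S) x)) = f x.
Proof. by apply/eqP; rewrite -subr_eq0 -linearB; apply/eqP/fS/quotmP. Qed.

Lemma quotm_lift_linear : linear (fun q => f (repr q)).
Proof.
move=> a p q; have [x <-] := quotm_surj p; have [y <-] := quotm_surj q.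
by rewrite -(quotm_pi_linear a x y) !quotm_lift_pi linearP.
Qed.
Definition quotm_lift : {linear quotm S -> N} := mklin quotm_lift_linear.
Lemma quotm_liftE x : quotm_lift (quotm_pi x) = f x.
Proof. exact: quotm_lift_pi. Qed.
End Lift.

End QuotLmod.

(** The subquotient [Z / (Z \cap B)]. *)
Definition subquot M (Z B : submod M) : lmodType k :=
  quotm (preim_submod (sub_incl Z) B).

Section SubquotMap.
Variables (M N : lmodType k) (Z B : submod M) (Z' B' : submod N).
Variables (h : {linear M -> N}).
Hypothesis hZ : forall x, x \in smem Z -> h x \in smem Z'.
Hypothesis hB : forall x, x \in smem B -> h x \in smem B'.

Let hZ' (z : submodT Z) : lin_comp h (sub_incl Z) z \in smem Z'.
Proof. exact/hZ/(valP z). Qed.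

Let hl := lin_comp (quotm_pi (preim_submod (sub_incl Z') B')) (sub_corestr hZ').

Let hl0 z : z \in smem (preim_submod (sub_incl Z) B) -> hl z = 0.
Proof.
move=> zB; rewrite -[RHS](linear0 (quotm_pi _)).
by apply/quotm_eq; rewrite subr0 unfold_in; exact: hB.
Qed.

Definition subquot_map : {linear subquot Z B -> subquot Z' B'} :=
  quotm_lift hl0.
End SubquotMap.

(** The free module [k[T]]: finitely supported functions [T -> k]. *)
Section Free.
Variable T : Type.

Lemma finsupp_closed :
  submod_closed (fun phi : T -> k^o => `[< finite_set [set t | phi t != 0] >]).
Proof.
split=> [|a u v]; rewrite !unfold_in.
  apply/asboolP; apply: (@sub_finite_set _ _ set0) => // t /=.
  by rewrite eqxx.
move=> /asboolP fu /asboolP fv; apply/asboolP.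
apply: (@sub_finite_set _ _ ([set t | u t != 0] `|` [set t | v t != 0])).
  move=> t; rewrite /= -[(a *: u + v) t]/(a * u t + v t).
  have [->|] := eqVneq (u t) 0; last by left.
  have [->|] := eqVneq (v t) 0; last by right.
  by rewrite mulr0 addr0 eqxx.
by rewrite finite_setU.
Qed.

Definition freemod : lmodType k := submodT (Submod finsupp_closed).

Definition delta_fun (t : T) : T -> k^o := fun u => (`[< u = t >])%:R.
Lemma delta_finsupp t : delta_fun t \in smem (Submod finsupp_closed).
Proof.
rewrite unfold_in; apply/asboolP.
apply: (@sub_finite_set _ _ [set t]) => // u /=.
by rewrite /delta_fun; case: asboolP => // _; rewrite eqxx.
Qed.
Definition delta t : freemod := exist _ (delta_fun t) (delta_finsupp t).

Lemma free_supp (phi : freemod) :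
  exists2 s : seq {classic T}, uniq s & forall t, t \notin s -> val phi t = 0.
Proof.
have /asboolP/(@finite_seqP {classic T})[s es] := valP phi.
exists (undup s); first exact: undup_uniq.
move=> t; rewrite mem_undup => ts; apply/eqP; apply: contraNT ts => nz.
suff : [set` s] t by [].
by rewrite -es.
Qed.

Section FreeLift.
Variables (M : lmodType k) (f : T -> M).

Definition free_lift_fun (phi : freemod) : M :=
  \sum_(t \in [set: {classic T}]) val phi t *: f t.

Lemma free_lift_sum (phi : freemod) (s : seq {classic T}) : uniq s ->
  (forall t, t \notin s -> val phi t = 0) ->
  free_lift_fun phi = \sum_(t <- s) val phi t *: f t.
Proof.
move=> us s0; rewrite /free_lift_fun (bigfs _ us).
  by apply: eq_fsbigl; apply/seteqP.
by move=> t _ /s0->; rewrite scale0r.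
Qed.

Lemma free_lift_linear : linear free_lift_fun.
Proof.
move=> a x y; have [s us s0] := free_supp x; have [r ur r0] := free_supp y.
pose l := undup (s ++ r).
have lx t : t \notin l -> val x t = 0.
  by rewrite mem_undup mem_cat => /norP[/s0].
have ly t : t \notin l -> val y t = 0.
  by rewrite mem_undup mem_cat => /norP[_ /r0].
have ul : uniq l by exact: undup_uniq.
have e t : val (a *: x + y) t = a * val x t + val y t.
  by rewrite -[val _]/(sub_incl _ _) linearP.
rewrite !(free_lift_sum ul) //; last first.
  by move=> t tl; rewrite e lx // ly // mulr0 addr0.
rewrite scaler_sumr -big_split /=; apply: eq_bigr => t _.
by rewrite [X in X *: _]e scalerDl scalerA.
Qed.
Definition free_lift : {linear freemod -> M} := mklin free_lift_linear.

Lemma free_lift_delta t : free_lift (delta t) = f t.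
Proof.
rewrite /= (@free_lift_sum _ [:: t : {classic T}]) //.
  by rewrite big_seq1 /= /delta_fun asboolT // scale1r.
by move=> u; rewrite inE => /eqP ut; rewrite /= /delta_fun asboolF.
Qed.
End FreeLift.

Lemma free_ext (M : lmodType k) (f g : {linear freemod -> M}) :
  (forall t, f (delta t) = g (delta t)) -> f =1 g.
Proof.
move=> fg x; have [s us s0] := free_supp x.
suff -> : x = \sum_(t <- s) val x t *: delta t.
  by rewrite !linear_sum; apply: eq_bigr => t _; rewrite !linearZ /= fg.
have le := free_lift_sum delta us s0.
apply: val_inj; apply/funext => u.
have -> : val (\sum_(t <- s) val x t *: delta t) u
        = \sum_(t <- s) val x t * delta_fun t u.
  elim: (s) => [|t r IH]; first by rewrite !big_nil.
  by rewrite !big_cons -IH.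
have [us'|us'] := boolP ((u : {classic T}) \in s).
  rewrite (bigD1_seq (u : {classic T})) //= big1 ?addr0.
    by rewrite /delta_fun asboolT // mulr1.
  move=> t tu; rewrite /delta_fun asboolF ?mulr0 // => ut.
  by move: tu; rewrite ut eqxx.
rewrite s0 // big1_seq // => t /andP[_ ts].
rewrite /delta_fun asboolF ?mulr0 // => ut.
by move: us'; rewrite ut ts.
Qed.
End Free.

End Submodules.

Arguments freemod k T : clear implicits.

Record category := Category {
  obj :> Type;
  hom : obj -> obj -> Type;
  idm : forall x, hom x x;
  cmp : forall x y z, hom y z -> hom x y -> hom x z;
  cmpA : forall x y z t (h : hom z t) (g : hom y z) (f : hom x y),
    cmp h (cmp g f) = cmp (cmp h g) f;
  cmp1m : forall x y (f : hom x y), cmp (idm y) f = f;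
  cmpm1 : forall x y (f : hom x y), cmp f (idm x) = f
}.
Arguments hom {c}.
Arguments idm {c}.
Arguments cmp {c x y z}.

Record functor (C D : category) := Functor {
  fobj :> C -> D;
  fhom : forall x y, hom x y -> hom (fobj x) (fobj y);
  fhom1 : forall x, fhom (idm x) = idm (fobj x);
  fhomM : forall x y z (g : hom y z) (f : hom x y),
    fhom (cmp g f) = cmp (fhom g) (fhom f)
}.
Arguments fhom {C D} _ {x y} _.

Definition opc (C : category) : category :=
  @Category C (fun x y => hom y x) (@idm C)
    (fun x y z g f => cmp f g)
    (fun x y z t h g f => esym (cmpA f g h))
    (fun x y f => cmpm1 f)
    (fun x y f => cmp1m f).

Definition opf C D (phi : functor C D) : functor (opc C) (opc D) :=
  @Functor (opc C) (opc D) phi (fun x y f => fhom phi f) (fhom1 phi)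
    (fun x y z g f => fhomM phi f g).

Section Product.
Variables C D : category.

Let phom (x y : C * D) : Type := hom x.1 y.1 * hom x.2 y.2.
Let pcmp (x y z : C * D) (g : phom y z) (f : phom x y) : phom x z :=
  (cmp g.1 f.1, cmp g.2 f.2).
Let pcmpA x y z t (h : phom z t) (g : phom y z) (f : phom x y) :
  pcmp h (pcmp g f) = pcmp (pcmp h g) f.
Proof. by rewrite /pcmp /= !cmpA. Qed.
Let pcmp1m (x y : C * D) (f : phom x y) : pcmp (idm y.1, idm y.2) f = f.
Proof. by case: f => f g; rewrite /pcmp /= !cmp1m. Qed.
Let pcmpm1 (x y : C * D) (f : phom x y) : pcmp f (idm x.1, idm x.2) = f.
Proof. by case: f => f g; rewrite /pcmp /= !cmpm1. Qed.

Definition prodc : category :=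
  @Category (C * D) phom (fun x => (idm x.1, idm x.2)) pcmp
    pcmpA pcmp1m pcmpm1.

End Product.

Definition op_prod C D : functor (opc (prodc C D)) (prodc (opc C) (opc D)) :=
  @Functor (opc (prodc C D)) (prodc (opc C) (opc D)) id (fun x y f => f)
    (fun x => erefl) (fun x y z g f => erefl).

Definition diag (C : category) : functor C (prodc C C) :=
  @Functor C (prodc C C) (fun a => (a, a)) (fun x y f => (f, f))
    (fun x => erefl) (fun x y z g f => erefl).

Definition slice_l (C D : category) (d : D) : functor C (prodc C D) :=
  @Functor C (prodc C D) (fun y => (y, d)) (fun x y f => (f, idm d))
    (fun x => erefl) (fun x y z g f => congr1 (pair _) (esym (cmp1m _))).

Definition slice_r (C D : category) (c : C) : functor D (prodc C D) :=
  @Functor D (prodc C D) (fun y => (c, y)) (fun x y f => (idm c, f))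
    (fun x => erefl) (fun x y z g f => congr1 (pair^~ _) (esym (cmp1m _))).

Section FunctorModules.
Context {k : comPzRingType}.

Record kfun (C : category) := KFun {
  kobj :> C -> lmodType k;
  kmap : forall x y, hom x y -> {linear kobj x -> kobj y};
  kmap1 : forall x v, kmap (idm x) v = v;
  kmapM : forall x y z (g : hom y z) (f : hom x y) v,
    kmap (cmp g f) v = kmap g (kmap f v)
}.
Arguments kmap {C} _ {x y} _.

Record nat_trans C (F G : kfun C) := NatTrans {
  ncomp :> forall x, {linear F x -> G x};
  ncompN : forall x y (f : hom x y) v,
    ncomp y (kmap F f v) = kmap G f (ncomp x v)
}.

Section Hom.
Context {C : category}.
Implicit Types F G H : kfun C.

Lemma nat_ext F G (a b : nat_trans F G) : (forall x, a x =1 b x) -> a = b.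
Proof.
case: a b => [a aN] [b bN] /= ab.
have e : a = b.
  by apply: functional_extensionality_dep => x; exact/linear_ext/ab.
by subst b; rewrite (Prop_irrelevance aN bN).
Qed.

Definition nat_id F : nat_trans F F :=
  @NatTrans C F F (fun x => lin_id (F x)) (fun x y f v => erefl).

Lemma nat_comp_subproof F G H (b : nat_trans G H) (a : nat_trans F G)
    x y (f : hom x y) v :
  lin_comp (b y) (a y) (kmap F f v) = kmap H f (lin_comp (b x) (a x) v).
Proof. by rewrite /= !ncompN. Qed.
Definition nat_comp F G H (b : nat_trans G H) (a : nat_trans F G) :
  nat_trans F H := NatTrans (nat_comp_subproof b a).

Section HomLmod.
Variables F G : kfun C.
Implicit Types a b : nat_trans F G.

HB.instance Definition _ := gen_eqMixin (nat_trans F G).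
HB.instance Definition _ := gen_choiceMixin (nat_trans F G).

Lemma nat_zero_linear x : linear (fun _ : F x => 0 : G x).
Proof. by move=> c u v; rewrite scaler0 addr0. Qed.
Lemma nat_zeroN x y (f : hom x y) v :
  mklin (@nat_zero_linear y) (kmap F f v)
  = kmap G f (mklin (@nat_zero_linear x) v).
Proof. by rewrite /= linear0. Qed.
Definition nat_zero : nat_trans F G := NatTrans nat_zeroN.

Lemma nat_add_linear a b x : linear (fun v => a x v + b x v).
Proof. by move=> c u v; rewrite !linearP scalerDr addrACA. Qed.
Lemma nat_addN a b x y (f : hom x y) v :
  mklin (@nat_add_linear a b y) (kmap F f v)
  = kmap G f (mklin (@nat_add_linear a b x) v).
Proof. by rewrite /= !ncompN linearD. Qed.
Definition nat_add a b : nat_trans F G := NatTrans (nat_addN a b).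

Lemma nat_scale_linear (c : k) a x : linear (fun v => c *: a x v).
Proof. by move=> d u v; rewrite linearP scalerDr !scalerA mulrC. Qed.
Lemma nat_scaleN c a x y (f : hom x y) v :
  mklin (@nat_scale_linear c a y) (kmap F f v)
  = kmap G f (mklin (@nat_scale_linear c a x) v).
Proof. by rewrite /= !ncompN linearZ. Qed.
Definition nat_scale c a : nat_trans F G := NatTrans (nat_scaleN c a).

Definition nat_opp a : nat_trans F G := nat_scale (-1) a.

Lemma nat_addA : associative nat_add.
Proof. by move=> a b c; apply: nat_ext => x v /=; rewrite addrA. Qed.
Lemma nat_addC : commutative nat_add.
Proof. by move=> a b; apply: nat_ext => x v /=; rewrite addrC. Qed.
Lemma nat_add0 : left_id nat_zero nat_add.
Proof. by move=> a; apply: nat_ext => x v /=; rewrite add0r. Qed.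
Lemma nat_addNr : left_inverse nat_zero nat_opp nat_add.
Proof. by move=> a; apply: nat_ext => x v /=; rewrite scaleN1r addNr. Qed.
HB.instance Definition _ := GRing.isZmodule.Build (nat_trans F G)
  nat_addA nat_addC nat_add0 nat_addNr.

Lemma nat_scaleA c d a : nat_scale c (nat_scale d a) = nat_scale (c * d) a.
Proof. by apply: nat_ext => x v /=; rewrite scalerA. Qed.
Lemma nat_scale1 : left_id 1 nat_scale.
Proof. by move=> a; apply: nat_ext => x v /=; rewrite scale1r. Qed.
Lemma nat_scaleDr : right_distributive nat_scale +%R.
Proof. by move=> c a b; apply: nat_ext => x v /=; rewrite scalerDr. Qed.
Lemma nat_scaleDl a : {morph nat_scale^~ a : c d / c + d}.
Proof. by move=> c d; apply: nat_ext => x v /=; rewrite scalerDl. Qed.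
HB.instance Definition _ := GRing.Zmodule_isLmodule.Build k (nat_trans F G)
  nat_scaleA nat_scale1 nat_scaleDr nat_scaleDl.

End HomLmod.

Lemma hom_pre_linear F G H (a : nat_trans F G) :
  linear (fun b : nat_trans G H => nat_comp b a).
Proof. by move=> c u v; apply: nat_ext. Qed.
Definition hom_pre F G H (a : nat_trans F G) :
  {linear nat_trans G H -> nat_trans F H} := mklin (@hom_pre_linear F G H a).

(** Epimorphisms, exactness and isomorphisms in [k[C]-Mod] are objectwise. *)
Definition epi F G (a : nat_trans F G) :=
  forall x (w : G x), exists v, a x v = w.

Definition exact_at F G H (a : nat_trans F G) (b : nat_trans G H) :=
  forall x (v : G x), b x v = 0 <-> exists u, a x u = v.

Definition projective F := forall G H (p : nat_trans G H) (a : nat_trans F H),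
  epi p -> exists b : nat_trans F G, nat_comp p b = a.

Definition nat_iso F G := exists a : nat_trans F G, forall x, bijective (a x).

Record resolution F := Resolution {
  res_obj :> nat -> kfun C;
  resd : forall n, nat_trans (res_obj n.+1) (res_obj n);
  resa : nat_trans (res_obj 0) F;
  resa_epi : epi resa;
  res_exact0 : exact_at (resd 0) resa;
  res_exactS : forall n, exact_at (resd n.+1) (resd n)
}.
Arguments resd {F} _ _.
Arguments resa {F} _.

Definition proj_resolution F (P : resolution F) := forall n, projective (P n).

Section FreeCover.
Variable F : kfun C.

Definition cover_gen (y : C) : Type := {x : C & (F x * hom x y)%type}.

Definition cover_act y z (f : hom y z) (t : cover_gen y) :
  freemod k (cover_gen z) :=
  delta (existT _ (tag t) ((tagged t).1, cmp f (tagged t).2)).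

Lemma cover_map1 y v : free_lift (cover_act (idm y)) v = v.
Proof.
rewrite -[RHS]/(lin_id _ v); apply: free_ext => -[x [s g]].
by rewrite free_lift_delta /cover_act /= cmp1m.
Qed.
Lemma cover_mapM y z t (g : hom z t) (f : hom y z) v :
  free_lift (cover_act (cmp g f)) v
  = free_lift (cover_act g) (free_lift (cover_act f) v).
Proof.
rewrite -[RHS]/(lin_comp (free_lift _) (free_lift _) v).
apply: free_ext => -[x [s h]].
by rewrite lin_compE !free_lift_delta /cover_act /= cmpA.
Qed.

(** The direct sum, over all objects [x] and all [s] in [F x], of the
    functors [y |-> k[C(x,y)]]. *)
Definition cover : kfun C :=
  @KFun C (fun y => freemod k (cover_gen y))
    (fun y z f => free_lift (cover_act f)) cover_map1 cover_mapM.

Lemma cover_mapE y z (f : hom y z) t : kmap cover f (delta t) = cover_act f t.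
Proof. exact: free_lift_delta. Qed.

Definition cover_eval y (t : cover_gen y) : F y :=
  kmap F (tagged t).2 (tagged t).1.

Lemma cover_augN y z (f : hom y z) v :
  free_lift (@cover_eval z) (kmap cover f v)
  = kmap F f (free_lift (@cover_eval y) v).
Proof.
rewrite -[LHS]/(lin_comp (free_lift _) (kmap cover f) v).
rewrite -[RHS]/(lin_comp (kmap F f) (free_lift _) v).
apply: free_ext => -[x [s g]].
rewrite !lin_compE cover_mapE !free_lift_delta.
by rewrite /cover_eval /= kmapM.
Qed.
Definition cover_aug : nat_trans cover F := NatTrans cover_augN.

Lemma cover_aug_epi : epi cover_aug.
Proof.
move=> x s; exists (delta (existT _ x (s, idm x))).
by rewrite -[LHS]/(free_lift _ _) free_lift_delta /cover_eval kmap1.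
Qed.

Lemma cover_projective : projective cover.
Proof.
move=> G H p a pE.
have ex : forall xs : {x : C & F x}, exists v : G (tag xs),
    p (tag xs) v = a (tag xs) (delta (existT _ (tag xs) (tagged xs, idm _))).
  by move=> xs; exact: pE.
pose c xs := sval (cid (ex xs)); have cP xs := svalP (cid (ex xs)).
pose b y (t : cover_gen y) : G y :=
  kmap G (tagged t).2 (c (existT _ (tag t) (tagged t).1)).
have bN y z (f : hom y z) v :
    free_lift (@b z) (kmap cover f v) = kmap G f (free_lift (@b y) v).
  rewrite -[LHS]/(lin_comp (free_lift _) (kmap cover f) v).
  rewrite -[RHS]/(lin_comp (kmap G f) (free_lift _) v).
  apply: free_ext => -[x [s g]].
  by rewrite !lin_compE cover_mapE !free_lift_delta
             /b /= kmapM.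
exists (NatTrans bN); apply: nat_ext => y; apply: free_ext => -[x [s g]].
rewrite -[LHS]/(p y (free_lift (@b y) _)) free_lift_delta /b /=.
rewrite ncompN [X in kmap H g X](cP (existT _ x s)) -ncompN.
rewrite cover_mapE /cover_act /=.
by rewrite cmpm1.
Qed.

End FreeCover.

Section Kernel.
Variables (F G : kfun C) (a : nat_trans F G).

Lemma ker_map_sub x y (f : hom x y) (v : submodT (kerm (a x))) :
  lin_comp (kmap F f) (sub_incl _) v \in smem (kerm (a y)).
Proof.
have /eqP av : val v \in smem (kerm (a x)) := valP v.
by rewrite unfold_in /= ncompN av linear0.
Qed.
Lemma ker_map1 x v : sub_corestr (ker_map_sub (idm x)) v = v.
Proof. by apply: val_inj; rewrite /= kmap1. Qed.
Lemma ker_mapM x y z (g : hom y z) (f : hom x y) v :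
  sub_corestr (ker_map_sub (cmp g f)) v
  = sub_corestr (ker_map_sub g) (sub_corestr (ker_map_sub f) v).
Proof. by apply: val_inj; rewrite /= kmapM. Qed.
Definition nat_ker : kfun C :=
  @KFun C (fun x => submodT (kerm (a x)))
    (fun x y f => sub_corestr (ker_map_sub f)) ker_map1 ker_mapM.
Definition nat_ker_incl : nat_trans nat_ker F :=
  @NatTrans C nat_ker F (fun x => sub_incl _) (fun x y f v => erefl).

End Kernel.

Fixpoint syzygy F n : kfun C :=
  if n is m.+1 then nat_ker (cover_aug (syzygy F m)) else F.

Definition std_d F n :
  nat_trans (cover (syzygy F n.+1)) (cover (syzygy F n)) :=
  nat_comp (nat_ker_incl (cover_aug (syzygy F n)))
           (cover_aug (syzygy F n.+1)).

Lemma std_exact0 F : exact_at (std_d F 0) (cover_aug F).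
Proof.
move=> x v; split=> [av|[u <-]].
  have vk : v \in smem (kerm (cover_aug F x)) by exact/eqP.
  have [u uv] := cover_aug_epi (exist _ v vk : syzygy F 1 x).
  by exists u; rewrite -[LHS]/(val (cover_aug (syzygy F 1) x u)) uv.
by have /eqP := valP (cover_aug (syzygy F 1) x u).
Qed.

Lemma std_exactS F n : exact_at (std_d F n.+1) (std_d F n).
Proof.
move=> x v; have e : std_d F n x v = val (cover_aug (syzygy F n.+1) x v) by [].
have [h1 h2] := @std_exact0 (syzygy F n.+1) x v; rewrite e.
by split=> [dv|/h2-> //]; apply: h1; exact: val_inj.
Qed.

Definition std_resolution F : resolution F :=
  @Resolution F (fun n => cover (syzygy F n)) (std_d F) (cover_aug F)
    (@cover_aug_epi F) (@std_exact0 F) (@std_exactS F).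

Lemma std_resolution_proj F : proj_resolution (std_resolution F).
Proof. by move=> n; exact: cover_projective. Qed.

Definition chain_lift F (Q P : resolution F)
    (f : forall n, nat_trans (Q n) (P n)) :=
  nat_comp (resa P) (f 0) = resa Q /\
  forall n, nat_comp (resd P n) (f n.+1) = nat_comp (f n) (resd Q n).

Section Corestriction.
Variables (R F G : kfun C) (b : nat_trans F G) (c : nat_trans R F).
Hypothesis bc : forall x v, b x (c x v) = 0.

Lemma ker_corestr_sub x v : c x v \in smem (kerm (b x)).
Proof. exact/eqP/bc. Qed.
Lemma ker_corestrN x y (f : hom x y) v :
  sub_corestr (@ker_corestr_sub y) (kmap R f v)
  = kmap (nat_ker b) f (sub_corestr (@ker_corestr_sub x) v).
Proof. by apply: val_inj; rewrite /= ncompN. Qed.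
Definition nat_ker_corestr : nat_trans R (nat_ker b) :=
  @NatTrans C R (nat_ker b) (fun x => sub_corestr (@ker_corestr_sub x))
    ker_corestrN.
End Corestriction.

Lemma projective_exact R F G H (a : nat_trans F G) (b : nat_trans G H)
    (c : nat_trans R G) :
  projective R -> exact_at a b -> (forall x v, b x (c x v) = 0) ->
  exists c', nat_comp a c' = c.
Proof.
move=> Rp ab bc.
have ba x v : b x (a x v) = 0 by apply/ab; exists v.
have ae : epi (nat_ker_corestr ba).
  move=> x [v /= vk]; have /ab[u uv] : b x v = 0 by exact/eqP.
  by exists u; exact: val_inj.
have [c' c'E] := Rp _ _ _ (nat_ker_corestr bc) ae.
exists c'; apply: nat_ext => x v.
exact: (congr1 (fun e : nat_trans R (nat_ker b) => val (e x v)) c'E).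
Qed.

Section ChainLift.
Variables (F : kfun C) (Q P : resolution F).
Hypothesis Qproj : proj_resolution Q.

Let square n := {fg : nat_trans (Q n) (P n) * nat_trans (Q n.+1) (P n.+1) |
  nat_comp (resd P n) fg.2 = nat_comp fg.1 (resd Q n)}.

Let square_ex0 : exists s : square 0, nat_comp (resa P) (sval s).1 = resa Q.
Proof.
have [f fE] := @Qproj 0 _ _ _ (resa Q) (@resa_epi _ P).
have [x v|g gE] := @projective_exact _ _ _ _ _ _ (nat_comp f (resd Q 0))
  (@Qproj 1) (@res_exact0 _ P).
  rewrite -[LHS]/(nat_comp (resa P) f x (resd Q 0 x v)) fE.
  by apply/(@res_exact0 _ Q); exists v.
by exists (exist _ (f, g) gE).
Qed.

Let square_exS n (s : square n) :
  exists s' : square n.+1, (sval s').1 = (sval s).2.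
Proof.
case: s => -[f g] /= fg.
have [x v|h hE] := @projective_exact _ _ _ _ _ _ (nat_comp g (resd Q n.+1))
  (@Qproj n.+2) (@res_exactS _ P n).
  rewrite -[LHS]/(nat_comp (resd P n) g x (resd Q n.+1 x v)) fg.
  rewrite -[LHS]/(f x (resd Q n x (resd Q n.+1 x v))).
  have -> : resd Q n x (resd Q n.+1 x v) = 0.
    by apply/(@res_exactS _ Q); exists v.
  exact: linear0.
by exists (exist _ (g, h) hE).
Qed.

Lemma chain_lift_exists : exists f, @chain_lift F Q P f.
Proof.
have [s0 s0E] := square_ex0.
pose s := fix s n : square n :=
  if n is m.+1 then sval (cid (square_exS (s m))) else s0.
exists (fun n => (sval (s n)).1); split=> // n.
by rewrite [s n.+1]/= (svalP (cid (square_exS (s n)))) (svalP (s n)).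
Qed.
End ChainLift.

End Hom.

Section Pull.
Context {C D : category} (phi : functor C D).

Lemma pull_map1 (F : kfun D) x v : kmap F (fhom phi (idm x)) v = v.
Proof. by rewrite fhom1 kmap1. Qed.
Lemma pull_mapM (F : kfun D) x y z (g : hom y z) (f : hom x y) v :
  kmap F (fhom phi (cmp g f)) v = kmap F (fhom phi g) (kmap F (fhom phi f) v).
Proof. by rewrite fhomM kmapM. Qed.
Definition pull (F : kfun D) : kfun C :=
  @KFun C (fun x => F (phi x)) (fun x y f => kmap F (fhom phi f))
    (@pull_map1 F) (@pull_mapM F).

Definition pull_nat F G (a : nat_trans F G) : nat_trans (pull F) (pull G) :=
  @NatTrans C (pull F) (pull G) (fun x => a (phi x))
    (fun x y f v => ncompN a (fhom phi f) v).

Definition pull_resolution F (P : resolution F) : resolution (pull F) :=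
  @Resolution C (pull F) (fun n => pull (P n)) (fun n => pull_nat (resd P n))
    (pull_nat (resa P)) (fun x => @resa_epi _ _ P (phi x))
    (fun x => @res_exact0 _ _ P (phi x))
    (fun n x => @res_exactS _ _ P n (phi x)).

Lemma std_lift_exists (F : kfun D) :
  exists f, @chain_lift C (pull F) (std_resolution (pull F))
    (pull_resolution (std_resolution F)) f.
Proof. by apply: chain_lift_exists; exact: std_resolution_proj. Qed.

(** Comparison maps are unique up to homotopy, so the choice made here does not
    affect the maps induced on Ext and Tor. *)
Definition std_lift (F : kfun D) := sval (cid (std_lift_exists F)).
Definition std_liftP F : chain_lift (std_lift F) :=
  svalP (cid (std_lift_exists F)).

End Pull.

Lemma kfun_ext (C : category) (T : C -> lmodType k)
    (m m' : forall x y, hom x y -> {linear T x -> T y}) e1 eM e1' eM' :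
  m = m' -> @KFun C T m e1 eM = @KFun C T m' e1' eM'.
Proof.
move=> mm'; subst m'.
by rewrite (Prop_irrelevance e1 e1') (Prop_irrelevance eM eM').
Qed.

(** For a functor [F] contravariant in two variables, the right
    [k[C x C]]-module given by [F] restricts along the diagonal to
    [x |-> F (x, x)]. *)
Lemma pull_diag_op C (F : kfun (prodc (opc C) (opc C))) :
  pull (opf (diag C)) (pull (op_prod C C) F) = pull (diag (opc C)) F.
Proof. exact: kfun_ext. Qed.

Section Ext.
Context {C : category}.
Variables (F : kfun C) (P : resolution F) (G : kfun C).

Definition cocycles n : submod (nat_trans (P n) G) :=
  kerm (hom_pre G (resd P n)).

Definition coboundaries n : submod (nat_trans (P n) G) :=
  match n with
  | 0 => zero_submod _
  | m.+1 => imm (hom_pre G (resd P m))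
  end.

Definition Ext_of n : lmodType k := subquot (cocycles n) (coboundaries n).
End Ext.

Definition Ext C n (F G : kfun C) : lmodType k := Ext_of (std_resolution F) G n.

Section ExtRestr.
Context {C D : category} (phi : functor C D).
Variables (F : kfun D) (P : resolution F) (Q : resolution (pull phi F)).
Variables (f : forall n, nat_trans (Q n) (pull_resolution phi P n)).
Hypothesis fP : chain_lift f.
Variable G : kfun D.

Lemma Ext_restr_linear n :
  linear (fun c : nat_trans (P n) G => nat_comp (pull_nat phi c) (f n)).
Proof. by move=> a u v; apply: nat_ext. Qed.

Lemma Ext_restr_cocycles n c : c \in smem (cocycles P G n) ->
  mklin (@Ext_restr_linear n) c \in smem (cocycles Q (pull phi G) n).
Proof.
move=> /mem_kerm cP; apply/mem_kerm; apply: nat_ext => x v.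
have e := congr1 (fun e => ncomp (nat_comp (pull_nat phi c) e) x v) (fP.2 n).
apply: etrans (esym e) _.
exact: (congr1 (fun e => ncomp e (phi x) (f n.+1 x v)) cP).
Qed.

Lemma Ext_restr_coboundaries n c : c \in smem (coboundaries P G n) ->
  mklin (@Ext_restr_linear n) c \in smem (coboundaries Q (pull phi G) n).
Proof.
case: n c => [|n] c.
  by move=> c0; have /mem_zero_submod-> := c0; rewrite linear0 rpred0.
move=> /mem_imm[b <-]; apply/mem_imm.
exists (mklin (@Ext_restr_linear n) b); apply: nat_ext => x v.
exact/esym/(congr1 (fun e => ncomp (nat_comp (pull_nat phi b) e) x v) (fP.2 n)).
Qed.

Definition Ext_of_restr n :
  {linear Ext_of P G n -> Ext_of Q (pull phi G) n} :=
  subquot_map (@Ext_restr_cocycles n) (@Ext_restr_coboundaries n).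
End ExtRestr.

Definition Ext_restr C D (phi : functor C D) n (F G : kfun D) :
  {linear Ext n F G -> Ext n (pull phi F) (pull phi G)} :=
  Ext_of_restr (std_liftP phi F) G n.

Section Coend.
Context {C : category}.
Variables (F : kfun (opc C)) (G : kfun C).

Definition coend_gen : Type := {x : C & (F x * G x)%type}.
Definition coend_sym (x : C) (s : F x) (t : G x) : freemod k coend_gen :=
  delta (existT _ x (s, t)).

(** The coend of [F x (x)_k G x], presented at once: the bilinearity relations
    give the tensor products over [k], the last one is dinaturality. *)
Inductive coend_rel : freemod k coend_gen -> Prop :=
  | coend_addl x s s' t : coend_rel
      (@coend_sym x (s + s') t - (coend_sym s t + coend_sym s' t))
  | coend_addr x s t t' : coend_rel
      (@coend_sym x s (t + t') - (coend_sym s t + coend_sym s t'))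
  | coend_scalel x (a : k) s t : coend_rel
      (@coend_sym x (a *: s) t - a *: coend_sym s t)
  | coend_scaler x (a : k) s t : coend_rel
      (@coend_sym x s (a *: t) - a *: coend_sym s t)
  | coend_balance (x y : C) (f : hom x y) (s : F y) (t : G x) : coend_rel
      (coend_sym (@kmap _ F y x f s) t - coend_sym s (kmap G f t)).

Definition coend : lmodType k := quotm (span_submod coend_rel).

Definition coend_tens (x : C) (s : F x) (t : G x) : coend :=
  quotm_pi (span_submod coend_rel) (coend_sym s t).

Section CoendLift.
Variables (M : lmodType k) (h : forall x : C, F x -> G x -> M).
Hypothesis hl : forall x t, linear (fun s => @h x s t).
Hypothesis hr : forall x s, linear (@h x s).
Hypothesis hb : forall (x y : C) (f : hom x y) (s : F y) (t : G x),
  h (@kmap _ F y x f s) t = h s (kmap G f t).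

Let h' (t : coend_gen) : M := h (tagged t).1 (tagged t).2.

Lemma coend_lift0 u : u \in smem (span_submod coend_rel) -> free_lift h' u = 0.
Proof.
move=> /mem_span_submod; elim=> {u} [|u|a u v _ hu _ hv]; first exact: linear0.
  have hlZ x t a s : h (a *: s) t = a *: @h x s t.
    exact: (linearZ_LR (mklin (@hl x t)) a s).
  have hrZ x t a s : h s (a *: t) = a *: @h x s t.
    exact: (linearZ_LR (mklin (@hr x s)) a t).
  have hlD x t s s' : h (s + s') t = @h x s t + h s' t.
    exact: (linearD (mklin (@hl x t))).
  have hrD x s t t' : h s (t + t') = @h x s t + h s t'.
    exact: (linearD (mklin (@hr x s))).
  case=> [x s s' t|x s t t'|x a s t|x a s t|x y f s t];
    rewrite linearB ?linearD ?linearZ_LR !free_lift_delta /h' /=.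
  - by rewrite hlD -opprD subrr.
  - by rewrite hrD -opprD subrr.
  - by rewrite hlZ scalerN subrr.
  - by rewrite hrZ scalerN subrr.
  - by rewrite hb subrr.
by rewrite linearP hu hv scaler0 addr0.
Qed.
Definition coend_lift : {linear coend -> M} := quotm_lift coend_lift0.
Lemma coend_liftE x s t : coend_lift (coend_tens s t) = @h x s t.
Proof. by rewrite /coend_lift quotm_liftE free_lift_delta. Qed.
End CoendLift.

Lemma coend_tens_eq u v : coend_rel (u - v) ->
  quotm_pi (span_submod coend_rel) u = quotm_pi (span_submod coend_rel) v.
Proof. by move=> uv; apply/quotm_eq/mem_span_submod/span_gen. Qed.

Lemma coend_tens_linl x t : linear (fun s => @coend_tens x s t).
Proof.
move=> a u v; rewrite -[in RHS](linearZ_LR (quotm_pi _)).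
rewrite /coend_tens (coend_tens_eq (coend_addl (a *: u) v t)) linearD.
by rewrite (coend_tens_eq (coend_scalel a u t)) linearZ_LR.
Qed.
Lemma coend_tens_linr x s : linear (@coend_tens x s).
Proof.
move=> a u v; rewrite -[in RHS](linearZ_LR (quotm_pi _)).
rewrite /coend_tens (coend_tens_eq (coend_addr s (a *: u) v)) linearD.
by rewrite (coend_tens_eq (coend_scaler a s u)) linearZ_LR.
Qed.
Lemma coend_tens_balance (x y : C) (f : hom x y) (s : F y) (t : G x) :
  coend_tens (@kmap _ F y x f s) t = coend_tens s (kmap G f t).
Proof. exact/coend_tens_eq/coend_balance. Qed.

Lemma coend_ext (M : lmodType k) (f g : {linear coend -> M}) :
  (forall x s t, f (@coend_tens x s t) = g (coend_tens s t)) -> f =1 g.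
Proof.
move=> fg u; have [v <-] := quotm_surj u.
apply: (@free_ext _ _ _ (lin_comp f (quotm_pi _)) (lin_comp g (quotm_pi _))).
by move=> [x [s t]]; exact: fg.
Qed.

End Coend.
Section CoendMaps.
Context {C : category} (F : kfun (opc C)) (G G' : kfun C) (b : nat_trans G G').

Let h (x : C) (s : F x) (t : G x) : coend F G' := coend_tens s (b x t).
Let hl x t : linear (fun s => @h x s t).
Proof. by move=> a u v; rewrite /h coend_tens_linl. Qed.
Let hr x s : linear (@h x s).
Proof. by move=> a u v; rewrite /h linearP coend_tens_linr. Qed.
Let hb (x y : C) (f : hom x y) (s : F y) (t : G x) :
  h (@kmap _ F y x f s) t = h s (kmap G f t).
Proof. by rewrite /h coend_tens_balance ncompN. Qed.

Definition coend_map : {linear coend F G -> coend F G'} := coend_lift hl hr hb.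
Lemma coend_mapE (x : C) s t : coend_map (@coend_tens C F G x s t) = h s t.
Proof. exact: coend_liftE. Qed.
End CoendMaps.

Section CoendRestr.
Context {C D : category} (phi : functor C D).
Variables (F : kfun (opc D)) (G : kfun D).

Let h (x : C) (s : F (phi x)) (t : G (phi x)) : coend F G := coend_tens s t.
Let hl x t : linear (fun s => @h x s t).
Proof. exact: coend_tens_linl. Qed.
Let hr x s : linear (@h x s).
Proof. exact: coend_tens_linr. Qed.
Let hb (x y : C) (f : hom x y) s t :
  @h x (@kmap _ F (phi y) (phi x) (fhom phi f) s) t
  = @h y s (kmap G (fhom phi f) t).
Proof. exact: coend_tens_balance. Qed.

Definition coend_restr :
  {linear coend (pull (opf phi) F) (pull phi G) -> coend F G} :=
  @coend_lift C (pull (opf phi) F) (pull phi G) _ h hl hr hb.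
Lemma coend_restrE (x : C) s t :
  coend_restr (@coend_tens C (pull (opf phi) F) (pull phi G) x s t)
  = @coend_tens D F G (phi x) s t.
Proof. exact: coend_liftE. Qed.
End CoendRestr.

Section Tor.
Context {C : category}.
Variables (F : kfun (opc C)) (G : kfun C) (P : resolution G).

Definition cycles n : submod (coend F (P n)) :=
  match n with
  | 0 => full_submod _
  | m.+1 => kerm (coend_map F (resd P m))
  end.

Definition boundaries n : submod (coend F (P n)) :=
  imm (coend_map F (resd P n)).

Definition Tor_of n : lmodType k := subquot (cycles n) (boundaries n).
End Tor.

(** The derived functors of the tensor product, computed by resolving the
    covariant variable. *)
Definition Tor C n (F : kfun (opc C)) (G : kfun C) : lmodType k :=
  Tor_of F (std_resolution G) n.

Section TorRestr.
Context {C D : category} (phi : functor C D).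
Variables (F : kfun (opc D)) (G : kfun D).
Variables (P : resolution G) (Q : resolution (pull phi G)).
Variables (f : forall n, nat_trans (Q n) (pull_resolution phi P n)).
Hypothesis fP : chain_lift f.

Definition Tor_restr_chain n :
  {linear coend (pull (opf phi) F) (Q n) -> coend F (P n)} :=
  lin_comp (coend_restr phi F (P n)) (coend_map (pull (opf phi) F) (f n)).

Lemma Tor_restr_chainN n u :
  coend_map F (resd P n) (Tor_restr_chain n.+1 u)
  = Tor_restr_chain n (coend_map (pull (opf phi) F) (resd Q n) u).
Proof.
rewrite -[LHS]/(lin_comp _ (Tor_restr_chain n.+1) u).
rewrite -[RHS]/(lin_comp (Tor_restr_chain n) (coend_map _ _) u).
apply: coend_ext => x s t; rewrite !lin_compE !coend_mapE !coend_restrE.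
rewrite coend_mapE.
congr coend_tens.
exact: (congr1 (fun e => ncomp e x t) (fP.2 n)).
Qed.

Lemma Tor_restr_cycles n u : u \in smem (cycles (pull (opf phi) F) Q n) ->
  Tor_restr_chain n u \in smem (cycles F P n).
Proof.
case: n u => [|n] u; first by move=> _; exact: mem_full_submod.
move=> /mem_kerm du; apply/mem_kerm; rewrite Tor_restr_chainN du.
exact: linear0.
Qed.

Lemma Tor_restr_boundaries n u :
  u \in smem (boundaries (pull (opf phi) F) Q n) ->
  Tor_restr_chain n u \in smem (boundaries F P n).
Proof.
move=> /mem_imm[v <-]; apply/mem_imm.
by exists (Tor_restr_chain n.+1 v); rewrite Tor_restr_chainN.
Qed.

Definition Tor_of_restr n :
  {linear Tor_of (pull (opf phi) F) Q n -> Tor_of F P n} :=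
  subquot_map (@Tor_restr_cycles n) (@Tor_restr_boundaries n).
End TorRestr.

Definition Tor_restr C D (phi : functor C D) n (F : kfun (opc D)) (G : kfun D) :
  {linear Tor n (pull (opf phi) F) (pull phi G) -> Tor n F G} :=
  Tor_of_restr F (std_liftP phi G) n.

End FunctorModules.

Arguments kfun k C : clear implicits.
Arguments kmap {k C} _ {x y} _.

Section Tensor.
Context {R : comPzRingType}.
Variables M N : lmodType R.

Definition tens_sym (m : M) (n : N) : freemod R (M * N) := delta (m, n).

Inductive tens_rel : freemod R (M * N) -> Prop :=
  | tens_addl m m' n :
      tens_rel (tens_sym (m + m') n - (tens_sym m n + tens_sym m' n))
  | tens_addr m n n' :
      tens_rel (tens_sym m (n + n') - (tens_sym m n + tens_sym m n'))
  | tens_scalel a m n : tens_rel (tens_sym (a *: m) n - a *: tens_sym m n)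
  | tens_scaler a m n : tens_rel (tens_sym m (a *: n) - a *: tens_sym m n).

Definition tens : lmodType R := quotm (span_submod tens_rel).

End Tensor.

Definition intmod (A : zmodType) : lmodType int := zmodule A.

(** Finite biproducts are given for all finite families at once; the empty
    one is a zero object. *)
Record addcat := AddCat {
  aobj :> Type;
  ahom : aobj -> aobj -> zmodType;
  aid : forall x, ahom x x;
  acmp : forall x y z, ahom y z -> ahom x y -> ahom x z;
  acmpA : forall x y z t (h : ahom z t) (g : ahom y z) (f : ahom x y),
    acmp h (acmp g f) = acmp (acmp h g) f;
  acmp1m : forall x y (f : ahom x y), acmp (aid y) f = f;
  acmpm1 : forall x y (f : ahom x y), acmp f (aid x) = f;
  acmpDl : forall x y z (g g' : ahom y z) (f : ahom x y),
    acmp (g + g') f = acmp g f + acmp g' f;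
  acmpDr : forall x y z (g : ahom y z) (f f' : ahom x y),
    acmp g (f + f') = acmp g f + acmp g f';
  bip : forall n, ('I_n -> aobj) -> aobj;
  bip_inj : forall n (x : 'I_n -> aobj) i, ahom (x i) (bip x);
  bip_prj : forall n (x : 'I_n -> aobj) i, ahom (bip x) (x i);
  bip_prj_inj : forall n (x : 'I_n -> aobj) i,
    acmp (bip_prj x i) (bip_inj x i) = aid (x i);
  bip_prj_inj0 : forall n (x : 'I_n -> aobj) i j,
    i != j -> acmp (bip_prj x i) (bip_inj x j) = 0;
  sum_bip_inj_prj : forall n (x : 'I_n -> aobj),
    \sum_(i < n) acmp (bip_inj x i) (bip_prj x i) = aid (bip x)
}.
Arguments ahom {a}.
Arguments aid {a}.
Arguments acmp {a x y z}.
Arguments bip {a n}.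
Arguments bip_inj {a n}.
Arguments bip_prj {a n}.

Definition cat_of (A : addcat) : category :=
  @Category A (fun x y => ahom x y) (@aid A) (@acmp A)
    (@acmpA A) (@acmp1m A) (@acmpm1 A).
Coercion cat_of : addcat >-> category.

Definition addop (A : addcat) : addcat :=
  @AddCat A (fun x y => ahom y x) (@aid A)
    (fun x y z g f => acmp f g)
    (fun x y z t h g f => esym (acmpA f g h))
    (fun x y f => acmpm1 f)
    (fun x y f => acmp1m f)
    (fun x y z g g' f => acmpDr f g g')
    (fun x y z g f f' => acmpDl f f' g)
    (@bip A) (@bip_prj A) (@bip_inj A)
    (@bip_prj_inj A)
    (fun n x i j ij => bip_prj_inj0 x (negbT (etrans (eq_sym j i) (negbTE ij))))
    (@sum_bip_inj_prj A).

Section AddTheory.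
Variable A : addcat.

Lemma acmp0m (x y z : A) (f : ahom x y) : acmp (0 : ahom y z) f = 0.
Proof. by apply: (addrI (acmp 0 f)); rewrite -acmpDl !addr0. Qed.
Lemma acmpm0 (x y z : A) (g : ahom y z) : acmp g (0 : ahom x y) = 0.
Proof. by apply: (addrI (acmp g 0)); rewrite -acmpDr !addr0. Qed.
Lemma acmpBl (x y z : A) (g g' : ahom y z) (f : ahom x y) :
  acmp (g - g') f = acmp g f - acmp g' f.
Proof. by apply: (addIr (acmp g' f)); rewrite -acmpDl !addrNK. Qed.
Lemma acmpBr (x y z : A) (g : ahom y z) (f f' : ahom x y) :
  acmp g (f - f') = acmp g f - acmp g f'.
Proof. by apply: (addIr (acmp g f')); rewrite -acmpDr !addrNK. Qed.

End AddTheory.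

Record ideal (A : addcat) := Ideal {
  imem :> forall x y : A, zmodClosed (ahom x y);
  ideal_l : forall x y z (g : ahom y z) (f : ahom x y),
    f \in imem x y -> acmp g f \in imem x z;
  ideal_r : forall x y z (g : ahom y z) (f : ahom x y),
    g \in imem y z -> acmp g f \in imem x z
}.

Section QuotientCategory.
Variables (A : addcat) (I : ideal A).

Definition qhom (x y : A) : zmodType := Quotient.quot (I x y).
Definition qpi (x y : A) (f : ahom x y) : qhom x y :=
  \pi_(Quotient.quot (I x y)) f.
Definition qcmp (x y z : A) (g : qhom y z) (f : qhom x y) : qhom x z :=
  qpi (acmp (repr g) (repr f)).

Lemma qpi_eq (x y : A) (f g : ahom x y) : qpi f = qpi g <-> f - g \in I x y.
Proof. by rewrite /qpi (rwP eqP) piE. Qed.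
Lemma qpi_surj (x y : A) (q : qhom x y) : exists f, qpi f = q.
Proof. by exists (repr q); rewrite /qpi reprK. Qed.
Lemma qpiD (x y : A) (f g : ahom x y) : qpi (f + g) = qpi f + qpi g.
Proof. by rewrite /qpi !piE. Qed.
Lemma qpi0 (x y : A) : qpi (0 : ahom x y) = 0.
Proof. by apply: (addrI (qpi 0)); rewrite -qpiD !addr0. Qed.

Lemma qcmp_pi (x y z : A) (g : ahom y z) (f : ahom x y) :
  qcmp (qpi g) (qpi f) = qpi (acmp g f).
Proof.
have rP u v (h : ahom u v) : repr (qpi h) - h \in I u v.
  by apply/qpi_eq; rewrite /qpi reprK.
apply/qpi_eq; set g' := repr _; set f' := repr _.
have -> : acmp g' f' - acmp g f = acmp g' (f' - f) + acmp (g' - g) f.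
  by rewrite acmpBr acmpBl addrA subrK.
by apply: rpredD; [apply: ideal_l|apply: ideal_r]; exact: rP.
Qed.

Lemma qcmpA (x y z t : A) (h : qhom z t) (g : qhom y z) (f : qhom x y) :
  qcmp h (qcmp g f) = qcmp (qcmp h g) f.
Proof.
have [h' <-] := qpi_surj h; have [g' <-] := qpi_surj g.
by have [f' <-] := qpi_surj f; rewrite !qcmp_pi acmpA.
Qed.
Lemma qcmp1m (x y : A) (f : qhom x y) : qcmp (qpi (aid y)) f = f.
Proof. by have [f' <-] := qpi_surj f; rewrite qcmp_pi acmp1m. Qed.
Lemma qcmpm1 (x y : A) (f : qhom x y) : qcmp f (qpi (aid x)) = f.
Proof. by have [f' <-] := qpi_surj f; rewrite qcmp_pi acmpm1. Qed.
Lemma qcmpDl (x y z : A) (g g' : qhom y z) (f : qhom x y) :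
  qcmp (g + g') f = qcmp g f + qcmp g' f.
Proof.
have [h <-] := qpi_surj g; have [h' <-] := qpi_surj g'.
by have [u <-] := qpi_surj f; rewrite -qpiD !qcmp_pi acmpDl qpiD.
Qed.
Lemma qcmpDr (x y z : A) (g : qhom y z) (f f' : qhom x y) :
  qcmp g (f + f') = qcmp g f + qcmp g f'.
Proof.
have [h <-] := qpi_surj f; have [h' <-] := qpi_surj f'.
by have [u <-] := qpi_surj g; rewrite -qpiD !qcmp_pi acmpDr qpiD.
Qed.
Lemma qprj_inj n (x : 'I_n -> A) i :
  qcmp (qpi (bip_prj x i)) (qpi (bip_inj x i)) = qpi (aid (x i)).
Proof. by rewrite qcmp_pi bip_prj_inj. Qed.
Lemma qprj_inj0 n (x : 'I_n -> A) i j :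
  i != j -> qcmp (qpi (bip_prj x i)) (qpi (bip_inj x j)) = 0.
Proof. by move=> ij; rewrite qcmp_pi bip_prj_inj0 // qpi0. Qed.
Lemma qsum_inj_prj n (x : 'I_n -> A) :
  \sum_(i < n) qcmp (qpi (bip_inj x i)) (qpi (bip_prj x i)) = qpi (aid (bip x)).
Proof.
rewrite -sum_bip_inj_prj (big_morph _ (@qpiD _ _) (qpi0 _ _)).
by apply: eq_bigr => i _; rewrite qcmp_pi.
Qed.

Definition quotc : addcat :=
  @AddCat A qhom (fun x => qpi (aid x)) qcmp qcmpA qcmp1m qcmpm1 qcmpDl qcmpDr
    (@bip A) (fun n x i => qpi (bip_inj x i)) (fun n x i => qpi (bip_prj x i))
    qprj_inj qprj_inj0 qsum_inj_prj.

Definition quotc_pi : functor A quotc :=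
  @Functor A quotc id (fun x y f => qpi f) (fun x => erefl)
    (fun x y z g f => esym (qcmp_pi g f)).

End QuotientCategory.

Section Polynomial.
Variable k : comPzRingType.

Definition ktrivial (A : addcat) : Prop :=
  forall x y : A, finite_set [set: ahom x y] /\
    forall t : tens (intmod k) (intmod (ahom x y)), t = 0.

Definition kcotrivial (A : addcat) (I : ideal A) : Prop := ktrivial (quotc I).

Definition antipolynomial_functor (A : addcat) (F : kfun k A) : Prop :=
  exists I : ideal A, kcotrivial I /\
    exists F' : kfun k (quotc I), nat_iso F (pull (quotc_pi I) F').

(** The projection that omits the summand [x j]. *)
Definition omit_prj (A : addcat) d (x : 'I_d -> A) (j : 'I_d) :
  ahom (bip x) (bip (fun i => x (lift j i))) :=
  \sum_(i < d.-1)
    acmp (bip_inj (fun i => x (lift j i)) i) (bip_prj x (lift j i)).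

Definition cross_effect (A : addcat) (F : kfun k A) d (x : 'I_d -> A) :
  set (F (bip x)) :=
  [set v | forall j, kmap F (omit_prj x j : @hom A _ _) v = 0].

(** [d = 0] is excluded: the empty intersection would be [F 0], whose vanishing
    does not bound the degree of [F]. *)
Definition polynomial_functor (A : addcat) (F : kfun k A) : Prop :=
  exists d : nat, (0 < d)%N /\
    forall x : 'I_d -> A, @cross_effect A F d x = [set 0].

Definition AP_type (A : addcat) (B : kfun k (prodc A A)) : Prop :=
  forall x : A, antipolynomial_functor (pull (slice_l A (x : cat_of A)) B) /\
                polynomial_functor (pull (slice_r A (x : cat_of A)) B).

End Polynomial.

(* Main.v *)
From HB Require Import structures.
From mathcomp Require Import all_boot all_algebra.
From mathcomp Require Import boolp classical_sets functions cardinality fsbigop.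
Require Import Defs.

Set Implicit Arguments.
Unset Strict Implicit.
Unset Printing Implicit Defensive.

Import GRing.Theory.
Local Open Scope ring_scope.

(** Write [orth F G] for the vanishing of all [Ext^n (F, G)]. The proof rests on
    three observations.

    (1) On an additive category [A], multiplication by an integer [t] is a
    natural endomorphism of the identity functor, so the integers act on every
    functor, and the two resulting actions on [Ext^n (F, G)] agree. If [F] has
    degree less than [d] then [t |-> F (t id)] is killed by [d] differences
    ([polynomial_on_lines]). If [G] factors through [A / I] and [m id] lies in
    [I], the action on [G] has period [m]. A sequence with both properties is
    constant when [m] is invertible ([periodic_polynomial_constant]); if the
    second functor is reduced then its values at [1] and [0] show that every
    class is zero ([orth_poly_periodic]). For a k-cotrivial ideal an invertible
    [m] exists, but it depends on the object ([tens0_unit]). Hence this is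
    applied to functors [k[A (x, -) / I (x, -)]], or to the dual functors
    coinduced from one object [x], and passes to all antipolynomial functors by
    resolutions: a polynomial and an antipolynomial functor are orthogonal, in
    both orders, when the second one is reduced ([orth_poly_factors],
    [orth_factors_poly]).

    (2) [orth X Y] over a product of categories follows from [orth] for all
    pairs of slices ([kunneth_orth]), by embedding [Y] into a functor coinduced
    from its slices.

    (3) The sum [A x A -> A] is left adjoint to the diagonal, so that
    [Ext^n (diag^* B, diag^* C)] is [Ext^n (B, C')] with
    [C' (x, y) = C (x + y, x + y)]. The map
    [C (x, y) -> C (x, x + y) -> C (x + y, x + y)] splits. The complement at each
    step is a functor of three variables restricted along a functor that doubles
    [x] or [y] and that has a right adjoint; by adjunction and (2), the
    orthogonality of [B] to the complement reduces to (1) in one variable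
    ([orth_ker1], [orth_ker2]). So Ext does not see the complements, and
    restriction along the diagonal is bijective on Ext
    ([Ext_diag_bijective]).

    For Tor, [Hom_k (F (x) P, J)] is [Nat (P, Hom_k (F, J))], and
    [Hom_k (F, J)] inherits the AP condition. So the dual of the comparison
    map of complexes is a quasi-isomorphism for every module [J], and it
    suffices to let [J] be the chains of its mapping cone modulo boundaries to
    see that the map itself is one ([cone_cycle_boundary]). *)

(** * Cochains and the vanishing of Ext *)

Section NatTransBasics.
Context {k : comPzRingType} {C : category}.
Implicit Types F G H : kfun k C.

Lemma nat_compE F G H (b : nat_trans G H) (a : nat_trans F G) x v :
  nat_comp b a x v = b x (a x v).
Proof. by []. Qed.
Lemma nat_subE F G (a b : nat_trans F G) x v : (a - b) x v = a x v - b x v.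
Proof. by rewrite -scaleN1r. Qed.

Lemma hom_post_linear F G H (b : nat_trans G H) :
  linear (fun a : nat_trans F G => nat_comp b a).
Proof. by move=> c u v; apply: nat_ext => x w; rewrite nat_compE linearP. Qed.
Definition hom_post F G H (b : nat_trans G H) :
  {linear nat_trans F G -> nat_trans F H} := mklin (@hom_post_linear F G H b).

Lemma mem_cocycles F (P : resolution F) G n (c : nat_trans (P n) G) :
  c \in smem (cocycles P G n) <-> forall x v, c x (resd P n x v) = 0.
Proof.
split=> [/mem_kerm e x v|e]; first exact: (congr1 (fun e => ncomp e x v) e).
by apply/mem_kerm; apply: nat_ext.
Qed.

Lemma mem_coboundariesS F (P : resolution F) G n (c : nat_trans (P n.+1) G) :
  c \in smem (coboundaries P G n.+1) <->
  exists b : nat_trans (P n) G, forall x v, c x v = b x (resd P n x v).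
Proof.
split=> [/mem_imm[b <-]|[b e]]; first by exists b.
by apply/mem_imm; exists b; apply: nat_ext => x v; rewrite /= e.
Qed.

Lemma resdd F (P : resolution F) n x v : resd P n x (resd P n.+1 x v) = 0.
Proof. by apply/(@res_exactS _ _ _ P); exists v. Qed.
Lemma resad F (P : resolution F) x v : resa P x (resd P 0 x v) = 0.
Proof. by apply/(@res_exact0 _ _ _ P); exists v. Qed.

Lemma coboundary_cocycle F (P : resolution F) G n c :
  c \in smem (coboundaries P G n) -> c \in smem (cocycles P G n).
Proof.
case: n c => [|n] c; first by move=> c0; rewrite (mem_zero_submod c).1 ?rpred0.
move=> /mem_coboundariesS[b e]; apply/mem_cocycles => x v.
by rewrite e resdd linear0.
Qed.

Lemma coboundary_post F (P : resolution F) G H (a : nat_trans G H) n c :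
  c \in smem (coboundaries P G n) ->
  nat_comp a c \in smem (coboundaries P H n).
Proof.
case: n c => [|n] c.
  move=> c0; rewrite (mem_zero_submod c).1 //.
  by apply/mem_zero_submod; apply: nat_ext => x v; exact: (linear0 (a x)).
move=> /mem_coboundariesS[b e]; apply/mem_coboundariesS.
by exists (nat_comp a b) => x v; rewrite !nat_compE e.
Qed.

Lemma cocycle_post F (P : resolution F) G H (a : nat_trans G H) n c :
  c \in smem (cocycles P G n) -> nat_comp a c \in smem (cocycles P H n).
Proof.
move=> /mem_cocycles e; apply/mem_cocycles => x v.
by rewrite nat_compE e linear0.
Qed.

(** Terms of a projective resolution lift the primitive of a coboundary. *)
Lemma epi_coboundary_lift F (P : resolution F) G H (a : nat_trans G H) n c :
  proj_resolution P -> epi a -> c \in smem (coboundaries P H n) ->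
  exists2 b, b \in smem (coboundaries P G n) & nat_comp a b = c.
Proof.
move=> Pp ae; case: n c => [|n] c.
  move=> c0; rewrite (mem_zero_submod c).1 //; exists 0; first exact: rpred0.
  by apply: nat_ext => x v; exact: (linear0 (a x)).
move=> /mem_coboundariesS[b e].
have [b' b'E] := Pp n _ _ a b ae.
exists (nat_comp b' (resd P n)); first by apply/mem_coboundariesS; exists b'.
by apply: nat_ext => x v; rewrite e -b'E.
Qed.

(** Preimages under a monomorphism are unique; chosen objectwise, they are
    therefore linear and natural. *)
Lemma kernel_factor F G H R (a : nat_trans F G) (b : nat_trans G H)
    (c : nat_trans R G) :
  (forall x, injective (a x)) -> exact_at a b ->
  (forall x v, b x (c x v) = 0) -> exists c', nat_comp a c' = c.
Proof.
move=> ai ab bc.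
have ex x v : exists u, a x u = c x v by apply/ab.
pose h x v := sval (cid (ex x v)).
have hE x v : a x (h x v) = c x v := svalP (cid (ex x v)).
have hl x : linear (h x).
  by move=> t u v; apply: (ai x); rewrite hE !linearP !hE.
have hN x y (f : hom x y) v :
    mklin (hl y) (kmap R f v) = kmap F f (mklin (hl x) v).
  by apply: (ai y); rewrite /= hE !ncompN hE.
by exists (NatTrans hN); apply: nat_ext => x v; rewrite /= hE.
Qed.

(** [Ext^n (F, G) = 0]. The quantifier over resolutions avoids a choice; one
    resolution decides, by [vanishing_resolution]. *)
Definition vanishing n F G := forall P : resolution F, proj_resolution P ->
  forall c, c \in smem (cocycles P G n) -> c \in smem (coboundaries P G n).

Definition orth F G := forall n, vanishing n F G.

Section ChainMaps.
Variables (F F' : kfun k C) (P : resolution F) (P' : resolution F').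

Definition chain_map (f : forall n, nat_trans (P n) (P' n)) :=
  forall n x v, resd P' n x (f n.+1 x v) = f n x (resd P n x v).

Lemma chain_map_cocycle f G n c : chain_map f ->
  c \in smem (cocycles P' G n) -> nat_comp c (f n) \in smem (cocycles P G n).
Proof.
move=> fd /mem_cocycles e; apply/mem_cocycles => x v.
by rewrite nat_compE -fd e.
Qed.

Lemma chain_map_coboundary f G n c : chain_map f ->
  c \in smem (coboundaries P' G n) ->
  nat_comp c (f n) \in smem (coboundaries P G n).
Proof.
move=> fd; case: n c => [|n] c.
  move=> c0; rewrite (mem_zero_submod c).1 //.
  by apply/mem_zero_submod; exact: nat_ext.
move=> /mem_coboundariesS[b e]; apply/mem_coboundariesS.
by exists (nat_comp b (f n)) => x v; rewrite !nat_compE e fd.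
Qed.

Hypothesis Pp : proj_resolution P.

(** A null-homotopy [h] of [f] gives [c f = c (d h + h d) = (c h) d], since [c]
    is a cocycle; [h] is built degree by degree from projectivity. *)
Lemma null_chain_map_coboundary f G n c : chain_map f ->
  (forall x v, resa P' x (f 0 x v) = 0) ->
  c \in smem (cocycles P' G n) ->
  nat_comp c (f n) \in smem (coboundaries P G n).
Proof.
move=> fd f0 /mem_cocycles cc.
have [h0 h0E] := projective_exact (@Pp 0) (@res_exact0 _ _ _ P') f0.
case: n c cc => [|n] c cc.
  apply/mem_zero_submod; apply: nat_ext => x v.
  by rewrite nat_compE -h0E nat_compE cc.
have [h hE] : exists h : nat_trans (P n) (P' n.+1),
    forall x v, resd P' n x ((f n.+1 - nat_comp h (resd P n)) x v) = 0.
  elim: n {c cc} => [|n [h hE]].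
    exists h0 => x v; rewrite nat_subE linearB /= fd.
    by rewrite -[X in _ - X](nat_compE (resd P' 0) h0) h0E subrr.
  have [h' h'E] := projective_exact (@Pp n.+1) (@res_exactS _ _ _ P' n) hE.
  exists h' => x v; rewrite nat_subE linearB /= fd.
  rewrite -[X in _ - X](nat_compE (resd P' n.+1) h') h'E nat_subE nat_compE.
  by rewrite resdd linear0 subr0 subrr.
have [h' h'E] := projective_exact (@Pp n.+1) (@res_exactS _ _ _ P' n) hE.
apply/mem_coboundariesS; exists (nat_comp c h) => x v.
have := congr1 (fun e => c x (ncomp e x v)) h'E.
rewrite !nat_compE cc nat_subE linearB /= => e.
by apply/eqP; rewrite -subr_eq0 -e.
Qed.

Lemma chain_map_homotopic f g G n c : chain_map f -> chain_map g ->
  (forall x v, resa P' x (f 0 x v) = resa P' x (g 0 x v)) ->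
  c \in smem (cocycles P' G n) ->
  nat_comp c (f n) - nat_comp c (g n) \in smem (coboundaries P G n).
Proof.
move=> fd gd fg cc; rewrite -[_ - _](linearB (hom_post _ c)) /=.
apply: (@null_chain_map_coboundary (fun n => f n - g n)) => //.
  by move=> m x v; rewrite !nat_subE linearB /= fd gd.
by move=> x v; rewrite nat_subE linearB /= fg subrr.
Qed.

(* The commutative squares over which the chain map is built by dependent
   choice. *)
Let square n := {fg : nat_trans (P n) (P' n) * nat_trans (P n.+1) (P' n.+1) |
  nat_comp (resd P' n) fg.2 = nat_comp fg.1 (resd P n)}.

Let square_exS n (s : square n) :
  exists s' : square n.+1, (sval s').1 = (sval s).2.
Proof.
case: s => -[f g] /= fg.
have [x v|h hE] := @projective_exact _ _ _ _ _ _ _ _ (nat_comp g (resd P n.+1))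
  (@Pp n.+2) (@res_exactS _ _ _ P' n).
  rewrite nat_compE -[LHS](nat_compE (resd P' n) g) fg.
  by rewrite nat_compE resdd linear0.
by exists (exist _ (g, h) hE).
Qed.

Lemma chain_map_exists (a : nat_trans F F') : exists f,
  chain_map f /\ forall x v, resa P' x (f 0 x v) = a x (resa P x v).
Proof.
have [f fE] := @Pp 0 _ _ _ (nat_comp a (resa P)) (@resa_epi _ _ _ P').
have [x v|g gE] := @projective_exact _ _ _ _ _ _ _ _ (nat_comp f (resd P 0))
  (@Pp 1) (@res_exact0 _ _ _ P').
  rewrite nat_compE -[LHS](nat_compE (resa P') f) fE.
  by rewrite nat_compE resad linear0.
pose s0 : square 0 := exist _ (f, g) gE.
pose s := fix s n : square n :=
  if n is m.+1 then sval (cid (square_exS (s m))) else s0.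
exists (fun n => (sval (s n)).1); split=> [n x v|x v].
  have -> : (sval (s n.+1)).1 = (sval (s n)).2.
    exact: svalP (cid (square_exS (s n))).
  exact: (congr1 (fun e => ncomp e x v) (svalP (s n))).
exact: (congr1 (fun e => ncomp e x v) fE).
Qed.

End ChainMaps.

(** Two projective resolutions are homotopy equivalent. *)
Lemma vanishing_resolution F G n (P : resolution F) : proj_resolution P ->
  (forall c, c \in smem (cocycles P G n) -> c \in smem (coboundaries P G n)) ->
  vanishing n F G.
Proof.
move=> Pp Pv Q Qp c cc.
have [f [fd fa]] := chain_map_exists P Qp (nat_id F).
have [g [gd ga]] := chain_map_exists Q Pp (nat_id F).
have := chain_map_coboundary fd (Pv _ (chain_map_cocycle gd cc)).
set e := nat_comp _ _ => eB.
have idE : c = nat_comp c (nat_id (Q n)) by exact: nat_ext.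
rewrite -(subrK e c) rpredD // [X in X - _]idE.
have -> : e = nat_comp c (nat_comp (g n) (f n)) by exact: nat_ext.
apply: (@chain_map_homotopic _ _ Q Q Qp (fun n => nat_id (Q n))
  (fun n => nat_comp (g n) (f n))) => //.
  by move=> m x v; rewrite !nat_compE gd fd.
by move=> x v; rewrite nat_compE ga fa.
Qed.

(** * Dimension shifting *)

(** As the terms of a projective resolution are projective, a short exact
    sequence of targets gives a short exact sequence of cochain complexes; the
    next three lemmas are pieces of its long exact sequence. *)
Section ShortExactTarget.
Variables (F T T0 T1 : kfun k C) (a : nat_trans T T0) (b : nat_trans T0 T1).
Hypotheses (a_inj : forall x, injective (a x)) (ab : exact_at a b)
  (b_epi : epi b).

Let ba x v : b x (a x v) = 0. Proof. by apply/ab; exists v. Qed.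

Lemma vanishing0_mono : vanishing 0 F T0 -> vanishing 0 F T.
Proof.
move=> v0 P Pp c cc.
have /mem_zero_submod e := v0 P Pp _ (cocycle_post a cc).
apply/mem_zero_submod; apply: nat_ext => x v; apply: (a_inj (x := x)).
by rewrite linear0; exact: (congr1 (fun e => ncomp e x v) e).
Qed.

Lemma vanishing_shift_target n :
  vanishing n.+1 F T0 -> vanishing n F T1 -> vanishing n.+1 F T.
Proof.
move=> v0 v1 P Pp c /mem_cocycles cc.
have /mem_coboundariesS[e eE] :=
  v0 P Pp _ (cocycle_post a ((mem_cocycles c).2 cc)).
have be : nat_comp b e \in smem (cocycles P T1 n).
  by apply/mem_cocycles => x v; rewrite nat_compE -eE nat_compE ba.
have [g gB gE] := epi_coboundary_lift Pp b_epi (v1 P Pp _ be).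
have [x v|e' e'E] := @kernel_factor _ _ _ _ a b (e - g) a_inj ab.
  rewrite nat_subE linearB /= -[b x (g x v)](nat_compE b g) gE.
  by rewrite nat_compE subrr.
apply/mem_coboundariesS; exists e' => x v; apply: (a_inj (x := x)).
rewrite -[RHS](nat_compE a e') e'E nat_subE -eE nat_compE.
by have /mem_cocycles-> := coboundary_cocycle gB; rewrite subr0.
Qed.

Lemma orth_cokernel : orth F T -> orth F T0 -> orth F T1.
Proof.
move=> vT v0 n P Pp c cc; have /mem_cocycles ccE := cc.
have [e eE] := Pp n _ _ b c b_epi.
have [x v|h hE] := @kernel_factor _ _ _ _ a b (nat_comp e (resd P n)) a_inj ab.
  by rewrite nat_compE -[LHS](nat_compE b e) eE ccE.
have hc : h \in smem (cocycles P T n.+1).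
  apply/mem_cocycles => x v; apply: (a_inj (x := x)).
  by rewrite -[LHS](nat_compE a h) hE nat_compE resdd !linear0.
have /mem_coboundariesS[h' h'E] := vT n.+1 P Pp h hc.
have ec : e - nat_comp a h' \in smem (cocycles P T0 n).
  apply/mem_cocycles => x v; rewrite nat_subE nat_compE -h'E.
  by rewrite -[a x (h x v)](nat_compE a h) hE subrr.
have := coboundary_post b (v0 n P Pp _ ec).
suff -> : nat_comp b (e - nat_comp a h') = c by [].
apply: nat_ext => x v; rewrite nat_compE nat_subE linearB /= ba subr0.
by rewrite -eE.
Qed.

End ShortExactTarget.

(** The product is given by its projections, so that the lemma also applies to
    a functor that is a product only objectwise, as a slice of a coinduced
    functor is. *)
Lemma vanishing_target_product F I (G : kfun k C) (T : I -> kfun k C)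
    (pr : forall i, nat_trans G (T i)) n :
  (forall x (v : forall i, T i x), exists w, forall i, pr i x w = v i) ->
  (forall x w, (forall i, pr i x w = 0) -> w = 0) ->
  (forall i, vanishing n F (T i)) -> vanishing n F G.
Proof.
move=> prE pr0 vT P Pp c cc.
have prI x w w' : (forall i, pr i x w = pr i x w') -> w = w'.
  move=> e; apply/eqP; rewrite -subr_eq0; apply/eqP/pr0 => i.
  by rewrite linearB /= e subrr.
have ci i := vT i P Pp _ (cocycle_post (pr i) cc).
case: n c cc vT ci => [|n] c cc vT ci.
  apply/mem_zero_submod; apply: nat_ext => x v; apply: pr0 => i.
  have /mem_zero_submod e := ci i.
  exact: (congr1 (fun e => ncomp e x v) e).
have {}ci i : exists b : nat_trans (P n) (T i),
    forall x v, pr i x (c x v) = b x (resd P n x v).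
  by have /mem_coboundariesS := ci i.
pose b i := sval (cid (ci i)); have bE i := svalP (cid (ci i)).
pose h x v := sval (cid (prE x (fun i => b i x v))).
have hE x v i : pr i x (h x v) = b i x v.
  exact: svalP (cid (prE x (fun i => b i x v))) i.
have hl x : linear (h x).
  by move=> t u v; apply: prI => i; rewrite !linearP !hE linearP.
have hN x y (f : hom x y) v :
    mklin (hl y) (kmap (P n) f v) = kmap G f (mklin (hl x) v).
  by apply: prI => i; rewrite /= hE !ncompN hE.
apply/mem_coboundariesS; exists (NatTrans hN) => x v.
by apply: prI => i; rewrite /= hE bE.
Qed.

End NatTransBasics.

(** * Products and direct sums of modules *)

Section Products.
Context {k : comPzRingType}.

Definition prodmod (I : Type) (M : I -> lmodType k) : Type := forall i, M i.

Section ProdmodInstances.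
Variables (I : Type) (M : I -> lmodType k).
Implicit Types u v : prodmod M.

HB.instance Definition _ := gen_eqMixin (prodmod M).
HB.instance Definition _ := gen_choiceMixin (prodmod M).

Lemma prodmod_ext u v : (forall i, u i = v i) -> u = v.
Proof. exact: functional_extensionality_dep. Qed.

Let pm_add u v : prodmod M := fun i => u i + v i.
Let pm_opp u : prodmod M := fun i => - u i.
Let pm_scale (a : k) u : prodmod M := fun i => a *: u i.

Let pm_addA : associative pm_add.
Proof. by move=> u v w; apply: prodmod_ext => i; exact: addrA. Qed.
Let pm_addC : commutative pm_add.
Proof. by move=> u v; apply: prodmod_ext => i; exact: addrC. Qed.
Let pm_add0 : left_id (fun i => 0) pm_add.
Proof. by move=> u; apply: prodmod_ext => i; exact: add0r. Qed.
Let pm_addN : left_inverse (fun i => 0) pm_opp pm_add.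
Proof. by move=> u; apply: prodmod_ext => i; exact: addNr. Qed.
HB.instance Definition _ := GRing.isZmodule.Build (prodmod M)
  pm_addA pm_addC pm_add0 pm_addN.

Let pm_scaleA a b u : pm_scale a (pm_scale b u) = pm_scale (a * b) u.
Proof. by apply: prodmod_ext => i; exact: scalerA. Qed.
Let pm_scale1 : left_id 1 pm_scale.
Proof. by move=> u; apply: prodmod_ext => i; exact: scale1r. Qed.
Let pm_scaleDr : right_distributive pm_scale +%R.
Proof. by move=> a u v; apply: prodmod_ext => i; exact: scalerDr. Qed.
Let pm_scaleDl u : {morph pm_scale^~ u : a b / a + b}.
Proof. by move=> a b; apply: prodmod_ext => i; exact: scalerDl. Qed.
HB.instance Definition _ := GRing.Zmodule_isLmodule.Build k (prodmod M)
  pm_scaleA pm_scale1 pm_scaleDr pm_scaleDl.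

Lemma prodmod_linP (a : k) u v i : (a *: u + v) i = a *: u i + v i.
Proof. by []. Qed.
Lemma prodmod_0E i : (0 : prodmod M) i = 0. Proof. by []. Qed.
End ProdmodInstances.

Section DirectSum.
Variables (I : Type) (M : I -> lmodType k).

Lemma dsum_closed : submod_closed
  (fun u : prodmod M => `[< finite_set [set i | u i != 0] >]).
Proof.
split=> [|a u v]; rewrite !unfold_in.
  apply/asboolP; apply: (@sub_finite_set _ _ set0) => // i /=.
  by rewrite eqxx.
move=> /asboolP fu /asboolP fv; apply/asboolP.
apply: (@sub_finite_set _ _
  ([set i | u i != 0] `|` [set i | v i != 0])%classic).
  move=> i; rewrite /= prodmod_linP.
  have [->|] := eqVneq (u i) 0; last by left.
  have [->|] := eqVneq (v i) 0; last by right.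
  by rewrite scaler0 addr0 eqxx.
by rewrite finite_setU.
Qed.

Definition dsum : lmodType k := submodT (Submod dsum_closed).

Lemma dsum_ext (u v : dsum) : (forall i, val u i = val v i) -> u = v.
Proof. by move=> e; apply: val_inj; exact: prodmod_ext. Qed.

Lemma dsum_supp (u : dsum) :
  exists2 s : seq {classic I}, uniq s & forall i, i \notin s -> val u i = 0.
Proof.
have /asboolP/(@finite_seqP {classic I})[s es] := valP u.
exists (undup s); first exact: undup_uniq.
move=> i; rewrite mem_undup => ts; apply/eqP; apply: contraNT ts => nz.
suff : [set` s]%classic i by [].
by rewrite -es.
Qed.

Definition dsum_single i0 (v : M i0) : prodmod M := fun i =>
  if pselect (i0 = i) is left e then eq_rect i0 (fun i => M i) v i e else 0.

Lemma dsum_singleE i0 (v : M i0) : dsum_single v i0 = v.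
Proof.
by rewrite /dsum_single; case: pselect => // e;
  rewrite (Prop_irrelevance e erefl).
Qed.
Lemma dsum_single0 i0 (v : M i0) i : i0 <> i -> dsum_single v i = 0.
Proof. by rewrite /dsum_single; case: pselect. Qed.

Lemma dsum_single_fin i0 (v : M i0) :
  dsum_single v \in smem (Submod dsum_closed).
Proof.
rewrite unfold_in; apply/asboolP.
apply: (@sub_finite_set _ _ [set i0]%classic) => // i /=.
case: (pselect (i0 = i)) => [e _|/dsum_single0->]; first exact: esym.
by rewrite eqxx.
Qed.

Lemma dsum_in_linear i0 :
  linear (fun v : M i0 => exist _ (dsum_single v) (dsum_single_fin v) : dsum).
Proof.
move=> a u v; apply: dsum_ext => i /=; rewrite prodmod_linP.
case: (pselect (i0 = i)) => [e|ne];
  last by rewrite !dsum_single0 // scaler0 addr0.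
by case: i / e; rewrite !dsum_singleE.
Qed.
Definition dsum_in i : {linear M i -> dsum} := mklin (@dsum_in_linear i).

Lemma dsum_decomp (u : dsum) (s : seq {classic I}) : uniq s ->
  (forall i, i \notin s -> val u i = 0) ->
    u = \sum_(i <- s) dsum_in i (val u i).
Proof.
move=> us s0; apply: dsum_ext => j.
have -> : val (\sum_(i <- s) dsum_in i (val u i)) j
        = \sum_(i <- s) dsum_single (val u i) j.
  by elim: (s) => [|i r IH]; rewrite ?big_nil // !big_cons -IH.
have [js|js] := boolP ((j : {classic I}) \in s); last first.
  rewrite s0 // big1_seq // => i /andP[_ si]; rewrite dsum_single0 // => e.
  by move: js; rewrite -e si.
rewrite (bigD1_seq (j : {classic I})) //= big1 ?addr0 ?dsum_singleE // => i ij.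
by rewrite dsum_single0 // => e; move: ij; rewrite e eqxx.
Qed.

Lemma dsum_lin_ext (N : lmodType k) (f g : {linear dsum -> N}) :
  (forall i v, f (dsum_in i v) = g (dsum_in i v)) -> f =1 g.
Proof.
move=> fg u; have [s us s0] := dsum_supp u.
by rewrite (dsum_decomp us s0) !linear_sum; apply: eq_bigr => i _; exact: fg.
Qed.

Section Lift.
Variables (N : lmodType k) (f : forall i, {linear M i -> N}).

Let lift_fun (u : dsum) : N := \sum_(i \in [set: {classic I}]) f i (val u i).

Let lift_sum (u : dsum) (s : seq {classic I}) : uniq s ->
  (forall i, i \notin s -> val u i = 0) ->
    lift_fun u = \sum_(i <- s) f i (val u i).
Proof.
move=> us s0; rewrite /lift_fun (bigfs _ us).
  by apply: eq_fsbigl; apply/seteqP.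
by move=> i _ /s0->; rewrite linear0.
Qed.

Let lift_linear : linear lift_fun.
Proof.
move=> a x y; have [s us s0] := dsum_supp x; have [r ur r0] := dsum_supp y.
pose l := undup (s ++ r).
have lx t : t \notin l -> val x t = 0.
  by rewrite mem_undup mem_cat => /norP[/s0].
have ly t : t \notin l -> val y t = 0.
  by rewrite mem_undup mem_cat => /norP[_ /r0].
have ul : uniq l by exact: undup_uniq.
rewrite !(lift_sum ul) //; last first.
  by move=> t tl; rewrite /= prodmod_linP lx // ly // scaler0 addr0.
rewrite scaler_sumr -big_split /=; apply: eq_bigr => t _.
by rewrite prodmod_linP linearP.
Qed.
Definition dsum_lift : {linear dsum -> N} := mklin lift_linear.

Lemma dsum_liftE i v : dsum_lift (dsum_in i v) = f i v.
Proof.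
rewrite /= (@lift_sum _ [:: i : {classic I}]) //.
  by rewrite big_seq1 /= dsum_singleE.
by move=> j; rewrite inE => /eqP ij; rewrite /= dsum_single0 // => e; exact: ij.
Qed.
End Lift.

End DirectSum.
Arguments dsum_in {I M} i.

Lemma dsum_map_fin I (M N : I -> lmodType k) (u : dsum M) (w : prodmod N) :
  (forall i, val u i = 0 -> w i = 0) -> w \in smem (Submod (@dsum_closed I N)).
Proof.
move=> uw; rewrite unfold_in; apply/asboolP.
have /asboolP fu := valP u; apply: sub_finite_set fu => i /=.
by apply: contra => /eqP/uw->.
Qed.

Section DsumMap.
Variables (I : Type) (M N : I -> lmodType k) (f :
  forall i, {linear M i -> N i}).

Lemma dsum_map_sub (u : dsum M) :
  ((fun i => f i (val u i)) : prodmod N) \in smem (Submod (@dsum_closed I N)).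
Proof. by apply: (@dsum_map_fin _ _ _ u) => i ->; exact: linear0. Qed.
Lemma dsum_map_linear : linear (fun u : dsum M =>
  exist _ (fun i => f i (val u i)) (dsum_map_sub u) : dsum N).
Proof.
by move=> a u v; apply: dsum_ext => i /=; rewrite !prodmod_linP linearP.
Qed.
Definition dsum_map : {linear dsum M -> dsum N} := mklin dsum_map_linear.

Lemma dsum_map_in i v : dsum_map (dsum_in i v) = dsum_in i (f i v).
Proof.
apply: dsum_ext => j /=; case: (pselect (i = j)) => [e|ne].
  by case: j / e; rewrite !dsum_singleE.
by rewrite !dsum_single0 // linear0.
Qed.

(** Zero entries are lifted to zero, so that the supports stay finite. *)
Lemma dsum_map_preimage (w : dsum N) :
  (forall i, exists v, f i v = val w i) -> exists u, dsum_map u = w.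
Proof.
move=> ex; have ex0 i : exists v, f i v = val w i /\ (val w i = 0 -> v = 0).
  have [v vE] := ex i; case: (eqVneq (val w i) 0) => [w0|/eqP w0].
    by exists 0; rewrite linear0 w0.
  by exists v.
pose u : prodmod M := fun i => sval (cid (ex0 i)).
have uf : u \in smem (Submod (@dsum_closed _ M)).
  by apply: (@dsum_map_fin _ _ _ w) => i; case: (svalP (cid (ex0 i))).
exists (exist _ u uf); apply: dsum_ext => i /=.
by case: (svalP (cid (ex0 i))).
Qed.
End DsumMap.

End Products.

Arguments dsum_in {k I M} i.

Lemma quotm_pi_eq0 (k : comPzRingType) (M : lmodType k) (S : submod M) v :
  quotm_pi S v = 0 <-> v \in smem S.
Proof.
rewrite -(linear0 (quotm_pi S)); split=> [e|vS].
  by have := (quotm_eq S v 0).1 e; rewrite subr0.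
by apply/(quotm_eq S v 0); rewrite subr0.
Qed.

Lemma quotm_pi_surj (k : comPzRingType) (M : lmodType k) (S : submod M)
  (q : quotm S) : exists x, quotm_pi S x = q.
Proof. exact: quotm_surj. Qed.

(** * Cokernels and direct sums of functors *)

Section FunctorConstructions.
Context {k : comPzRingType} {C : category}.
Implicit Types F G H K T X : kfun k C.

Section Cokernel.
Variables (F G : kfun k C) (a : nat_trans F G).

Lemma coker_map0 x y (f : hom x y) v : v \in smem (imm (a x)) ->
  lin_comp (quotm_pi (imm (a y))) (kmap G f) v = 0.
Proof.
move=> /mem_imm[u <-]; rewrite lin_compE -ncompN.
by apply: (quotm_pi_eq0 (imm (a y)) _).2; apply/mem_imm; exists (kmap F f u).
Qed.
Definition coker_map x y (f : hom x y) := quotm_lift (@coker_map0 x y f).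
Lemma coker_mapE x y (f : hom x y) v :
  coker_map f (quotm_pi (imm (a x)) v) = quotm_pi (imm (a y)) (kmap G f v).
Proof. exact: quotm_liftE. Qed.
Lemma coker_map1 x v : coker_map (idm x) v = v.
Proof. by have [u <-] := quotm_pi_surj v; rewrite coker_mapE kmap1. Qed.
Lemma coker_mapM x y z (g : hom y z) (f : hom x y) v :
  coker_map (cmp g f) v = coker_map g (coker_map f v).
Proof. by have [u <-] := quotm_pi_surj v; rewrite !coker_mapE kmapM. Qed.
Definition nat_coker : kfun k C := KFun coker_map1 coker_mapM.

Lemma nat_coker_piN x y (f : hom x y) v :
  quotm_pi (imm (a y)) (kmap G f v) = kmap nat_coker f (quotm_pi (imm (a x)) v).
Proof. by rewrite coker_mapE. Qed.
Definition nat_coker_pi : nat_trans G nat_coker :=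
  @NatTrans k C G nat_coker (fun x => quotm_pi (imm (a x))) nat_coker_piN.

Lemma nat_coker_epi : epi nat_coker_pi.
Proof. by move=> x w; exact: quotm_pi_surj. Qed.
Lemma nat_coker_exact : exact_at a nat_coker_pi.
Proof.
move=> x v; split=> [e|[u <-]].
  by apply/mem_imm; exact: (quotm_pi_eq0 (imm (a x)) v).1 e.
by apply: (quotm_pi_eq0 (imm (a x)) _).2; apply/mem_imm; exists u.
Qed.
End Cokernel.

Lemma nat_ker_exact F G (a : nat_trans F G) : exact_at (nat_ker_incl a) a.
Proof.
move=> x v; split=> [av|[u <-]]; last by have /eqP := valP u.
have vk : v \in smem (kerm (a x)) by exact/eqP.
by exists (exist _ v vk).
Qed.
Lemma nat_ker_incl_inj F G (a : nat_trans F G) x :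
  injective (nat_ker_incl a x).
Proof. exact: val_inj. Qed.

Section DirectSum.
Variables (I : Type) (F : I -> kfun k C).

Let dmap x y (f : hom x y) :
  {linear dsum (fun i => F i x) -> dsum (fun i => F i y)} :=
  dsum_map (fun i => kmap (F i) f).
Lemma dsumk_map1 x v : dmap (idm x) v = v.
Proof. by apply: dsum_ext => i; rewrite /= kmap1. Qed.
Lemma dsumk_mapM x y z (g : hom y z) (f : hom x y) v :
  dmap (cmp g f) v = dmap g (dmap f v).
Proof. by apply: dsum_ext => i; rewrite /= kmapM. Qed.
Definition dsumk : kfun k C :=
  @KFun k C (fun x => dsum (fun i => F i x)) dmap dsumk_map1 dsumk_mapM.

Lemma dsumk_inN i x y (f : hom x y) v :
  dsum_in (M := fun i => F i y) i (kmap (F i) f v)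
  = kmap dsumk f (dsum_in (M := fun i => F i x) i v).
Proof. by rewrite [RHS]dsum_map_in. Qed.
Definition dsumk_in i : nat_trans (F i) dsumk :=
  @NatTrans k C (F i) dsumk (fun x => dsum_in (M := fun i => F i x) i)
    (@dsumk_inN i).

Section Lift.
Variables (G : kfun k C) (a : forall i, nat_trans (F i) G).
Lemma dsumk_liftN x y (f : hom x y) v :
  dsum_lift (fun i => a i y) (kmap dsumk f v)
  = kmap G f (dsum_lift (fun i => a i x) v).
Proof.
rewrite -[LHS]/(lin_comp (dsum_lift _) (kmap dsumk f) v).
rewrite -[RHS]/(lin_comp (kmap G f) (dsum_lift _) v).
move: v; apply: dsum_lin_ext => i u.
by rewrite !lin_compE [kmap dsumk f _]dsum_map_in !dsum_liftE ncompN.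
Qed.
Definition dsumk_lift : nat_trans dsumk G :=
  @NatTrans k C dsumk G (fun x => dsum_lift (fun i => a i x)) dsumk_liftN.
Lemma dsumk_lift_in i x v : dsumk_lift x (dsumk_in i x v) = a i x v.
Proof. exact: dsum_liftE. Qed.
End Lift.

Lemma dsumk_ext G (a b : nat_trans dsumk G) :
  (forall i, nat_comp a (dsumk_in i) = nat_comp b (dsumk_in i)) -> a = b.
Proof.
move=> e; apply: nat_ext => x; apply: dsum_lin_ext => i v.
exact: (congr1 (fun e => ncomp e x v) (e i)).
Qed.

Lemma dsumk_projective : (forall i, projective (F i)) -> projective dsumk.
Proof.
move=> Fp G H p a pE.
have ex i : exists b, nat_comp p b = nat_comp a (dsumk_in i) by exact: Fp.
exists (dsumk_lift (fun i => sval (cid (ex i)))); apply: dsumk_ext => i.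
rewrite -[RHS](svalP (cid (ex i))); apply: nat_ext => x v.
by rewrite !nat_compE dsumk_lift_in.
Qed.
End DirectSum.

Section DirectSumMap.
Variables (I : Type) (F G H : I -> kfun k C).
Variables (a : forall i, nat_trans (F i) (G i)).

Lemma dsumk_mapN x y (f : hom x y) v :
  dsum_map (fun i => a i y) (kmap (dsumk F) f v)
  = kmap (dsumk G) f (dsum_map (fun i => a i x) v).
Proof. by apply: dsum_ext => i; rewrite /= ncompN. Qed.
Definition dsumk_map : nat_trans (dsumk F) (dsumk G) :=
  @NatTrans k C (dsumk F) (dsumk G) (fun x => dsum_map (fun i => a i x))
    dsumk_mapN.

Lemma dsumk_map_epi : (forall i, epi (a i)) -> epi dsumk_map.
Proof.
by move=> ae x w; apply: dsum_map_preimage => i; exact: ae.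
Qed.
End DirectSumMap.

Lemma dsumk_map_exact I (F G H : I -> kfun k C)
    (a : forall i, nat_trans (F i) (G i)) (b :
      forall i, nat_trans (G i) (H i)) :
  (forall i, exact_at (a i) (b i)) -> exact_at (dsumk_map a) (dsumk_map b).
Proof.
move=> ab x w; split=> [e|[u <-]]; last first.
  by apply: dsum_ext => i /=; apply/ab; exists (val u i).
have be i : b i x (val w i) = 0 := congr1 (fun u => val u i) e.
by apply: dsum_map_preimage => i; apply/ab.
Qed.

Section DirectSumResolution.
Variables (I : Type) (F : I -> kfun k C) (P : forall i, resolution (F i)).

Definition dsum_resolution : resolution (dsumk F) :=
  @Resolution k C (dsumk F) (fun n => dsumk (fun i => P i n))
    (fun n => dsumk_map (fun i => resd (P i) n))
    (dsumk_map (fun i => resa (P i)))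
    (dsumk_map_epi (fun i => @resa_epi _ _ _ (P i)))
    (dsumk_map_exact (fun i => @res_exact0 _ _ _ (P i)))
    (fun n => dsumk_map_exact (fun i => @res_exactS _ _ _ (P i) n)).
End DirectSumResolution.

(** A direct sum of resolutions resolves the direct sum, and maps out of a
    direct sum are families of maps. *)
Lemma vanishing_dsum I (F : I -> kfun k C) T n :
  (forall i, vanishing n (F i) T) -> vanishing n (dsumk F) T.
Proof.
move=> Fv; pose P i := std_resolution (F i).
have Pp i : proj_resolution (P i) := @std_resolution_proj _ _ (F i).
apply: (@vanishing_resolution _ _ _ _ _ (dsum_resolution P)).
  by move=> m; apply: dsumk_projective => i; exact: Pp.
move=> c /mem_cocycles cc.
have ci i : nat_comp c (dsumk_in (fun i => P i n) i)
    \in smem (coboundaries (P i) T n).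
  apply: (Fv i) => //; apply/mem_cocycles => x v.
  rewrite nat_compE -(cc x (dsumk_in (fun i => P i n.+1) i x v)).
  by congr (c x _); exact/esym/dsum_map_in.
case: n c cc ci {Fv} => [|n] c cc ci.
  apply/mem_zero_submod; apply: dsumk_ext => i; apply: nat_ext => x v.
  have /mem_zero_submod e := ci i.
  exact: (congr1 (fun e => ncomp e x v) e).
have {}ci i : exists b : nat_trans (P i n) T, forall x v,
    c x (dsumk_in (fun i => P i n.+1) i x v) = b x (resd (P i) n x v).
  by have /mem_coboundariesS := ci i.
pose b := dsumk_lift (fun i => sval (cid (ci i))).
apply/mem_coboundariesS; exists b => x.
apply: (@dsum_lin_ext _ _ (fun i => P i n.+1 x) _ (c x)
  (lin_comp (b x) (resd (dsum_resolution P) n x))) => i v.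
rewrite (svalP (cid (ci i))) lin_compE.
transitivity (b x (dsumk_in (fun i => P i n) i x (resd (P i) n x v))).
  by rewrite dsumk_lift_in.
by congr (b x _); exact/esym/dsum_map_in.
Qed.

(** * The mapping cone *)

Section Pair.
Variables F G : kfun k C.

Lemma pair_map_linear x y (f : hom x y) :
  linear (fun v : F x * G x => (kmap F f v.1, kmap G f v.2)).
Proof. by move=> a [u v] [u' v']; rewrite /= !linearP. Qed.
Definition pair_map x y (f : hom x y) :
  {linear (F x * G x)%type -> (F y * G y)%type} := mklin (pair_map_linear f).
Lemma pair_map1 x v : pair_map (idm x) v = v.
Proof. by case: v => u v; rewrite /= !kmap1. Qed.
Lemma pair_mapM x y z (g : hom y z) (f : hom x y) v :
  pair_map (cmp g f) v = pair_map g (pair_map f v).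
Proof. by rewrite /= !kmapM. Qed.
Definition pairk : kfun k C :=
  @KFun k C (fun x => (F x * G x)%type :
    lmodType k) pair_map pair_map1 pair_mapM.

Section Copair.
Variables (H : kfun k C) (a : nat_trans F H) (b : nat_trans G H).
Lemma copair_linear x : linear (fun v : F x * G x => a x v.1 + b x v.2).
Proof. by move=> c u v; rewrite /= !linearP scalerDr addrACA. Qed.
Lemma copairN x y (f : hom x y) v :
  mklin (@copair_linear y) (kmap pairk f v)
  = kmap H f (mklin (@copair_linear x) v).
Proof. by rewrite /= !ncompN linearD. Qed.
Definition copair : nat_trans pairk H :=
  @NatTrans k C pairk H (fun x => mklin (@copair_linear x)) copairN.
End Copair.

Lemma pair_inl_linear x : linear (fun v : F x => (v, 0) : F x * G x).
Proof.
move=> a u v; congr pair; change (0 = a *: (0 : G x) + 0).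
by rewrite scaler0 addr0.
Qed.
Lemma pair_inlN x y (f : hom x y) v :
  mklin (@pair_inl_linear y) (kmap F f v)
  = kmap pairk f (mklin (@pair_inl_linear x) v).
Proof. by rewrite /= linear0. Qed.
Definition pair_inl : nat_trans F pairk :=
  @NatTrans k C F pairk (fun x => mklin (@pair_inl_linear x)) pair_inlN.

Lemma pair_inr_linear x : linear (fun v : G x => (0, v) : F x * G x).
Proof.
move=> a u v; congr pair; change (0 = a *: (0 : F x) + 0).
by rewrite scaler0 addr0.
Qed.
Lemma pair_inrN x y (f : hom x y) v :
  mklin (@pair_inr_linear y) (kmap G f v)
  = kmap pairk f (mklin (@pair_inr_linear x) v).
Proof. by rewrite /= linear0. Qed.
Definition pair_inr : nat_trans G pairk :=
  @NatTrans k C G pairk (fun x => mklin (@pair_inr_linear x)) pair_inrN.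

Lemma pair_split x (v : pairk x) : v = pair_inl x v.1 + pair_inr x v.2.
Proof.
case: v => u v; rewrite -[RHS]/(u + 0, 0 + v); by rewrite addr0 add0r.
Qed.

Lemma pairk_projective : projective F -> projective G -> projective pairk.
Proof.
move=> Fp Gp H K p a pE.
have [b bE] := Fp _ _ p (nat_comp a pair_inl) pE.
have [c cE] := Gp _ _ p (nat_comp a pair_inr) pE.
exists (copair b c); apply: nat_ext => x v.
rewrite [in RHS](pair_split v) linearD nat_compE /= linearD /=.
congr (_ + _).
  exact: (congr1 (fun e => ncomp e x v.1) bE).
exact: (congr1 (fun e => ncomp e x v.2) cE).
Qed.
End Pair.

(** The cone of a chain map that lifts a monomorphism [i] to resolutions is a
    resolution of the cokernel of [i]. It takes the place of the long exact
    sequence of Ext in the first variable. *)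
Section Cone.
Variables (K X0 X : kfun k C) (i : nat_trans K X0) (p : nat_trans X0 X).
Hypotheses (i_inj : forall x, injective (i x)) (ip : exact_at i p) (p_epi :
  epi p).
Variables (R : resolution K) (P : resolution X0).
Variable f : forall n, nat_trans (R n) (P n).
Hypotheses (fd : chain_map f)
  (fa : forall x v, resa P x (f 0 x v) = i x (resa R x v)).

Definition cone_obj n : kfun k C :=
  if n is m.+1 then pairk (P m.+1) (R m) else P 0.

Definition cone_d n : nat_trans (cone_obj n.+1) (cone_obj n) :=
  match n with
  | 0 => copair (resd P 0) (f 0)
  | m.+1 => copair (nat_comp (pair_inl _ _) (resd P m.+1))
      (nat_comp (pair_inl _ _) (f m.+1) - nat_comp (pair_inr _ _) (resd R m))
  end.

Lemma cone_dE0 x v : cone_d 0 x v = resd P 0 x v.1 + f 0 x v.2.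
Proof. by []. Qed.
Lemma cone_dES n x v :
  cone_d n.+1 x v = (resd P n.+1 x v.1 + f n.+1 x v.2, - resd R n x v.2).
Proof.
change (pair_inl (P n.+1) (R n) x (resd P n.+1 x v.1)
  + (nat_comp (pair_inl (P n.+1) (R n)) (f n.+1)
     - nat_comp (pair_inr (P n.+1) (R n)) (resd R n)) x v.2 = 
  (resd P n.+1 x v.1 + f n.+1 x v.2, - resd R n x v.2)).
rewrite nat_subE !nat_compE; congr pair => /=; first by rewrite subr0.
by rewrite !add0r.
Qed.

Definition cone_aug : nat_trans (cone_obj 0) X := nat_comp p (resa P).

Lemma cone_aug_epi : epi cone_aug.
Proof.
move=> x w; have [v <-] := p_epi w; have [u <-] := @resa_epi _ _ _ P x v.
by exists u.
Qed.

Lemma cone_exact0 : exact_at (cone_d 0) cone_aug.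
Proof.
move=> x v; split=> [/ip[w]|[u <-]].
  have [r <-] := @resa_epi _ _ _ R x w; rewrite -fa => e.
  have : resa P x (v - f 0 x r) = 0 by rewrite linearB /= e subrr.
  by move=> /(@res_exact0 _ _ _ P)[q qE]; exists (q, r);
    rewrite cone_dE0 /= qE subrK.
rewrite cone_dE0 nat_compE linearD /= resad add0r fa.
by apply/ip; exists (resa R x u.2).
Qed.

Lemma cone_exactS n : exact_at (cone_d n.+1) (cone_d n).
Proof.
move=> x v; split=> [e|[u <-]]; last first.
  case: n v u => [|n] v u.
    by rewrite cone_dE0 cone_dES /= linearD /= resdd add0r linearN /= fd subrr.
  rewrite [cone_d n.+1 x _]cone_dES cone_dES /= linearD /= resdd add0r.
  by rewrite !linearN /= fd subrr resdd !oppr0.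
have [r rE] : exists r, resd R n x r = v.2.
  case: n v e => [|n] v e.
    apply: (@res_exact0 _ _ _ R x v.2).1; apply: (i_inj (x := x)).
    rewrite linear0 -fa; move: e; rewrite cone_dE0 => /(congr1 (resa P x)).
    by rewrite linearD /= resad add0r linear0.
  apply: (@res_exactS _ _ _ R n x v.2).1.
  by move: e; rewrite cone_dES => /(congr1 snd)/eqP; rewrite oppr_eq0 => /eqP.
have : resd P n x (v.1 + f n.+1 x r) = 0.
  rewrite linearD /= fd rE; case: n v r e rE => [|n] v r e _ //.
  by move: e; rewrite cone_dES => /(congr1 fst).
move=> /(@res_exactS _ _ _ P)[q qE]; exists (q, - r).
by rewrite cone_dES /= !linearN /= qE addrK rE opprK; case: (v).
Qed.

Definition cone_resolution : resolution X :=
  @Resolution k C X cone_obj cone_d cone_aug cone_aug_epi cone_exact0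
    cone_exactS.

Hypotheses (Rp : proj_resolution R) (Pp : proj_resolution P).

Lemma cone_projective : proj_resolution cone_resolution.
Proof. by case=> [|n];
  [exact: Pp|apply: pairk_projective; [exact: Pp|exact: Rp]]. Qed.

Lemma cone_vanishing0 T : vanishing 0 X0 T -> vanishing 0 X T.
Proof.
move=> v0; apply: (vanishing_resolution cone_projective) => c /mem_cocycles cc.
apply: (v0 P Pp); apply/mem_cocycles => x v.
rewrite -(cc x (v, 0)); congr (c x _).
by rewrite [RHS]cone_dE0 linear0 addr0.
Qed.

(* A cocycle of the cone is a pair of a cochain [c] on [P] and a cochain [b] on
   [R]. The first is a coboundary [c' d], and [b - c' f] is a cocycle. *)
Lemma cone_vanishingS T n :
  vanishing n.+1 X0 T -> vanishing n K T -> vanishing n.+1 X T.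
Proof.
move=> v0 vK; apply: (vanishing_resolution cone_projective) =>
  c /mem_cocycles cc.
have cP : nat_comp c (pair_inl _ _) \in smem (cocycles P T n.+1).
  apply/mem_cocycles => x v; rewrite nat_compE -(cc x (v, 0)); congr (c x _).
  by rewrite [RHS]cone_dES /= !linear0 addr0.
have /mem_coboundariesS[c' c'E] := v0 P Pp _ cP.
pose b := nat_comp c (pair_inr _ _) - nat_comp c' (f n).
have bc : b \in smem (cocycles R T n).
  apply/mem_cocycles => x v; rewrite nat_subE !nat_compE -fd -c'E nat_compE.
  rewrite -linearB /= -[RHS]oppr0 -(cc x (0, v)) -linearN; congr (c x _).
  rewrite [in RHS]cone_dES /= linear0 add0r.
  by rewrite -[LHS]/(0 - _, _ - 0) -[RHS]/(- _, - - _) add0r subr0 opprK.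
have cE x v : c x v = c' x (resd P n x v.1) + (b x v.2 + c' x (f n x v.2)).
  have bE w : b x w = c x (pair_inr _ _ x w) - c' x (f n x w).
    by rewrite nat_subE !nat_compE.
  rewrite bE subrK -c'E nat_compE.
  have := linearD (c x) (pair_inl _ _ x v.1) (pair_inr _ _ x v.2).
  by rewrite -pair_split.
clearbody b; have := vK R Rp _ bc;
  case: n c b c' c'E cE {cc cP bc v0 vK} => [|n] c b c' c'E cE.
  move=> /mem_zero_submod b0; apply/mem_coboundariesS; exists c' => x v.
  by rewrite cE b0 add0r cone_dE0 linearD.
move=> /mem_coboundariesS[b' b'E]; apply/mem_coboundariesS.
exists (copair c' (- b')) => x v; rewrite cE b'E [in RHS]cone_dES /=.
rewrite linearD /= -addrA; congr (_ + _).
by rewrite linearN scaleN1r opprK addrC.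
Qed.

End Cone.

Lemma vanishing0_epi (X0 X T : kfun k C) (p : nat_trans X0 X) :
  epi p -> vanishing 0 X0 T -> vanishing 0 X T.
Proof.
move=> pe; have Rp := @std_resolution_proj _ _ (nat_ker p).
have Pp := @std_resolution_proj _ _ X0.
have [f [fd fa]] := chain_map_exists (std_resolution X0) Rp (nat_ker_incl p).
exact: (cone_vanishing0 (@nat_ker_incl_inj _ _ p) (@nat_ker_exact _ _ p) pe fd
  fa).
Qed.

Lemma vanishing_shift_source (X0 X T : kfun k C) (p : nat_trans X0 X) n :
  epi p ->
  vanishing n.+1 X0 T -> vanishing n (nat_ker p) T -> vanishing n.+1 X T.
Proof.
move=> pe; have Rp := @std_resolution_proj _ _ (nat_ker p).
have Pp := @std_resolution_proj _ _ X0.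
have [f [fd fa]] := chain_map_exists (std_resolution X0) Rp (nat_ker_incl p).
exact: (cone_vanishingS (@nat_ker_incl_inj _ _ p) (@nat_ker_exact _ _ p) pe fd
  fa).
Qed.

End FunctorConstructions.

(** * Restriction along adjoint functors *)

Record adjunction (C D : category) (j : functor C D) (r : functor D C) :=
  Adjunction {
  adj_unit : forall c : C, hom c (r (j c));
  adj_counit : forall d : D, hom (j (r d)) d;
  adj_unitN : forall (c c' : C) (f : hom c c'),
    cmp (fhom r (fhom j f)) (adj_unit c) = cmp (adj_unit c') f;
  adj_counitN : forall (d d' : D) (g : hom d d'),
    cmp g (adj_counit d) = cmp (adj_counit d') (fhom j (fhom r g));
  adj_triangle_l : forall c : C,
    cmp (adj_counit (j c)) (fhom j (adj_unit c)) = idm (j c);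
  adj_triangle_r : forall d : D,
    cmp (fhom r (adj_counit d)) (adj_unit (r d)) = idm (r d)
}.

Section Adjunction.
Context {k : comPzRingType} {C D : category}.
Variables (j : functor C D) (r : functor D C) (adj : adjunction j r).

(** When [j] is left adjoint to [r], restriction along [r] is left adjoint to
    restriction along [j]. *)
Section Transpose.
Variables (X : kfun k C) (E : kfun k D).

Lemma adj_trN (a : nat_trans (pull r X) E) c c' (f : hom c c') v :
  lin_comp (a (j c')) (kmap X (adj_unit adj c')) (kmap X f v)
  = kmap (pull j E) f (lin_comp (a (j c)) (kmap X (adj_unit adj c)) v).
Proof.
rewrite !lin_compE -kmapM -adj_unitN kmapM.
exact: (ncompN a (fhom j f)).
Qed.
Definition adj_tr (a : nat_trans (pull r X) E) : nat_trans X (pull j E) :=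
  @NatTrans k C X (pull j E)
    (fun c => lin_comp (a (j c)) (kmap X (adj_unit adj c))) (adj_trN a).

Lemma adj_unN (b : nat_trans X (pull j E)) d d' (g : hom d d') v :
  lin_comp (kmap E (adj_counit adj d')) (b (r d')) (kmap (pull r X) g v)
  = kmap E g (lin_comp (kmap E (adj_counit adj d)) (b (r d)) v).
Proof.
by rewrite !lin_compE -kmapM adj_counitN kmapM [b _ _]ncompN.
Qed.
Definition adj_un (b : nat_trans X (pull j E)) : nat_trans (pull r X) E :=
  @NatTrans k D (pull r X) E
    (fun d => lin_comp (kmap E (adj_counit adj d)) (b (r d))) (adj_unN b).

Lemma adj_trK a : adj_un (adj_tr a) = a.
Proof.
apply: nat_ext => d v; rewrite -[LHS]/(kmap E _ (a _ (kmap X _ v))) -ncompN.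
by congr (a d _); rewrite -[LHS]kmapM adj_triangle_r kmap1.
Qed.

Lemma adj_unK b : adj_tr (adj_un b) = b.
Proof.
apply: nat_ext => c v; rewrite -[LHS]/(kmap E _ (b _ (kmap X _ v))) ncompN.
by rewrite -[LHS]kmapM adj_triangle_l kmap1.
Qed.

Lemma adj_unB a b : adj_un (a - b) = adj_un a - adj_un b.
Proof. by apply: nat_ext => d v; rewrite nat_subE /= scaleN1r linearB. Qed.
End Transpose.

(** A left adjoint of an exact functor preserves projectives. *)
Lemma projective_pull_adj (X : kfun k C) :
  projective X -> projective (pull r X).
Proof.
move=> Xp G H p a pE.
have [b bE] := Xp _ _ (pull_nat j p) (adj_tr a) (fun c => pE (j c)).
exists (adj_un b); rewrite -[RHS]adj_trK -bE; apply: nat_ext => d v.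
exact: ncompN.
Qed.

Lemma proj_resolution_pull_adj (B : kfun k C) (P : resolution B) :
  proj_resolution P -> proj_resolution (pull_resolution r P).
Proof. by move=> Pp n; exact: projective_pull_adj. Qed.

Section TransposeCochains.
Variables (B : kfun k C) (E : kfun k D) (P : resolution B).

Lemma adj_un_cocycle n (c : nat_trans (P n) (pull j E)) :
  c \in smem (cocycles P (pull j E) n) ->
  adj_un c \in smem (cocycles (pull_resolution r P) E n).
Proof.
by move=> /mem_cocycles cc; apply/mem_cocycles => d v; rewrite /= cc linear0.
Qed.

Lemma adj_tr_cocycle n (c : nat_trans (pull r (P n)) E) :
  c \in smem (cocycles (pull_resolution r P) E n) ->
  adj_tr c \in smem (cocycles P (pull j E) n).
Proof.
move=> /mem_cocycles cc; apply/mem_cocycles => x v; rewrite /= -ncompN.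
exact: (cc (j x) (kmap (P n.+1) (adj_unit adj x) v)).
Qed.

Lemma adj_un_coboundary n (c : nat_trans (P n) (pull j E)) :
  c \in smem (coboundaries P (pull j E) n) ->
  adj_un c \in smem (coboundaries (pull_resolution r P) E n).
Proof.
case: n c => [|n] c.
  move=> c0; rewrite (mem_zero_submod c).1 //; apply/mem_zero_submod.
  by apply: nat_ext => d v; exact: linear0.
move=> /mem_coboundariesS[b bE]; apply/mem_coboundariesS.
by exists (adj_un b) => d v; rewrite /= bE.
Qed.

Lemma adj_tr_coboundary n (c : nat_trans (pull r (P n)) E) :
  c \in smem (coboundaries (pull_resolution r P) E n) ->
  adj_tr c \in smem (coboundaries P (pull j E) n).
Proof.
case: n c => [|n] c.
  move=> c0; rewrite (mem_zero_submod c).1 //; apply/mem_zero_submod.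
  exact: nat_ext.
move=> /mem_coboundariesS[e eE]; apply/mem_coboundariesS.
exists (adj_tr e) => x v.
apply: etrans (eE (j x) (kmap (P n.+1) (adj_unit adj x) v)) _.
by congr (e _ _); exact: (ncompN (resd P n) (adj_unit adj x) v).
Qed.
End TransposeCochains.

Lemma orth_pull_adj (B : kfun k C) (E : kfun k D) :
  orth (pull r B) E -> orth B (pull j E).
Proof.
move=> BE n P Pp c cc; rewrite -[c]adj_unK; apply: adj_tr_coboundary.
by apply: BE (proj_resolution_pull_adj Pp) _ _; exact: adj_un_cocycle.
Qed.

End Adjunction.

(** * Vanishing over a product of categories *)

Section Coinduction.
Context {k : comPzRingType} {C D : category}.
Variables (I : Type) (o : I -> D) (G : I -> kfun k C).

Section CoinductionMap.
Variables (x y : prodc C D) (f : hom x y).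

Lemma coind_map_linear :
  linear (fun (phi : prodmod (fun u : {i : I & hom x.2 (o i)} => G (tag u) x.1))
    => (fun u : {i : I & hom y.2 (o i)} => kmap (G (tag u)) f.1
         (phi (existT _ (tag u) (cmp (tagged u) f.2))))
    : prodmod (fun u : {i : I & hom y.2 (o i)} => G (tag u) y.1)).
Proof. by move=> a u v; apply: prodmod_ext => i;
  rewrite !prodmod_linP linearP. Qed.
End CoinductionMap.

Lemma coind_map1 (x : prodc C D) v : mklin (coind_map_linear (idm x)) v = v.
Proof. by apply: prodmod_ext => -[i h]; rewrite /= kmap1 cmpm1. Qed.
Lemma coind_mapM (x y z : prodc C D) (g : hom y z) (f : hom x y) v :
  mklin (coind_map_linear (cmp g f)) v
  = mklin (coind_map_linear g) (mklin (coind_map_linear f) v).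
Proof. by apply: prodmod_ext => -[i h]; rewrite /= kmapM cmpA. Qed.

(** The right adjoint of the restriction to the slices over the objects
    [o i]. *)
Definition coind : kfun k (prodc C D) :=
  @KFun k (prodc C D)
    (fun x => prodmod (fun u : {i : I & hom x.2 (o i)} => G (tag u) x.1))
    (fun x y f => mklin (coind_map_linear f)) coind_map1 coind_mapM.

Section Transpose.
Variable X : kfun k (prodc C D).

Section Tr.
Variable a : forall i, nat_trans (pull (slice_l C (o i)) X) (G i).
Let to_slice (x : prodc C D) (u : {i : I & hom x.2 (o i)}) :
  hom x ((x.1, o (tag u)) : prodc C D) := (idm x.1, tagged u).

Lemma coind_tr_linear (x : prodc C D) :
  linear (fun v : X x => (fun u => a (tag u) x.1 (kmap X (to_slice u) v))
    : coind x).
Proof.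
by move=> c u v; apply: prodmod_ext => i; rewrite prodmod_linP !linearP.
Qed.
Lemma coind_trN (x y : prodc C D) (f : hom x y) v :
  mklin (@coind_tr_linear y) (kmap X f v)
  = kmap coind f (mklin (@coind_tr_linear x) v).
Proof.
apply: prodmod_ext => -[i h] /=.
apply: etrans _ (ncompN (a i) f.1
  (kmap X (@to_slice x (existT _ i (cmp h f.2))) v)); congr (a i _ _).
by rewrite /= -!kmapM; congr (kmap X _ v); rewrite /= cmp1m cmpm1 cmp1m.
Qed.
Definition coind_tr : nat_trans X coind :=
  @NatTrans k _ X coind (fun x => mklin (@coind_tr_linear x)) coind_trN.
End Tr.

Section Un.
Variables (b : nat_trans X coind) (i : I).
Lemma coind_un_linear c :
  linear (fun v : X (c, o i) => (b (c, o i) v : prodmod _)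
    (existT (fun i' => hom (o i) (o i')) i (idm (o i))) : G i c).
Proof. by move=> a u v; rewrite linearP. Qed.
Lemma coind_unN c c' (f : hom c c') v :
  mklin (@coind_un_linear c') (kmap (pull (slice_l C (o i)) X) f v)
  = kmap (G i) f (mklin (@coind_un_linear c) v).
Proof.
rewrite /=; have -> := @ncompN _ _ _ _ b (c, o i) (c', o i) (f, idm (o i)) v.
by rewrite /= cmp1m.
Qed.
Definition coind_un : nat_trans (pull (slice_l C (o i)) X) (G i) :=
  @NatTrans k C (pull (slice_l C (o i)) X) (G i)
    (fun c => mklin (@coind_un_linear c)) coind_unN.
End Un.

Lemma coind_trK a i : coind_un (coind_tr a) i = a i.
Proof.
apply: nat_ext => c v; exact: (congr1 (a i c) (@kmap1 _ _ X (c, o i) v)).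
Qed.

Lemma coind_unK b : coind_tr (coind_un b) = b.
Proof.
apply: nat_ext => -[c d] v; apply: prodmod_ext => -[i h] /=.
have -> := @ncompN _ _ _ _ b (c, d) (c, o i) (idm c, h) v.
by rewrite /= kmap1 cmp1m.
Qed.
End Transpose.
End Coinduction.

Section Slices.
Context {k : comPzRingType} {C D : category}.
Implicit Types X Y : kfun k (prodc C D).

(** Restriction to a slice has an exact right adjoint, the coinduction from
    that slice. *)
Lemma projective_slice X (d : D) :
  projective X -> projective (pull (slice_l C d) X).
Proof.
move=> Xp G H p a pE; pose o (_ : unit) := d.
pose cp : nat_trans (coind o (fun _ => G)) (coind o (fun _ => H)) :=
  coind_tr (G := fun _ => H) (fun i => nat_comp p (coind_un (nat_id _) i)).
have cpE x v u : cp x v u = p x.1 (v u).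
  by case: u => -[] h; rewrite /= kmap1 cmp1m.
have [|b bE] := Xp _ _ cp (coind_tr (fun _ => a)).
  move=> x w; have ex u : exists v, p x.1 v = w u by exact: pE.
  exists (fun u => sval (cid (ex u))); apply: prodmod_ext => u.
  by rewrite cpE (svalP (cid (ex u))).
exists (coind_un b tt); apply: nat_ext => c v.
rewrite -[in RHS](coind_trK (o := o) (G := fun _ => H) (fun _ => a) tt) -bE.
by rewrite -[RHS]/(cp _ _ _) cpE.
Qed.

Lemma vanishing_coind X I (o : I -> D) (G : I -> kfun k C) n :
  (forall i, vanishing n (pull (slice_l C (o i)) X) (G i)) ->
  vanishing n X (coind o G).
Proof.
move=> GX P Pp c /mem_cocycles cc.
pose Q i := pull_resolution (slice_l C (o i)) P.
have Qp i : proj_resolution (Q i) by move=> m; exact: projective_slice.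
have ci i : coind_un c i \in smem (coboundaries (Q i) (G i) n).
  apply: GX => //; apply/mem_cocycles => x v.
  by rewrite -[LHS]/(c (x, o i) (resd P n (x, o i) v) _) cc.
case: n c cc ci {GX} => [|n] c cc ci.
  apply/mem_zero_submod; rewrite -[c]coind_unK; apply: nat_ext => x v.
  apply: prodmod_ext => u; have /mem_zero_submod e := ci (tag u).
  exact: (congr1 (fun e => ncomp e x.1 _) e).
have {}ci i : exists b : nat_trans (Q i n) (G i),
    forall x v, coind_un c i x v = b x (resd (Q i) n x v).
  by have /mem_coboundariesS := ci i.
apply/mem_coboundariesS; exists (coind_tr (fun i => sval (cid (ci i)))) => x v.
rewrite -{1}[c]coind_unK; apply: prodmod_ext => u.
rewrite -[LHS]/(coind_un c (tag u) x.1 _) (svalP (cid (ci (tag u)))) /=.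
by rewrite ncompN.
Qed.

Section SliceEmbedding.
Variable Y : kfun k (prodc C D).

Definition slice_coind : kfun k (prodc C D) :=
  coind id (fun d => pull (slice_l C d) Y).

Definition slice_emb : nat_trans Y slice_coind :=
  coind_tr (fun d => nat_id (pull (slice_l C d) Y)).

Lemma slice_emb_inj x : injective (slice_emb x).
Proof.
case: x => c d u v.
move=> /(congr1 (fun phi : slice_coind (c, d) => phi (existT _ d (idm d)))).
by rewrite /= !kmap1.
Qed.

(** Each slice of [slice_coind] is a product of slices of [Y]. *)
Lemma orth_slice_coind (F : kfun k C) d :
  (forall d', orth F (pull (slice_l C d') Y)) ->
  orth F (pull (slice_l C d) slice_coind).
Proof.
move=> FY n; pose T (u : {d' : D & hom d d'}) := pull (slice_l C (tag u)) Y.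
have prl u c : linear (fun phi : slice_coind (c, d) => phi u : T u c) by [].
have prN u c c' (f : hom c c') v :
    mklin (@prl u c') (kmap (pull (slice_l C d) slice_coind) f v)
    = kmap (T u) f (mklin (@prl u c) v).
  by case: u => d' h; rewrite /= cmpm1.
apply: (@vanishing_target_product _ _ _ _ _ T
  (fun u => @NatTrans k C (pull (slice_l C d) slice_coind) (T u) _ (prN u))).
- by move=> x v; exists v.
- by move=> x v v0; exact: prodmod_ext.
by move=> u; exact: FY.
Qed.
End SliceEmbedding.

(** Embed [Y] into the functor coinduced from its slices, for which the
    vanishing is that of the slices, and iterate with the cokernel. *)
Lemma kunneth_vanishing n X Y :
  (forall d d', orth (pull (slice_l C d) X) (pull (slice_l C d') Y)) ->
  vanishing n X Y.
Proof.
elim: n Y => [|n IH] Y XY; have e_inj := @slice_emb_inj Y;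
  have v0 m : vanishing m X (slice_coind Y)
    by apply: vanishing_coind => d; exact: XY.
  exact: (vanishing0_mono e_inj).
have ex := nat_coker_exact (slice_emb Y).
have ep := @nat_coker_epi _ _ _ _ (slice_emb Y).
apply: (vanishing_shift_target e_inj ex ep) => //.
apply: IH => d d'.
apply: (@orth_cokernel _ _ _ _ _ _ (pull_nat (slice_l C d') (slice_emb Y))
  (pull_nat (slice_l C d') (nat_coker_pi (slice_emb Y)))).
- by move=> x; exact: e_inj.
- by move=> x; exact: (ex (x, d')).
- by move=> x; exact: (ep (x, d')).
- exact: XY.
by apply: orth_slice_coind => d''; exact: XY.
Qed.

Lemma kunneth_orth X Y :
  (forall d d', orth (pull (slice_l C d) X) (pull (slice_l C d') Y)) ->
  orth X Y.
Proof. by move=> XY n; exact: kunneth_vanishing. Qed.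

End Slices.

(** * Actions of the integers: polynomial and periodic *)

Definition diff (M : zmodType) (f : nat -> M) (t : nat) : M := f t.+1 - f t.

Section Differences.
Context {k : comPzRingType}.
Implicit Types M N : lmodType k.

Lemma iter_diff_ext M d (f g : nat -> M) :
  f =1 g -> iter d (@diff M) f =1 iter d (@diff M) g.
Proof. by move=> /funext->. Qed.

Lemma iter_diff_linear M N (h : {linear M -> N}) d f t :
  iter d (@diff N) (fun s => h (f s)) t = h (iter d (@diff M) f t).
Proof. by elim: d t => [|d IH] t //=; rewrite /diff !IH linearB. Qed.

(** The first difference of [f] is constant by induction, and a sequence with
    constant difference [c] and period [m] satisfies [m c = 0]. *)
Lemma periodic_polynomial_constant M (m : nat) (r : k) d (f : nat -> M) :
  r * m%:R = 1 -> (forall t, f (t + m)%N = f t) ->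
  (forall t, iter d (@diff M) f t = 0) -> forall t, f t = f 0%N.
Proof.
move=> rm; elim: d f => [|d IH] f fm fd t; first by rewrite [f t]fd [f 0%N]fd.
have dc s : diff f s = diff f 0.
  apply: IH => [u|u]; first by rewrite /diff -addSn !fm.
  by rewrite -iterSr.
have fE s : f s = f 0%N + diff f 0 *+ s.
  elim: s => [|s IHs]; first by rewrite addr0.
  by rewrite mulrS addrCA -IHs -(dc s) /diff subrK.
suff c0 : diff f 0 = 0 by rewrite fE c0 mul0rn addr0.
have : f 0%N + diff f 0 *+ m = f 0%N by rewrite -fE -[m]add0n fm.
rewrite -[X in _ = X]addr0 => /addrI cm.
by rewrite -[LHS]scale1r -rm -scalerA scaler_nat cm scaler0.
Qed.

End Differences.

Section Action.
Context {k : comPzRingType} {A : addcat}.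
Implicit Types F G Q : kfun k A.

Lemma acmpMnl (x y z : A) (g : ahom y z) (f : ahom x y) t :
  acmp (g *+ t) f = acmp g f *+ t.
Proof.
elim: t => [|t IH]; first by rewrite !mulr0n acmp0m.
by rewrite !mulrS acmpDl IH.
Qed.
Lemma acmpMnr (x y z : A) (g : ahom y z) (f : ahom x y) t :
  acmp g (f *+ t) = acmp g f *+ t.
Proof.
elim: t => [|t IH]; first by rewrite !mulr0n acmpm0.
by rewrite !mulrS acmpDr IH.
Qed.

(** Multiplication by [t] is a natural endomorphism of the identity functor of
    an additive category; hence it acts on every functor, compatibly with all
    natural transformations. *)
Lemma int_actN F t (x y : A) (f : @hom A x y) v :
  kmap F (aid y *+ t : @hom A y y) (kmap F f v)
  = kmap F f (kmap F (aid x *+ t : @hom A x x) v).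
Proof.
rewrite -!kmapM; congr (kmap F _ v).
by rewrite /= acmpMnl acmpMnr acmp1m acmpm1.
Qed.
Definition int_act F t : nat_trans F F :=
  @NatTrans k A F F (fun x => kmap F (aid x *+ t : @hom A x x))
    (fun x y f v => int_actN t f v).

Lemma int_act_nat F G (a : nat_trans F G) t :
  nat_comp a (int_act F t) = nat_comp (int_act G t) a.
Proof. by apply: nat_ext => x v; exact: ncompN. Qed.

Definition poly_act d F := forall t, iter d (@diff _) (int_act F) t = 0.

Definition periodic_act m F := forall t, int_act F (t + m) = int_act F t.

Lemma poly_actP d F : poly_act d F <-> forall x v t,
  iter d (@diff _) (fun s => kmap F (aid x *+ s : @hom A x x) v) t = 0.
Proof.
have ev_lin x v : linear (fun a : nat_trans F F => a x v) by [].
have E x v t : iter d (@diff _) (fun s => kmap F (aid x *+ s : @hom A x x) v) t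
    = iter d (@diff _) (int_act F) t x v.
  exact: (iter_diff_linear (mklin (ev_lin x v)) d (int_act F) t).
split=> [e x v t|e t]; first by rewrite E e.
by apply: nat_ext => x v; rewrite -E e.
Qed.

(** An operation on all functors that commutes with natural transformations
    and vanishes on [F] acts on a resolution of [F] by chain maps that lift
    zero. *)
Lemma act_null F G (phi : forall H : kfun k A, nat_trans H H) n
    (P : resolution F) c :
  (forall H H' (a : nat_trans H H'), nat_comp a (phi H) = nat_comp (phi H') a)
    ->
  phi F = 0 -> proj_resolution P -> c \in smem (cocycles P G n) ->
  nat_comp c (phi (P n)) \in smem (coboundaries P G n).
Proof.
move=> phiN phi0 Pp cc.
have phiE H H' (a : nat_trans H H') x v : a x (phi H x v) = phi H' x (a x v).
  exact: (congr1 (fun e => ncomp e x v) (phiN _ _ a)).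
apply: (null_chain_map_coboundary Pp (f := fun n => phi (P n))) cc.
  by move=> m x v; rewrite phiE.
by move=> x v; rewrite phiE phi0.
Qed.

Lemma iter_diff_act_nat d t H H' (a : nat_trans H H') :
  nat_comp a (iter d (@diff _) (int_act H) t)
  = nat_comp (iter d (@diff _) (int_act H') t) a.
Proof.
rewrite -[LHS](iter_diff_linear (hom_post H a)).
rewrite -[RHS](iter_diff_linear (hom_pre H' a)).
by apply: iter_diff_ext => s; exact: int_act_nat.
Qed.

(** The class of [t c] is a function of [t] that is periodic because of one
    of the functors and polynomial because of the other; so it is constant,
    and its values at 1 and 0 are the class of [c] and zero. *)
Lemma orth_poly_periodic m (r : k) d F G : r * m%:R = 1 ->
  periodic_act m F /\ poly_act d G \/ poly_act d F /\ periodic_act m G ->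
  int_act G 0 = 0 -> orth F G.
Proof.
move=> rm FG G0 n P Pp c cc.
pose S := coboundaries P G n.
pose f t := quotm_pi S (nat_comp (int_act G t) c).
have fd e t : iter e (@diff _) f t
    = quotm_pi S (nat_comp (iter e (@diff _) (int_act G) t) c).
  exact: (iter_diff_linear (lin_comp (quotm_pi S) (hom_pre G c)) e (int_act G)
    t).
have e0 : (forall t, f (t + m)%N = f t) /\ (forall t, iter d (@diff _) f t = 0).
  case: FG => -[Fe Ge]; split=> t.
  - apply/eqP; rewrite -subr_eq0; apply/eqP.
    rewrite -[LHS](linearB (quotm_pi S)); apply: (quotm_pi_eq0 S _).2.
    rewrite -!int_act_nat -[_ - _](linearB (hom_post _ c)) /=.
    apply: (@act_null F G (fun H => int_act H (t + m) - int_act H t)) => //.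
      move=> H H' a; rewrite -[LHS]/(hom_post _ a _) -[RHS]/(hom_pre _ a _).
      by rewrite !linearB /= !int_act_nat.
    by rewrite Fe subrr.
  - rewrite fd Ge; apply: (quotm_pi_eq0 S _).2.
    by rewrite -[nat_comp _ _]/(hom_pre _ c _) linear0 rpred0.
  - by rewrite /f Ge.
  - rewrite fd; apply: (quotm_pi_eq0 S _).2; rewrite -iter_diff_act_nat.
    apply: (@act_null F G (fun H => iter d (@diff _) (int_act H) t)) => //.
    exact: iter_diff_act_nat.
have := periodic_polynomial_constant rm e0.1 e0.2 1.
rewrite /f G0.
have -> : nat_comp (int_act G 1) c = c.
  by apply: nat_ext => x v; rewrite /= mulr1n kmap1.
rewrite -[nat_comp 0 c]/(hom_pre _ c 0) !linear0 => e.
exact: (quotm_pi_eq0 S c).1 e.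
Qed.

(** * Functors that factor through the quotient by an ideal *)

(** What the cotriviality of [I] provides; see [kcotrivial_unit]. *)
Definition unit_in_ideal (I : ideal A) := forall x : A, exists m (r : k),
  r * m%:R = 1 /\ aid x *+ m \in imem I x x.

Definition factors (I : ideal A) F := forall (x y : A) (f g : ahom x y),
  f - g \in imem I x y ->
  forall v, kmap F (f : @hom A x y) v = kmap F (g : @hom A x y) v.

Definition reduced F := forall (x y : A) v, kmap F (0 : @hom A x y) v = 0.

Lemma reduced_act0 F : reduced F -> int_act F 0 = 0.
Proof. by move=> F0; apply: nat_ext => x v; rewrite /= mulr0n F0. Qed.

Lemma factors_mono F G (a : nat_trans F G) I :
  (forall x, injective (a x)) -> factors I G -> factors I F.
Proof.
by move=> ai GI x y f g fg v; apply: (ai y); rewrite !ncompN (GI _ _ _ _ fg).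
Qed.

Section Coinduced.
Variables (I : ideal A) (x : A) (J : lmodType k).

Lemma inv_fun_closed y : submod_closed
  (fun phi : prodmod (fun _ : ahom y x => J) =>
    `[< (forall f g, f - g \in imem I y x -> phi f = phi g) /\ phi 0 = 0 >]).
Proof.
split=> [|a u v]; rewrite !unfold_in; first exact/asboolP.
move=> /asboolP[uI u0] /asboolP[vI v0]; apply/asboolP; split=> [f g fg|].
  by rewrite !prodmod_linP (uI f g) ?(vI f g).
by rewrite prodmod_linP u0 v0 scaler0 addr0.
Qed.
Definition inv_fun y := Submod (inv_fun_closed y).

Lemma inv_funP y (phi : submodT (inv_fun y)) :
  (forall f g, f - g \in imem I y x -> val phi f = val phi g) /\ val phi 0 = 0.
Proof. by have /asboolP := valP phi. Qed.

Lemma inv_fun_map_mem (y z : A) (h : ahom y z) (phi : submodT (inv_fun y)) :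
  ((fun f : ahom z x => val phi (acmp f h)) : prodmod (fun _ => J))
  \in smem (inv_fun z).
Proof.
have [pI p0] := inv_funP phi; rewrite unfold_in; apply/asboolP; split.
  by move=> f g fg; apply: pI; rewrite -acmpBl; apply: ideal_r.
by rewrite acmp0m.
Qed.

Lemma inv_fun_map_linear (y z : A) (h : ahom y z) :
  linear (fun phi : submodT (inv_fun y) =>
    exist _ (fun f : ahom z x => val phi (acmp f h)) (inv_fun_map_mem h phi)
    : submodT (inv_fun z)).
Proof. by move=> a u v; apply: val_inj; exact: prodmod_ext. Qed.

Definition coinduced_map (y z : A) (h : @hom A y z) :
  {linear submodT (inv_fun y) -> submodT (inv_fun z)} :=
  mklin (@inv_fun_map_linear y z h).
Lemma coinduced_map1 y v : coinduced_map (@idm A y) v = v.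
Proof. by apply: val_inj; apply: prodmod_ext => f; rewrite /= acmpm1. Qed.
Lemma coinduced_mapM (y z t : A) (g : @hom A z t) (f : @hom A y z) v :
  coinduced_map (cmp g f) v = coinduced_map g (coinduced_map f v).
Proof. by apply: val_inj; apply: prodmod_ext => h; rewrite /= acmpA. Qed.

(** The functions [A(y, x) / I(y, x) -> J] that vanish at zero. *)
Definition coinduced : kfun k A :=
  @KFun k A (fun y => submodT (inv_fun y) : lmodType k) coinduced_map
    coinduced_map1 coinduced_mapM.

Lemma coinduced_ext y (u v : coinduced y) : (forall f, val u f = val v f) ->
  u = v.
Proof. by move=> e; apply: val_inj; exact: prodmod_ext. Qed.

Lemma coinduced_factors : factors I coinduced.
Proof.
move=> y z f g fg v; apply: coinduced_ext => h.
by apply: (inv_funP v).1; rewrite -acmpBr; exact: ideal_l.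
Qed.
Lemma coinduced_reduced : reduced coinduced.
Proof.
by move=> y z v; apply: coinduced_ext => h; rewrite /= acmpm0 (inv_funP v).2.
Qed.
(** Composition with [t id_y] on the source is composition with [t id_x] on the
    target, so that the period depends on [x] and not on [y]. *)
Lemma coinduced_periodic m : aid x *+ m \in imem I x x ->
  periodic_act m coinduced.
Proof.
move=> mI t; apply: nat_ext => y v; apply: coinduced_ext => h.
apply: (inv_funP v).1; rewrite -acmpBr mulrnDr addrC addKr acmpMnr acmpm1.
by rewrite -[h]acmp1m -acmpMnl; apply: ideal_r.
Qed.
End Coinduced.

Section ProductFunctor.
Variables (I : Type) (T : I -> kfun k A).

Lemma prodk_map_linear (x y : A) (f : @hom A x y) :
  linear (fun (v : prodmod (fun i => T i x)) =>
    (fun i => kmap (T i) f (v i)) : prodmod (fun i => T i y)).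
Proof. by move=> a u v; apply: prodmod_ext => i;
  rewrite !prodmod_linP linearP. Qed.
Lemma prodk_map1 (x : A) v : mklin (prodk_map_linear (@idm A x)) v = v.
Proof. by apply: prodmod_ext => i; rewrite /= kmap1. Qed.
Lemma prodk_mapM (x y z : A) (g : @hom A y z) (f : @hom A x y) v :
  mklin (prodk_map_linear (cmp g f)) v
  = mklin (prodk_map_linear g) (mklin (prodk_map_linear f) v).
Proof. by apply: prodmod_ext => i; rewrite /= kmapM. Qed.
Definition prodk : kfun k A :=
  @KFun k A (fun x => prodmod (fun i => T i x))
    (fun x y f => mklin (prodk_map_linear f)) prodk_map1 prodk_mapM.

Lemma prodk_prj_linear i (x : A) : linear (fun v : prodk x => v i : T i x).
Proof. by []. Qed.
Definition prodk_prj i : nat_trans prodk (T i) :=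
  @NatTrans k A prodk (T i) (fun x => mklin (@prodk_prj_linear i x))
    (fun x y f v => erefl).

Lemma vanishing_prodk F n :
  (forall i, vanishing n F (T i)) -> vanishing n F prodk.
Proof.
apply: (vanishing_target_product (pr := prodk_prj)).
  by move=> x v; exists v.
by move=> x v v0; exact: prodmod_ext.
Qed.
End ProductFunctor.

Section Envelope.
Variables (I : ideal A) (Q : kfun k A) (QI : factors I Q) (Q0 : reduced Q).

(** Dually to a free cover, [v] in [Q y] is sent to all [f |-> Q f v]. *)
Definition envelope : kfun k A := prodk (fun x : A => coinduced I x (Q x)).

Lemma envelope_emb_mem (y : A) (v : Q y) x :
  ((fun f : ahom y x => kmap Q (f : @hom A y x) v) : prodmod (fun _ => Q x))
  \in smem (inv_fun I x (Q x) y).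
Proof.
by rewrite unfold_in; apply/asboolP; split=> [f g fg|]; [exact: QI|exact: Q0].
Qed.

Lemma envelope_emb_linear y : linear (fun v : Q y =>
  (fun x => exist _ (fun f : ahom y x => kmap Q (f : @hom A y x) v)
    (envelope_emb_mem v x) : coinduced I x (Q x) y) : envelope y).
Proof.
move=> a u v; apply: prodmod_ext => x; apply: coinduced_ext => f.
exact: linearP.
Qed.
Lemma envelope_embN (y z : A) (h : @hom A y z) v :
  mklin (@envelope_emb_linear z) (kmap Q h v)
  = kmap envelope h (mklin (@envelope_emb_linear y) v).
Proof.
apply: prodmod_ext => x; apply: coinduced_ext => f; exact/esym/kmapM.
Qed.
Definition envelope_emb : nat_trans Q envelope :=
  @NatTrans k A Q envelope (fun y => mklin (@envelope_emb_linear y))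
    envelope_embN.

Lemma envelope_emb_inj y : injective (envelope_emb y).
Proof.
move=> u v /(congr1 (fun w : envelope y => val (w y) (aid y))).
by rewrite /= -[aid y]/(@idm A y) !kmap1.
Qed.

Lemma envelope_coker_factors : factors I (nat_coker envelope_emb).
Proof.
move=> y z f g fg w; have [v <-] := @nat_coker_epi _ _ _ _ envelope_emb y w.
rewrite -!ncompN; congr (nat_coker_pi envelope_emb z _).
by apply: prodmod_ext => x; exact: coinduced_factors.
Qed.
Lemma envelope_coker_reduced : reduced (nat_coker envelope_emb).
Proof.
move=> y z w; have [v <-] := @nat_coker_epi _ _ _ _ envelope_emb y w.
rewrite -ncompN -[RHS](linear0 (nat_coker_pi envelope_emb z)).
congr (nat_coker_pi envelope_emb z _).
by apply: prodmod_ext => x; exact: coinduced_reduced.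
Qed.

Lemma orth_envelope d F : unit_in_ideal I -> poly_act d F -> orth F envelope.
Proof.
move=> uI Fd n; apply: vanishing_prodk => x; have [m [r [rm mI]]] := uI x.
apply: (orth_poly_periodic (F := F) (G := coinduced I x (Q x)) rm).
  by right; split; [exact: Fd|exact: coinduced_periodic].
exact/reduced_act0/coinduced_reduced.
Qed.
End Envelope.

(** Embed [Q] into its envelope. Each factor of the envelope is periodic, with
    a period that depends on the factor; the cokernel is again reduced and
    factors through the same quotient. *)
Lemma orth_poly_factors d (I : ideal A) F Q :
  unit_in_ideal I -> poly_act d F -> factors I Q -> reduced Q -> orth F Q.
Proof.
move=> uI Fd QI Q0 n; elim: n Q QI Q0 => [|n IH] Q QI Q0;
  have e_inj := envelope_emb_inj (QI := QI) (Q0 := Q0);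
  have v0 := orth_envelope (Q := Q) uI Fd.
  exact: (vanishing0_mono e_inj).
apply: (vanishing_shift_target e_inj (nat_coker_exact _)
  (@nat_coker_epi _ _ _ _ _)).
  exact: v0.
by apply: IH; [exact: envelope_coker_factors|exact: envelope_coker_reduced].
Qed.

Section Representable.
Variables (I : ideal A) (x : A).

Let rmap (y z : A) (f : ahom y z) :
  {linear freemod k (qhom I x y) -> freemod k (qhom I x z)} :=
  free_lift (fun q => delta (qcmp (qpi I f) q)).
Let rmap_delta (y z : A) (f : ahom y z) q :
  rmap f (delta q) = delta (qcmp (qpi I f) q).
Proof. exact: free_lift_delta. Qed.

Lemma repr_map1 (y : A) v : rmap (aid y) v = v.
Proof.
rewrite -[RHS]/(lin_id _ v); move: v; apply: free_ext => q.
by rewrite rmap_delta qcmp1m.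
Qed.
Lemma repr_mapM (y z t : A) (g : ahom z t) (f : ahom y z) v :
  rmap (acmp g f) v = rmap g (rmap f v).
Proof.
rewrite -[RHS]/(lin_comp (rmap g) (rmap f) v); move: v; apply: free_ext => q.
by rewrite lin_compE !rmap_delta qcmpA qcmp_pi.
Qed.

(** [y |-> k[A(x, y) / I(x, y)]] *)
Definition qrepr : kfun k A :=
  @KFun k A (fun y => freemod k (qhom I x y)) rmap repr_map1 repr_mapM.

Lemma qrepr_mapE (y z : A) (f : @hom A y z) q :
  kmap qrepr f (delta q) = delta (qcmp (qpi I f) q).
Proof. exact: rmap_delta. Qed.

Lemma qrepr_factors : factors I qrepr.
Proof.
move=> y z f g fg; apply: free_ext => q; rewrite !qrepr_mapE.
by have -> : qpi I f = qpi I g by exact/qpi_eq.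
Qed.

Lemma qrepr_periodic m : aid x *+ m \in imem I x x -> periodic_act m qrepr.
Proof.
move=> mI t; apply: nat_ext => y; apply: free_ext => q.
rewrite -[LHS]/(kmap qrepr _ _) -[RHS]/(kmap qrepr _ _) !qrepr_mapE.
have [h <-] := qpi_surj q; rewrite !qcmp_pi; congr delta; apply/qpi_eq.
rewrite -acmpBl mulrnDr addrC addKr acmpMnl acmp1m.
by rewrite -[h]acmpm1 -acmpMnr; exact: ideal_l.
Qed.

Section Yoneda.
Variables (Q : kfun k A) (QI : factors I Q) (s : Q x).

Let ev (y : A) (q : qhom I x y) : Q y := kmap Q (repr q : @hom A x y) s.
Let evE (y : A) (f : ahom x y) : ev (qpi I f) = kmap Q (f : @hom A x y) s.
Proof. by apply: QI; apply/qpi_eq; rewrite /qpi reprK. Qed.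

Lemma yonedaN (y z : A) (f : @hom A y z) v :
  free_lift (@ev z) (kmap qrepr f v) = kmap Q f (free_lift (@ev y) v).
Proof.
rewrite -[LHS]/(lin_comp (free_lift _) (kmap qrepr f) v).
rewrite -[RHS]/(lin_comp (kmap Q f) (free_lift _) v).
move: v; apply: free_ext => q; have [h <-] := qpi_surj q.
by rewrite !lin_compE qrepr_mapE qcmp_pi !free_lift_delta !evE -kmapM.
Qed.
Definition yoneda : nat_trans qrepr Q := @NatTrans k A qrepr Q _ yonedaN.
Lemma yoneda_id : yoneda x (delta (qpi I (aid x))) = s.
Proof.
by rewrite -[LHS]/(free_lift _ _) free_lift_delta evE -[aid x]/(@idm A x) kmap1.
Qed.
End Yoneda.
End Representable.

Section QuotientCover.
Variables (I : ideal A) (Q : kfun k A) (QI : factors I Q).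

(** The cover of [Q], as a functor on [A / I], by representable functors. *)
Definition qcover : kfun k A :=
  dsumk (fun u : {x : A & Q x} => qrepr I (tag u)).

Definition qcover_aug : nat_trans qcover Q :=
  dsumk_lift (fun u : {x : A & Q x} => yoneda QI (tagged u)).

Lemma qcover_epi : epi qcover_aug.
Proof.
move=> y s; exists (dsumk_in (fun u : {x : A & Q x} => qrepr I (tag u))
  (existT _ y s) y (delta (qpi I (aid y)))).
by rewrite dsumk_lift_in; exact: yoneda_id.
Qed.

Lemma qcover_ker_factors : factors I (nat_ker qcover_aug).
Proof.
apply: (factors_mono (@nat_ker_incl_inj _ _ _ _ qcover_aug)).
by move=> y z f g fg v; apply: dsum_ext => u; exact: qrepr_factors.
Qed.

Lemma orth_qcover d F :
  unit_in_ideal I -> poly_act d F -> reduced F -> orth qcover F.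
Proof.
move=> uI Fd F0 n; apply: vanishing_dsum => u.
have [m [r [rm mI]]] := uI (tag u).
apply: (orth_poly_periodic (F := qrepr I (tag u)) (G := F) rm).
  by left; split; [exact: qrepr_periodic|exact: Fd].
exact: reduced_act0.
Qed.
End QuotientCover.

(** Dual to [orth_poly_factors]: cover [Q] by a sum of functors
    [k[A(x, -) / I(x, -)]], each of them periodic, and iterate with the
    kernel. *)
Lemma orth_factors_poly d (I : ideal A) F Q :
  unit_in_ideal I -> poly_act d F -> reduced F -> factors I Q -> orth Q F.
Proof.
move=> uI Fd F0 QI n; elim: n Q QI => [|n IH] Q QI;
  have pe := @qcover_epi I Q QI; have v0 := orth_qcover (Q := Q) uI Fd F0.
  exact: (vanishing0_epi pe).
apply: (vanishing_shift_source pe); first exact: v0.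
by apply: IH; exact: qcover_ker_factors.
Qed.

End Action.

(** * Cross-effects and iterated differences *)

Section MultiDifference.
Variables (I : eqType) (M : zmodType).
Implicit Types (e : I -> nat) (G : (I -> nat) -> M).

Definition bump_at (i : I) e : I -> nat := fun j => (e j + (j == i))%N.
Definition diff_at (i : I) G e : M := G (bump_at i e) - G e.
Definition diff_along (s : seq I) G := foldr diff_at G s.

Definition constant_in (i : I) G := forall e, G (bump_at i e) = G e.

Lemma bump_atC i j e : bump_at i (bump_at j e) = bump_at j (bump_at i e).
Proof. by apply/funext => l; rewrite /bump_at -!addnA (addnC (l == j)). Qed.

Lemma constant_in_diff i s G : constant_in i G ->
  constant_in i (diff_along s G).
Proof.
move=> Gi; elim: s => [|j s IH] e //=.
by rewrite /diff_at bump_atC !IH.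
Qed.

Lemma diff_along_constant i s G e : i \in s -> constant_in i G ->
  diff_along s G e = 0.
Proof.
move=> + Gi; elim: s e => [|j s IH] e //=; rewrite inE => /orP[/eqP<-|js].
  by rewrite /diff_at (constant_in_diff s Gi) subrr.
by rewrite /diff_at !IH // subrr.
Qed.

End MultiDifference.

Lemma diff_along_sum (n : nat) (M : zmodType) (g : nat -> M) (s : seq 'I_n) e :
  diff_along s (fun e => g (\sum_(i < n) e i)%N) e
  = iter (size s) (@diff M) g (\sum_(i < n) e i)%N.
Proof.
elim: s e => [|j s IH] e //=; rewrite /diff_at !IH /diff.
suff -> : (\sum_(i < n) bump_at j e i = (\sum_(i < n) e i).+1)%N by [].
rewrite /bump_at big_split /= -addn1; congr addn.
by rewrite (bigD1 j) //= eqxx big1 // => i /negbTE->.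
Qed.

Lemma diff_along_linear (k : pzRingType) (I : eqType) (M N : lmodType k)
    (h : {linear M -> N}) (s : seq I) G e :
  diff_along s (fun e => h (G e)) e = h (diff_along s G e).
Proof. by elim: s e => [|j s IH] e //=; rewrite /diff_at !IH linearB. Qed.

Section Lines.
Context {k : comPzRingType} {A : addcat}.
Implicit Types F : kfun k A.

Lemma acmp_suml (x y z : A) (J : Type) (r : seq J) (g : J -> ahom y z) (f :
  ahom x y) :
  acmp (\sum_(j <- r) g j) f = \sum_(j <- r) acmp (g j) f.
Proof.
by apply: (big_morph (fun h => acmp h f)) => [u v|]; rewrite ?acmpDl ?acmp0m.
Qed.
Lemma acmp_sumr (x y z : A) (J : Type) (r : seq J) (g : ahom y z) (f :
  J -> ahom x y) :
  acmp g (\sum_(j <- r) f j) = \sum_(j <- r) acmp g (f j).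
Proof.
by apply: (big_morph (fun h => acmp g h)) => [u v|]; rewrite ?acmpDr ?acmpm0.
Qed.

(** Affine lines and not only the multiples of the identity are considered,
    because a functor such as [y |-> F (x + y)] sends the latter to an affine
    line. *)
Definition poly_on_lines d F := forall (x y : A) (a b : ahom x y) v t,
  iter d (@diff _) (fun s => kmap F (a + b *+ s : @hom A x y) v) t = 0.

(** The difference [Delta^d] of [s |-> F (a + s b) v] at [0] is the image, under
    the codiagonal [y + ... + y -> y], of the multiple difference of the
    elements [F (e_0 b + a, e_1 b, ..., e_(d-1) b) v]. The latter lies in the
    cross-effect, since omitting a coordinate makes it constant in [e_j]. *)
Lemma polynomial_on_lines F : polynomial_functor F ->
  exists d, poly_on_lines d F.
Proof.
case=> -[|d] [// _ Fd]; exists d.+1 => x y a b v t.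
wlog -> : a t / t = 0%N => [H|].
  have := H (a + b *+ t) 0%N erefl; set g := (X in iter _ _ X _) => <-.
  pose f s := kmap F (a + b *+ s : @hom A x y) v.
  have -> : g = fun s => f (t + s)%N.
    by apply/funext => s; rewrite /g /f mulrnDr addrA.
  have shift e s : iter e (@diff _) (fun s => f (t + s)%N) s
    = iter e (@diff _) f (t + s)%N.
    by elim: e s => [|e IH] s //=; rewrite /diff !IH addnS.
  by rewrite shift addn0.
pose X : 'I_d.+1 -> A := fun _ => y.
pose coord (e : 'I_d.+1 -> nat) i : ahom x y := a *+ (i == ord0) + b *+ e i.
pose tau e : ahom x (bip X) := \sum_i acmp (bip_inj X i : ahom y _) (coord e i).
pose w e := kmap F (tau e : @hom A x (bip X)) v.
have tau_prj e i : acmp (bip_prj X i) (tau e) = coord e i.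
  rewrite acmp_sumr (bigD1 i) //= big1 => [|j ji].
    by rewrite addr0 acmpA bip_prj_inj acmp1m.
  by rewrite acmpA bip_prj_inj0 1?eq_sym // acmp0m.
pose sum_all : ahom (bip X) y := \sum_i (bip_prj X i : ahom (bip X) y).
have wE e : kmap F (sum_all : @hom A _ _) (w e)
    = kmap F (a + b *+ (\sum_i e i)%N : @hom A x y) v.
  rewrite /w -kmapM; congr (kmap F _ v); rewrite /= acmp_suml.
  rewrite (eq_bigr (coord e)) => [|i _]; last exact: tau_prj.
  rewrite big_split /= -sumrMnr; congr (_ + _).
  rewrite (bigD1 ord0) //= big1 ?addr0 // => i /negbTE->.
  by rewrite mulr0n.
pose e0 : 'I_d.+1 -> nat := fun _ => 0%N.
have w0 : diff_along (enum 'I_d.+1) w e0 = 0.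
  suff : [set 0]%classic (diff_along (enum 'I_d.+1) w e0) by [].
  rewrite -(Fd X) => j; rewrite -diff_along_linear.
  apply: (@diff_along_constant _ _ j); first by rewrite mem_enum.
  move=> e; rewrite /w -!kmapM; congr (kmap F _ v).
  rewrite /= !acmp_suml; apply: eq_bigr => i _.
  rewrite -!acmpA !tau_prj /coord /bump_at.
  by rewrite [lift j i == j]eq_sym (negbTE (neq_lift j i)) addn0.
have := diff_along_linear (kmap F (sum_all : @hom A _ _)) (enum 'I_d.+1) w e0.
rewrite w0 linear0 => e1.
have := diff_along_sum (fun s => kmap F (a + b *+ s :
  @hom A x y) v) (enum 'I_d.+1) e0.
rewrite size_enum_ord big1 // => <-; rewrite -[RHS]e1; congr diff_along.
by apply/funext => e; rewrite wE.
Qed.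

End Lines.

(** * Finite abelian groups killed by tensoring with [k] *)

Lemma additive_mulrz (U V : zmodType) (f : U -> V) :
  {morph f : x y / x + y} -> forall x (z : int), f (x *~ z) = f x *~ z.
Proof.
move=> fD; have f0 : f 0 = 0 by apply: (addrI (f 0)); rewrite -fD !addr0.
have fN x : f (- x) = - f x.
  by apply: (addrI (f x)); rewrite -fD !subrr.
have fn x n : f (x *+ n) = f x *+ n.
  by elim: n => [|n IH]; rewrite ?mulr0n // !mulrS fD IH.
by move=> x [n|n]; rewrite ?NegzE ?mulrNz ?fN -!pmulrn fn.
Qed.

Section TensorKilled.
Context {k : comPzRingType}.

Lemma tens_bilinear_zero (G N : zmodType) (h : k -> G -> N) :
  (forall g, {morph h^~ g : a b / a + b}) ->
  (forall a, {morph h a : g g' / g + g'}) ->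
  (forall t : tens (intmod k) (intmod G), t = 0) -> forall a g, h a g = 0.
Proof.
move=> hl hr t0 a g.
pose f (u : intmod k * intmod G) : intmod N := h u.1 u.2.
have f0 u : u \in smem (span_submod (@tens_rel _ (intmod k) (intmod G))) ->
    free_lift f u = 0.
  move=> /mem_span_submod; elim=> {u} [|u|c u v _ hu _ hv].
  - exact: linear0.
  - case=> [m m' n|m n n'|c m n|c m n];
      rewrite linearB ?linearD ?linearZ_LR !free_lift_delta /f /=.
    + by rewrite hl -opprD; exact: subrr.
    + by rewrite hr -opprD; exact: subrr.
    + rewrite scalerN; apply/eqP; rewrite subr_eq0; apply/eqP.
      exact: (additive_mulrz (hl n) m c).
    + rewrite scalerN; apply/eqP; rewrite subr_eq0; apply/eqP.
      exact: (additive_mulrz (hr m) n c).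
  by rewrite linearP hu hv scaler0 addr0.
have /(quotm_pi_eq0 (span_submod _) _).1/f0 :
    quotm_pi (span_submod (@tens_rel _ (intmod k) (intmod G)))
      (delta ((a, g) : intmod k * intmod G)) = 0 by exact: t0.
by rewrite free_lift_delta.
Qed.

Section Functional.
Variables (G : zmodType) (p : nat) (g0 : G).
Hypotheses (p_prime : prime p) (g0p : forall r, r *+ p <> g0).

Let pG : set G := fun g => exists r, r *+ p = g.
Let hull (S : set G) : set G := (S `|` pG)%classic.
Let subgroup (S : set G) := forall x y, S x -> S y -> S (x - y).
Let avoids (S : set G) := subgroup (hull S) /\ ~ hull S g0.

Let pG_sub : subgroup pG.
Proof. by move=> _ _ [x <-] [y <-]; exists (x - y); rewrite mulrnBl. Qed.

(** A subgroup that contains [pG] and is maximal among those avoiding [g0] is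
    the kernel of a homomorphism onto [Z/p] sending [g0] to 1. *)
Lemma maximal_avoiding : exists S : set G, [/\ subgroup S,
  forall r, S (r *+ p), ~ S g0 & forall r, exists j : nat, S (r - g0 *+ j)].
Proof.
have [S [[Ssub S0] Smax]] : exists S, avoids S /\
    forall B : set G, (S `<` B)%classic -> ~ avoids B.
  apply: Zorn_bigcup => F FP Ftot; split; last first.
    case=> [[X FX Xg]|[r /g0p//]]; have [_] := FP _ FX; apply; by left.
  move=> x y; have up X :
    F X -> (hull X `<=` hull (\bigcup_(X in F) X))%classic.
    by move=> FX z [zX|]; [left; exists X|right].
  have one X : F X -> hull X x -> hull X y -> hull (\bigcup_(X in F) X) (x - y).
    by move=> FX Xx Xy; apply: (up _ FX); apply: (FP _ FX).1.
  case=> [[X FX Xx]|px]; case=> [[Y FY Yy]|py].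
  - have [XY|YX] := Ftot _ _ FX FY.
      by apply: (one Y) => //; left; [exact: XY|].
    by apply: (one X) => //; left; [|exact: YX].
  - by apply: (one X) => //; [left|right].
  - by apply: (one Y) => //; [right|left].
  by right; exact: pG_sub.
have S00 : hull S 0 by right; exists 0; rewrite mul0rn.
have SN x : hull S x -> hull S (- x) by move=> Sx; rewrite -sub0r; exact: Ssub.
have SD x y : hull S x -> hull S y -> hull S (x + y).
  by move=> Sx Sy; rewrite -[y]opprK; apply: Ssub => //; exact: SN.
have SM x n : hull S x -> hull S (x *+ n).
  move=> Sx; elim: n => [|n IH]; rewrite ?mulr0n // mulrS; exact: SD.
have Sp r n : (p %| n)%N -> hull S (r *+ n).
  by move=> /dvdnP[c ->]; right; exists (r *+ c); rewrite -mulrnA.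
exists (hull S); split=> // [r|r]; first exact: Sp.
have [Sr|Sr] := pselect (hull S r); first by exists 0%N; rewrite mulr0n subr0.
pose B : set G := fun g => exists j, hull S (g - r *+ j).
have hB g : hull B g -> B g.
  case=> // pg; exists 0%N; rewrite mulr0n subr0; by right.
have Bg0 : B g0.
  apply: contrapT => nB; apply: (Smax B).
    split; first by move=> g Sg; exists 0%N; rewrite mulr0n subr0; left.
    move=> /(_ r) BS; apply: Sr; left; apply: BS; exists 1%N.
    by rewrite mulr1n subrr.
  split; last by move/hB.
  move=> x y /hB[i Si] /hB[j Sj]; left; exists (i + j * p.-1)%N.
  have -> : x - y - r *+ (i + j * p.-1) = (x - r *+ i) - (y - r *+ j)
    - r *+ (j * p).
    have -> : (j * p = j + j * p.-1)%N by rewrite -mulnS prednK ?prime_gt0.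
    rewrite !mulrnDr.
    set a := r *+ i; set b := r *+ j; set c := r *+ _.
    apply: (addIr (b + c)); rewrite subrK opprD opprB !addrA.
    by rewrite (addrAC _ (- c) b) subrK (addrAC x (- y)) (addrAC _ (- y)).
  by apply: SD; [exact: Ssub|apply/SN/Sp/dvdn_mull].
have [j Sj] := Bg0.
have pj : coprime p j.
  rewrite prime_coprime //; apply/negP => /(Sp r) Sr'; apply: S0.
  by rewrite -(subrK (r *+ j) g0); exact: SD.
have [a _ pa] := Bezoutl j (prime_gt0 p_prime).
rewrite (eqP pj) in pa; exists (a * p.-1)%N.
have -> : r - g0 *+ (a * p.-1) = (g0 - r *+ j) *+ a + r *+ (1 + a * j)
  - g0 *+ (a * p).
  have -> : (a * p = a + a * p.-1)%N by rewrite -mulnS prednK ?prime_gt0.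
  rewrite !mulrnDr mulrnBl -mulrnA.
  rewrite mulr1n (mulnC j a) opprD addrA; congr (_ - _).
  by rewrite [r + _]addrC addrA subrK addrAC subrr add0r.
apply: (SD); last exact/SN/Sp/dvdn_mull.
by apply: SD; [exact: SM|exact: Sp].
Qed.

(** The homomorphism [G -> Z/p -> k/pk] sends [g0] to 1, so that
    [k (x) G = 0] forces [1] into [pk]. *)
Lemma prime_unit_of_tens0 : (forall t : tens (intmod k) (intmod G), t = 0) ->
  exists r : k, r * p%:R = 1.
Proof.
move=> t0; have [S [Ssub Sp Sg0 Sj]] := maximal_avoiding.
pose j r := sval (cid (Sj r));
  have jP r : S (r - g0 *+ j r) := svalP (cid (Sj r)).
have S00 : S 0 by rewrite -(mul0rn G p).
have SN x : S x -> S (- x) by move=> Sx; rewrite -sub0r; exact: Ssub.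
have SD x y : S x -> S y -> S (x + y).
  by move=> Sx Sy; rewrite -[y]opprK; apply: Ssub => //; exact: SN.
have SM x n : S x -> S (x *+ n).
  move=> Sx; elim: n => [|n IH]; rewrite ?mulr0n // mulrS; exact: SD.
have dvd c : S (g0 *+ c) -> (p %| c)%N.
  move=> Sc; apply: contrapT => /negP; rewrite -prime_coprime // => pc.
  have [a _ pa] := Bezoutl c (prime_gt0 p_prime).
  rewrite (eqP pc) in pa; apply: Sg0.
  have -> : g0 = g0 *+ (1 + a * c) - g0 *+ c *+ a.
    by rewrite mulrnDr mulr1n -mulrnA (mulnC c a) addrK.
  apply: Ssub; last exact: SM.
  by have /dvdnP[b ->] := pa; rewrite mulrnA.
have mul_lin : linear (fun x : k^o => x *+ p : k^o).
  by move=> a x y; rewrite mulrnDl scalerMnr.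
pose pk := imm (mklin mul_lin); pose pi := quotm_pi pk.
have pi_p (a : k) c : (p %| c)%N -> pi (a *+ c) = 0.
  move=> /dvdnP[b ->]; apply: (quotm_pi_eq0 pk _).2; apply/mem_imm.
  by exists (a *+ b); rewrite /= -mulrnA.
have piD (x y : k) : pi (x + y) = pi x + pi y := linearD pi x y.
have pi_cong (a : k) c c' : S (g0 *+ c - g0 *+ c') ->
  pi (a *+ c) = pi (a *+ c').
  wlog le : c c' / (c' <= c)%N => [H Sc|Sc].
    case/orP: (leq_total c' c) => le; first exact: H.
    by apply/esym/H => //; rewrite -opprB; exact: SN.
  rewrite -(subnKC le) mulrnDr piD [pi (a *+ (c - c'))]pi_p ?addr0 //;
    apply: dvd.
  by rewrite -(subnKC le) mulrnDr addrC addKr in Sc.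
have h0 : forall (a : k) r, pi (a *+ j r) = 0.
  apply: (tens_bilinear_zero (h := fun (a : k) r => pi (a *+ j r))) t0 =>
    [g a b|a g g'].
    by rewrite mulrnDl piD.
  rewrite -piD -mulrnDr; apply: pi_cong; rewrite mulrnDr.
  have -> : g0 *+ j (g + g') - (g0 *+ j g + g0 *+ j g')
      = (g - g0 *+ j g) + (g' - g0 *+ j g') - (g + g' - g0 *+ j (g + g')).
    by rewrite addrACA -opprD [RHS]addrC opprB addrA subrK.
  by apply: Ssub; [exact: SD|].
have pi1 : pi (1 : k) = 0.
  apply: etrans (h0 1 g0); apply: (pi_cong 1 1%N); rewrite mulr1n; exact: jP.
have /mem_imm[r rE] := (quotm_pi_eq0 pk _).1 pi1.
by exists r; rewrite mulr_natr.
Qed.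

End Functional.

Lemma finite_order (G : zmodType) (e : G) :
  finite_set [set: G] -> exists n, (0 < n)%N && (e *+ n == 0).
Proof.
move=> fG; apply: contrapT => ne; apply: infinite_nat.
have e_inj : injective (fun n => e *+ n).
  move=> m n; wlog le : m n / (m <= n)%N => [H E|E].
    by case/orP: (leq_total m n) => le; [exact: H|exact/esym/H].
  apply/eqP; rewrite eqn_leq le leqNgt; apply/negP => lt; apply: ne.
  exists (n - m)%N; rewrite subn_gt0 lt /=.
  by move: E; rewrite -{1}(subnKC le) mulrnDr -[LHS]addr0 => /addrI<-.
rewrite -[X in finite_set X](preimage_setT (fun n => e *+ n)).
by apply: finite_preimage => // m n _ _; exact: e_inj.
Qed.

Lemma finite_surj_inj (G : zmodType) (f : G -> G) : finite_set [set: G] ->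
  (forall g, exists g', f g' = g) -> injective f.
Proof.
move=> /finite_seqP[s0 sE] fs; pose s := undup s0.
have sG g : g \in s.
  rewrite mem_undup; suff : [set` s0]%classic g by [].
  by rewrite -sE.
have us : uniq [seq f g | g <- s].
  apply: (leq_size_uniq (undup_uniq s0)); last by rewrite size_map.
  by move=> g _; have [g' <-] := fs g; exact: map_f.
move=> g g' e; have lt x : (index x s < size [seq f g | g <- s])%N.
  by rewrite size_map index_mem.
have : index g s == index g' s.
  rewrite -(nth_uniq (f g) (lt g) (lt g') us) !(nth_map g) ?index_mem //.
  by rewrite !nth_index // e.
move=> /eqP/(congr1 (nth g s)); by rewrite !nth_index.
Qed.

Lemma unit_of_primes n : (0 < n)%N ->
  (forall p, prime p -> (p %| n)%N -> exists r : k, r * p%:R = 1) ->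
  exists r : k, r * n%:R = 1.
Proof.
elim/ltn_ind: n => n IH n0 pn.
have [n1|n1] := leqP n 1.
  have -> : n = 1%N by apply/eqP; rewrite eqn_leq n1.
  by exists 1; rewrite mulr1.
have pp := pdiv_prime n1; have [m mE] := dvdnP (pdiv_dvd n).
have m0 : (0 < m)%N by move: n0; rewrite mE muln_gt0 => /andP[].
have [||r rE] := IH m _ m0.
- by rewrite [X in (_ < X)%N]mE ltn_Pmulr // prime_gt1.
- by move=> p p_prime pm; apply: pn => //; rewrite mE dvdn_mulr.
have [q qE] := pn _ pp (pdiv_dvd n).
by exists (r * q); rewrite mE natrM mulrACA rE qE mulr1.
Qed.

(** If [p] divides the order [n] of [e] then [G] is not [p]-divisible: on a
    finite group, multiplication by [p] would be injective and [n / p] would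
    kill [e]. *)
Lemma tens0_unit (G : zmodType) (e : G) : finite_set [set: G] ->
  (forall t : tens (intmod k) (intmod G), t = 0) ->
  exists m (r : k), r * m%:R = 1 /\ e *+ m = 0.
Proof.
move=> fG t0; have ex := finite_order e fG.
case: (ex_minnP ex) => n /andP[n0 /eqP en] nmin.
have [p p_prime /dvdnP[m mE]|r rE] := @unit_of_primes n n0; last by exists n, r.
have [surj|/existsNP[g0 g0p]] := pselect (forall g : G, exists r, r *+ p = g).
  have /= inj := finite_surj_inj (f := fun g => g *+ p) fG surj.
  have m0 : (0 < m)%N by move: n0; rewrite mE muln_gt0 => /andP[].
  have em : e *+ m = 0 by apply: inj; rewrite -mulrnA -mE en mul0rn.
  have := nmin m; rewrite m0 em eqxx => /(_ isT).
  by rewrite mE leqNgt ltn_Pmulr // prime_gt1.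
apply: (prime_unit_of_tens0 p_prime (g0 := g0)) => // r rE.
by apply: g0p; exists r.
Qed.

End TensorKilled.

Lemma kcotrivial_unit (k : comPzRingType) (A : addcat) (I : ideal A) :
  kcotrivial k I -> unit_in_ideal (k := k) I.
Proof.
move=> kI x; have [fx tx] := kI x x.
have [m [r [rm em]]] := tens0_unit (qpi I (aid x)) fx tx.
exists m, r; split=> //; rewrite -[_ *+ _]subr0; apply/qpi_eq.
rewrite qpi0 -em; elim: m {rm em} => [|m IH]; first by rewrite !mulr0n qpi0.
by rewrite !mulrS qpiD IH.
Qed.

Lemma antipolynomial_factors (k : comPzRingType) (A : addcat) (F : kfun k A) :
  antipolynomial_functor F -> exists I : ideal A, unit_in_ideal (k := k) I /\
    factors I F.
Proof.
case=> I [kI [F' [a ab]]]; exists I; split; first exact: kcotrivial_unit.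
move=> x y f g fg v; apply: (bij_inj (ab y)); rewrite !ncompN.
by congr (kmap F' _ _); exact/qpi_eq.
Qed.

(** * Binary biproducts *)

Section Biproduct.
Context {A : addcat}.
Implicit Types x y z : A.

Definition pairfun x y : 'I_2 -> A := fun i => if val i is 0%N then x else y.
Definition bsum x y : A := bip (pairfun x y).
Let i1 : 'I_2 := @Ordinal 2 1 isT.
Definition in1 x y : ahom x (bsum x y) := bip_inj (pairfun x y) ord0.
Definition in2 x y : ahom y (bsum x y) := bip_inj (pairfun x y) i1.
Definition pr1 x y : ahom (bsum x y) x := bip_prj (pairfun x y) ord0.
Definition pr2 x y : ahom (bsum x y) y := bip_prj (pairfun x y) i1.
Arguments in1 {x y}. Arguments in2 {x y}. Arguments pr1 {x y}. Arguments pr2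
  {x y}.

Lemma pr1_in1 x y : acmp (@pr1 x y) in1 = aid x.
Proof. exact: (bip_prj_inj (pairfun x y) ord0). Qed.
Lemma pr2_in2 x y : acmp (@pr2 x y) in2 = aid y.
Proof. exact: (bip_prj_inj (pairfun x y) i1). Qed.
Lemma pr1_in2 x y : acmp (@pr1 x y) in2 = 0.
Proof. exact: (@bip_prj_inj0 A 2 (pairfun x y) ord0 i1). Qed.
Lemma pr2_in1 x y : acmp (@pr2 x y) in1 = 0.
Proof. exact: (@bip_prj_inj0 A 2 (pairfun x y) i1 ord0). Qed.
Lemma bsum_id x y : acmp (@in1 x y) pr1 + acmp (@in2 x y) pr2 = aid (bsum x y).
Proof.
rewrite -sum_bip_inj_prj !big_ord_recl big_ord0 addr0; congr (_ + _).
by have -> : lift ord0 ord0 = i1 by exact: val_inj.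
Qed.

Lemma bsum_ext_to x y z (f g : ahom z (bsum x y)) :
  acmp pr1 f = acmp pr1 g -> acmp pr2 f = acmp pr2 g -> f = g.
Proof.
move=> e1 e2; rewrite -[f]acmp1m -[g]acmp1m -bsum_id !acmpDl -!acmpA.
by rewrite e1 e2.
Qed.

Definition bmap x x' y y' (f : ahom x x') (g : ahom y y') :
  ahom (bsum x y) (bsum x' y') := acmp in1 (acmp f pr1) + acmp in2 (acmp g pr2).

Section Bmap.
Variables (x x' y y' : A) (f : ahom x x') (g : ahom y y').
Lemma pr1_bmap : acmp pr1 (bmap f g) = acmp f pr1.
Proof.
by rewrite acmpDr acmpA pr1_in1 acmp1m acmpA pr1_in2 acmp0m addr0.
Qed.
Lemma pr2_bmap : acmp pr2 (bmap f g) = acmp g pr2.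
Proof.
by rewrite acmpDr acmpA pr2_in1 acmp0m add0r acmpA pr2_in2 acmp1m.
Qed.
Lemma bmap_in1 : acmp (bmap f g) in1 = acmp in1 f.
Proof.
by rewrite acmpDl -!acmpA pr1_in1 acmpm1 pr2_in1 !acmpm0 addr0.
Qed.
Lemma bmap_in2 : acmp (bmap f g) in2 = acmp in2 g.
Proof.
by rewrite acmpDl -!acmpA pr1_in2 !acmpm0 add0r pr2_in2 acmpm1.
Qed.
End Bmap.

Lemma bmap_id x y : bmap (aid x) (aid y) = aid (bsum x y).
Proof. by rewrite /bmap !acmp1m bsum_id. Qed.

Lemma bmap_cmp x x' x'' y y' y'' (f' : ahom x' x'') (f : ahom x x')
    (g' : ahom y' y'') (g : ahom y y') :
  bmap (acmp f' f) (acmp g' g) = acmp (bmap f' g') (bmap f g).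
Proof.
apply: bsum_ext_to.
  by rewrite acmpA !pr1_bmap -!acmpA pr1_bmap.
by rewrite acmpA !pr2_bmap -!acmpA pr2_bmap.
Qed.

(** Adding a fixed summand turns the multiples of the identity into a line. *)
Lemma bmap_scalar_r x y t :
  bmap (aid x) (aid y *+ t) = acmp in1 pr1 + acmp in2 pr2 *+ t.
Proof. by rewrite /bmap acmp1m acmpMnl acmpMnr acmp1m. Qed.
Lemma bmap_scalar_l x y t :
  bmap (aid x *+ t) (aid y) = acmp in2 pr2 + acmp in1 pr1 *+ t.
Proof. by rewrite /bmap acmp1m acmpMnl acmpMnr acmp1m addrC. Qed.
Lemma bmap_0_r x y y' : bmap (aid x) (0 : ahom y y') = acmp in1 pr1.
Proof. by rewrite /bmap acmp0m acmpm0 addr0 acmp1m. Qed.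
Lemma bmap_0_l x x' y : bmap (0 : ahom x x') (aid y) = acmp in2 pr2.
Proof. by rewrite /bmap acmp0m acmpm0 add0r acmp1m. Qed.

Lemma bmap_ideal_r (I : ideal A) x y y' (f g : ahom y y') :
  f - g \in imem I y y' ->
  bmap (aid x) f - bmap (aid x) g \in imem I (bsum x y) (bsum x y').
Proof.
move=> fg; rewrite /bmap opprD addrACA subrr add0r -acmpBr -acmpBl.
by apply: ideal_l; exact: ideal_r.
Qed.

Let AA := prodc A A.
Let AAA := prodc A AA.

Definition plusf : functor AA A :=
  @Functor AA A (fun p => bsum p.1 p.2) (fun p q f => bmap f.1 f.2)
    (fun p => bmap_id p.1 p.2)
    (fun p q r g f => bmap_cmp g.1 f.1 g.2 f.2).

Lemma shear_id (x : AA) : (idm x.1, bmap (aid x.1) (aid x.2)) =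
  @idm AA ((x.1, bsum x.1 x.2) :
    AA) :> @hom AA (x.1, bsum x.1 x.2) (x.1, bsum x.1 x.2).
Proof. by rewrite bmap_id. Qed.
Lemma shear_cmp (x y z : AA) (g : hom y z) (f : hom x y) :
  (acmp g.1 f.1, bmap (acmp g.1 f.1) (acmp g.2 f.2)) =
  @cmp AA (x.1, bsum x.1 x.2) (y.1, bsum y.1 y.2) (z.1, bsum z.1 z.2)
    (g.1, bmap g.1 g.2) (f.1, bmap f.1 f.2).
Proof. by rewrite bmap_cmp. Qed.
Definition shear : functor AA AA :=
  @Functor AA AA (fun p => (p.1, bsum p.1 p.2))
    (fun p q f => (f.1, bmap f.1 f.2))
    shear_id shear_cmp.

Lemma codiag_in1 x : acmp (@pr1 x x + @pr2 x x) in1 = aid x.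
Proof. by rewrite acmpDl pr1_in1 pr2_in1 addr0. Qed.
Lemma codiag_in2 x : acmp (@pr1 x x + @pr2 x x) in2 = aid x.
Proof. by rewrite acmpDl pr2_in2 pr1_in2 add0r. Qed.
Lemma pr1_diag x : acmp pr1 (@in1 x x + @in2 x x) = aid x.
Proof. by rewrite acmpDr pr1_in1 pr1_in2 addr0. Qed.
Lemma pr2_diag x : acmp pr2 (@in1 x x + @in2 x x) = aid x.
Proof. by rewrite acmpDr pr2_in2 pr2_in1 add0r. Qed.

Lemma adj_plus_diag : adjunction plusf (diag A).
Proof.
exists (fun x : AA => (in1, in2) : @hom AA x (bsum x.1 x.2, bsum x.1 x.2))
  (fun a : A => pr1 + pr2 : @hom A (bsum a a) a).
- by move=> x y f; congr pair; rewrite /= ?bmap_in1 ?bmap_in2.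
- move=> a b g; rewrite /= acmpDl acmpDr; congr (_ + _).
    by rewrite pr1_bmap.
  by rewrite pr2_bmap.
- move=> x; rewrite /= acmpDl pr1_bmap pr2_bmap; exact: bsum_id.
- by move=> a; congr pair; rewrite /= ?codiag_in1 ?codiag_in2.
Defined.

(** The functors [(x, y) |-> (y, (x, y))] and [(x, y) |-> (x, (x, y))], that
    separate one occurrence of a variable, and their right adjoints. *)
Definition copy2 : functor AA AAA :=
  @Functor AA AAA (fun p => (p.2, p)) (fun p q f => (f.2, f))
    (fun p => erefl) (fun p q r g f => erefl).
Definition copy1 : functor AA AAA :=
  @Functor AA AAA (fun p => (p.1, p)) (fun p q f => (f.1, f))
    (fun p => erefl) (fun p q r g f => erefl).

Lemma merge2_id (p : AAA) : (idm p.2.1, bmap (aid p.2.2) (aid p.1)) =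
  idm ((p.2.1, bsum p.2.2 p.1) : AA).
Proof. by rewrite bmap_id. Qed.
Lemma merge2_cmp (p q r : AAA) (g : hom q r) (f : hom p q) :
  (acmp g.2.1 f.2.1, bmap (acmp g.2.2 f.2.2) (acmp g.1 f.1)) =
  @cmp AA (p.2.1, bsum p.2.2 p.1) (q.2.1, bsum q.2.2 q.1) (r.2.1,
    bsum r.2.2 r.1)
    (g.2.1, bmap g.2.2 g.1) (f.2.1, bmap f.2.2 f.1).
Proof. by rewrite bmap_cmp. Qed.
Definition merge2 : functor AAA AA :=
  @Functor AAA AA (fun p => (p.2.1, bsum p.2.2 p.1))
    (fun p q f => (f.2.1, bmap f.2.2 f.1)) merge2_id merge2_cmp.

Lemma merge1_id (p : AAA) : (bmap (aid p.2.1) (aid p.1), idm p.2.2) =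
  idm ((bsum p.2.1 p.1, p.2.2) : AA).
Proof. by rewrite bmap_id. Qed.
Lemma merge1_cmp (p q r : AAA) (g : hom q r) (f : hom p q) :
  (bmap (acmp g.2.1 f.2.1) (acmp g.1 f.1), acmp g.2.2 f.2.2) =
  @cmp AA (bsum p.2.1 p.1, p.2.2) (bsum q.2.1 q.1, q.2.2) (bsum r.2.1 r.1,
    r.2.2)
    (bmap g.2.1 g.1, g.2.2) (bmap f.2.1 f.1, f.2.2).
Proof. by rewrite bmap_cmp. Qed.
Definition merge1 : functor AAA AA :=
  @Functor AAA AA (fun p => (bsum p.2.1 p.1, p.2.2))
    (fun p q f => (bmap f.2.1 f.1, f.2.2)) merge1_id merge1_cmp.

Lemma adj_copy2_merge2 : adjunction copy2 merge2.
Proof.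
exists (fun p : AA => (aid p.1, in1 + in2) : @hom AA p (p.1, bsum p.2 p.2))
  (fun p : AAA => (pr2, (aid p.2.1, pr1)) :
     @hom AAA (bsum p.2.2 p.1, (p.2.1, bsum p.2.2 p.1)) p).
- move=> p q f; congr pair; rewrite /= ?acmpm1 ?acmp1m //.
  by rewrite acmpDr bmap_in1 bmap_in2 acmpDl.
- move=> p q f; congr (_, (_, _)); rewrite /= ?acmpm1 ?acmp1m //.
    by rewrite pr2_bmap.
  by rewrite pr1_bmap.
- by move=> p; congr (_, (_, _)); rewrite /= ?acmpm1 ?pr2_diag ?pr1_diag.
- move=> p; congr pair; rewrite /= ?acmpm1 //.
  by rewrite acmpDr bmap_in1 bmap_in2 bsum_id.
Qed.

Lemma adj_copy1_merge1 : adjunction copy1 merge1.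
Proof.
exists (fun p : AA => (in1 + in2, aid p.2) : @hom AA p (bsum p.1 p.1, p.2))
  (fun p : AAA => (pr2, (pr1, aid p.2.2)) :
     @hom AAA (bsum p.2.1 p.1, (bsum p.2.1 p.1, p.2.2)) p).
- move=> p q f; congr pair; rewrite /= ?acmpm1 ?acmp1m //.
  by rewrite acmpDr bmap_in1 bmap_in2 acmpDl.
- move=> p q f; congr (_, (_, _)); rewrite /= ?acmpm1 ?acmp1m //.
    by rewrite pr2_bmap.
  by rewrite pr1_bmap.
- by move=> p; congr (_, (_, _)); rewrite /= ?acmpm1 ?pr2_diag ?pr1_diag.
- move=> p; congr pair; rewrite /= ?acmpm1 //.
  by rewrite acmpDr bmap_in1 bmap_in2 bsum_id.
Qed.

End Biproduct.

Arguments in1 {A x y}.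
Arguments in2 {A x y}.
Arguments pr1 {A x y}.
Arguments pr2 {A x y}.

(** * Separating the variables *)

Section Separation.
Context {k : comPzRingType} {A : addcat}.
Let AA := prodc A A.
Let AAA := prodc A AA.
Implicit Types B C : kfun k AA.

(** The form in which AP-type is used. It is stated on morphisms, without
    cross-effects or factorizations, so that it passes to [Hom_k (B, J)]. *)
Definition AP_functor B := forall x : A,
  (exists I : ideal A, unit_in_ideal (k := k) I /\
    factors I (pull (slice_l A (x : cat_of A)) B)) /\
  exists d, poly_on_lines d (pull (slice_r A (x : cat_of A)) B).

Lemma poly_act_mono (F G : kfun k A) (a : nat_trans F G) d :
  (forall x, injective (a x)) -> poly_act d G -> poly_act d F.
Proof.
move=> ai Gd t; apply: nat_ext => x v; apply: (ai x).
rewrite -[LHS](congr1 (fun e => ncomp e x v) (esym (iter_diff_act_nat d t a))).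
by rewrite Gd linear0.
Qed.

Lemma AP_factors_merge B (x y : A) : AP_functor B ->
  exists I : ideal A, unit_in_ideal (k := k) I /\
    factors I (pull (slice_l A ((x, y) : AA)) (pull (merge1 (A := A)) B)).
Proof.
move=> BAP; have [[I [uI BI]] _] := BAP y; exists I; split=> // u u' f g fg v.
exact: (BI _ _ _ _ (bmap_ideal_r x fg) v).
Qed.

Lemma AP_poly_merge B (x y : A) : AP_functor B ->
  exists d,
    poly_act d (pull (slice_l A ((x, y) : AA)) (pull (merge2 (A := A)) B)).
Proof.
move=> BAP; have [_ [d Bd]] := BAP x; exists d; apply/poly_actP => u v t.
rewrite -[RHS](Bd _ _ (acmp in1 pr1) (acmp in2 pr2) v t).
by apply: iter_diff_ext => s; rewrite -bmap_scalar_r.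
Qed.

Section Kernels.
Variable C : kfun k AA.

(** [spread1] separates the [y] of the first argument of [C (x + y, x + y)], and
    [spread2] the [x] of the second argument of [C (x, x + y)]: restricting
    along [copy2], respectively [copy1], gives these functors back. Setting
    the separated variable [u] to zero gives [collapse1] and [collapse2]. *)
Lemma spread1_id (p : AAA) :
  (bmap (aid p.2.1) (aid p.1), bmap (aid p.2.1) (aid p.2.2)) =
  idm ((bsum p.2.1 p.1, bsum p.2.1 p.2.2) : AA).
Proof. by rewrite !bmap_id. Qed.
Lemma spread1_cmp (p q r : AAA) (g : hom q r) (f : hom p q) :
  (bmap (acmp g.2.1 f.2.1) (acmp g.1 f.1),
    bmap (acmp g.2.1 f.2.1) (acmp g.2.2 f.2.2)) =
  @cmp AA (bsum p.2.1 p.1, bsum p.2.1 p.2.2) (bsum q.2.1 q.1, bsum q.2.1 q.2.2)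
    (bsum r.2.1 r.1, bsum r.2.1 r.2.2)
    (bmap g.2.1 g.1, bmap g.2.1 g.2.2) (bmap f.2.1 f.1, bmap f.2.1 f.2.2).
Proof. by rewrite !bmap_cmp. Qed.
Definition spread1 : functor AAA AA :=
  @Functor AAA AA (fun p => (bsum p.2.1 p.1, bsum p.2.1 p.2.2))
    (fun p q f => (bmap f.2.1 f.1, bmap f.2.1 f.2.2)) spread1_id spread1_cmp.

Definition collapse1 : functor AAA AA :=
  @Functor AAA AA (fun p => (p.2.1, bsum p.2.1 p.2.2))
    (fun p q f => (f.2.1, bmap f.2.1 f.2.2))
    (fun p => shear_id p.2) (fun p q r g f => shear_cmp g.2 f.2).

Lemma spread2_id (p : AAA) : (idm p.2.1, bmap (aid p.1) (aid p.2.2)) =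
  idm ((p.2.1, bsum p.1 p.2.2) : AA).
Proof. by rewrite !bmap_id. Qed.
Lemma spread2_cmp (p q r : AAA) (g : hom q r) (f : hom p q) :
  (acmp g.2.1 f.2.1, bmap (acmp g.1 f.1) (acmp g.2.2 f.2.2)) =
  @cmp AA (p.2.1, bsum p.1 p.2.2) (q.2.1, bsum q.1 q.2.2) 
    (r.2.1, bsum r.1 r.2.2)
    (g.2.1, bmap g.1 g.2.2) (f.2.1, bmap f.1 f.2.2).
Proof. by rewrite !bmap_cmp. Qed.
Definition spread2 : functor AAA AA :=
  @Functor AAA AA (fun p => (p.2.1, bsum p.1 p.2.2))
    (fun p q f => (f.2.1, bmap f.1 f.2.2)) spread2_id spread2_cmp.

Definition collapse2 : functor AAA AA :=
  @Functor AAA AA (fun p => p.2) (fun p q f => f.2)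
    (fun p => erefl) (fun p q r g f => erefl).

Definition proj1_at (p : AAA) : @hom AA (spread1 p) (collapse1 p) :=
  (pr1, aid _).
Lemma proj1N (p q : AAA) (f : hom p q) v :
  kmap C (proj1_at q) (kmap (pull spread1 C) f v)
  = kmap (pull collapse1 C) f (kmap C (proj1_at p) v).
Proof.
rewrite -[LHS](@kmapM _ _ C) -[RHS](@kmapM _ _ C); congr (kmap C _ v).
by congr pair; rewrite /= ?pr1_bmap // acmp1m acmpm1.
Qed.
Definition proj1_trans : nat_trans (pull spread1 C) (pull collapse1 C) :=
  @NatTrans k AAA (pull spread1 C) (pull collapse1 C) _ proj1N.

Definition proj2_at (p : AAA) : @hom AA (spread2 p) (collapse2 p) :=
  (aid _, pr2).
Lemma proj2N (p q : AAA) (f : hom p q) v :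
  kmap C (proj2_at q) (kmap (pull spread2 C) f v)
  = kmap (pull collapse2 C) f (kmap C (proj2_at p) v).
Proof.
rewrite -[LHS](@kmapM _ _ C) -[RHS](@kmapM _ _ C); congr (kmap C _ v).
by congr pair; rewrite /= ?pr2_bmap // acmp1m acmpm1.
Qed.
Definition proj2_trans : nat_trans (pull spread2 C) (pull collapse2 C) :=
  @NatTrans k AAA (pull spread2 C) (pull collapse2 C) _ proj2N.

Hypothesis C_AP : AP_functor C.

Lemma ker1_slice (x y : A) :
  let E := pull (slice_l A ((x, y) : AA)) (nat_ker proj1_trans) in
  exists I : ideal A, [/\ unit_in_ideal (k := k) I, factors I E & reduced E].
Proof.
move=> E; have [[I [uI CI]] _] := C_AP (bsum x y); exists I; split=> //.
  apply: (@factors_mono _ _ _ _ (pull_nat (slice_l A ((x, y) : AA))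
    (nat_ker_incl proj1_trans))) => [u|u u' f g fg v].
    exact: (@nat_ker_incl_inj _ _ _ _ proj1_trans (u, (x, y))).
  have e (h : ahom u u') :
      kmap (pull (slice_l A ((x, y) : AA)) (pull spread1 C)) (h : @hom A u u') v
      = kmap (pull (slice_l A (bsum x y : cat_of A)) C)
          (bmap (aid x) h : @hom A (bsum x u) (bsum x u')) v.
    by congr (kmap C _ v); rewrite /= bmap_id.
  by rewrite !e; exact: (CI _ _ _ _ (bmap_ideal_r x fg) v).
move=> u u' v; apply: val_inj.
have /mem_kerm v0 := valP v.
have -> : val (kmap E (0 : @hom A u u') v)
    = kmap C ((in1, aid _) : @hom AA (x, bsum x y) (bsum x u', bsum x y))
        (proj1_trans ((u, (x, y)) : AAA) (val v)).
  rewrite -[RHS](@kmapM _ _ C); congr (kmap C _ (val v)); congr pair => /=.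
    exact: bmap_0_r.
  by rewrite bmap_id acmp1m.
by rewrite v0 linear0.
Qed.

Lemma ker2_slice (x y : A) :
  let E := pull (slice_l A ((x, y) : AA)) (nat_ker proj2_trans) in
  exists2 d, poly_act d E & reduced E.
Proof.
move=> E; have [_ [d Cd]] := C_AP x; exists d.
  apply: (@poly_act_mono _ _ (pull_nat (slice_l A ((x, y) : AA))
    (nat_ker_incl proj2_trans))); first by move=> u;
    exact: (@nat_ker_incl_inj _ _ _ _ proj2_trans (u, (x, y))).
  apply/poly_actP => u v t.
  rewrite -[RHS](Cd _ _ (acmp in2 pr2) (acmp in1 pr1) v t).
  by apply: iter_diff_ext => s; rewrite -bmap_scalar_l.
move=> u u' v; apply: val_inj.
have /mem_kerm v0 := valP v.
have -> : val (kmap E (0 : @hom A u u') v)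
    = kmap C ((aid _, in2) : @hom AA (x, y) (x, bsum u' y))
        (proj2_trans ((u, (x, y)) : AAA) (val v)).
  rewrite -[RHS](@kmapM _ _ C); congr (kmap C _ (val v)); congr pair => /=.
    by rewrite acmp1m.
  exact: bmap_0_l.
by rewrite v0 linear0.
Qed.

Variables (B : kfun k AA).
Hypothesis B_AP : AP_functor B.

(** In the separated variable [u], the functor [B (x, y + u)] is polynomial and
    the kernel is reduced and antipolynomial. *)
Lemma orth_ker1 : orth B (pull (copy2 (A := A)) (nat_ker proj1_trans)).
Proof.
apply: (orth_pull_adj adj_copy2_merge2); apply: kunneth_orth => -[x y] [x' y'].
have [d Bd] := AP_poly_merge x y B_AP.
have [I [uI EI E0]] := ker1_slice x' y'.
exact: orth_poly_factors uI Bd EI E0.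
Qed.

(** Here [B (x + u, y)] is antipolynomial in [u] and the kernel is reduced and
    polynomial. *)
Lemma orth_ker2 : orth B (pull (copy1 (A := A)) (nat_ker proj2_trans)).
Proof.
apply: (orth_pull_adj adj_copy1_merge1); apply: kunneth_orth => -[x y] [x' y'].
have [I [uI BI]] := AP_factors_merge x y B_AP.
have [d Ed E0] := ker2_slice x' y'.
exact: orth_factors_poly uI Ed E0 BI.
Qed.

End Kernels.

(** * The splitting of [C (x, y)] off [C (x + y, x + y)] *)

(** If [rho] splits [eta] and [B] is orthogonal to the kernel of [rho], then
    every class with values in [G'] comes from [G]. *)
Lemma split_coboundary (D : category) (B G G' K : kfun k D)
    (rho : nat_trans G' G) (eta : nat_trans G G') (kappa : nat_trans K G')
    (P : resolution B) n c :
  (forall x v, rho x (eta x v) = v) -> (forall x, injective (kappa x)) ->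
  exact_at kappa rho -> orth B K -> proj_resolution P ->
  c \in smem (cocycles P G' n) ->
  c - nat_comp eta (nat_comp rho c) \in smem (coboundaries P G' n).
Proof.
move=> re ki kr BK Pp cc.
have [x v|e eE] := @kernel_factor _ _ _ _ _ _ kappa rho
  (c - nat_comp eta (nat_comp rho c)) ki kr.
  by rewrite nat_subE linearB /= re subrr.
rewrite -eE; apply/coboundary_post/(BK n P Pp)/mem_cocycles => x v.
apply: (ki x); rewrite linear0 -[LHS](nat_compE kappa e) eE.
by have /mem_cocycles ccE := cc; rewrite nat_subE !nat_compE ccE !linear0 addr0.
Qed.

Section Comparison.
Variable C : kfun k AA.

Definition sheared : kfun k AA := pull (shear (A := A)) C.
Definition summed : kfun k AA := pull (plusf (A := A)) (pull (diag A) C).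

Let rho1_at (p : AA) :
  @hom AA (bsum p.1 p.2, bsum p.1 p.2) (p.1, bsum p.1 p.2) := (pr1, aid _).
Lemma rho1N (p q : AA) (f : hom p q) v :
  kmap C (rho1_at q) (kmap summed f v) = kmap sheared f (kmap C (rho1_at p) v).
Proof.
rewrite -[LHS](@kmapM _ _ C) -[RHS](@kmapM _ _ C); congr (kmap C _ v).
by congr pair; rewrite /= ?pr1_bmap // acmp1m acmpm1.
Qed.
Definition rho1 : nat_trans summed sheared :=
  @NatTrans k AA summed sheared _ rho1N.

Let eta1_at (p : AA) :
  @hom AA (p.1, bsum p.1 p.2) (bsum p.1 p.2, bsum p.1 p.2) := (in1, aid _).
Lemma eta1N (p q : AA) (f : hom p q) v :
  kmap C (eta1_at q) (kmap sheared f v) = kmap summed f (kmap C (eta1_at p) v).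
Proof.
rewrite -[LHS](@kmapM _ _ C) -[RHS](@kmapM _ _ C); congr (kmap C _ v).
by congr pair; rewrite /= ?bmap_in1 // acmp1m acmpm1.
Qed.
Definition eta1 : nat_trans sheared summed :=
  @NatTrans k AA sheared summed _ eta1N.

Let rho2_at (p : AA) : @hom AA (p.1, bsum p.1 p.2) p := (aid _, pr2).
Lemma rho2N (p q : AA) (f : hom p q) v :
  kmap C (rho2_at q) (kmap sheared f v) = kmap C f (kmap C (rho2_at p) v).
Proof.
rewrite -[LHS](@kmapM _ _ C) -[RHS](@kmapM _ _ C); congr (kmap C _ v).
by congr pair; rewrite /= ?pr2_bmap // acmp1m acmpm1.
Qed.
Definition rho2 : nat_trans sheared C :=
  @NatTrans k AA sheared C _ rho2N.

Let eta2_at (p : AA) : @hom AA p (p.1, bsum p.1 p.2) := (aid _, in2).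
Lemma eta2N (p q : AA) (f : hom p q) v :
  kmap C (eta2_at q) (kmap C f v) = kmap sheared f (kmap C (eta2_at p) v).
Proof.
rewrite -[LHS](@kmapM _ _ C) -[RHS](@kmapM _ _ C); congr (kmap C _ v).
by congr pair; rewrite /= ?bmap_in2 // acmp1m acmpm1.
Qed.
Definition eta2 : nat_trans C sheared :=
  @NatTrans k AA C sheared _ eta2N.

Lemma rho1_eta1 p v : rho1 p (eta1 p v) = v.
Proof.
rewrite -[LHS](@kmapM _ _ C) -[RHS](@kmap1 _ _ C); congr (kmap C _ v);
  congr pair.
  exact: pr1_in1.
exact: acmp1m.
Qed.
Lemma rho2_eta2 p v : rho2 p (eta2 p v) = v.
Proof.
rewrite -[LHS](@kmapM _ _ C) -[RHS](@kmap1 _ _ C); congr (kmap C _ v).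
case: p {v} => x y; congr pair; first exact: acmp1m.
exact: pr2_in2.
Qed.

Definition kappa1 :
  nat_trans (pull (copy2 (A := A)) (nat_ker (proj1_trans C))) summed :=
  @NatTrans k AA (pull (copy2 (A := A)) (nat_ker (proj1_trans C))) summed
    (fun p => nat_ker_incl (proj1_trans C) ((p.2, p) : AAA))
    (fun p q f v => erefl).
Definition kappa2 :
  nat_trans (pull (copy1 (A := A)) (nat_ker (proj2_trans C))) sheared :=
  @NatTrans k AA (pull (copy1 (A := A)) (nat_ker (proj2_trans C))) sheared
    (fun p => nat_ker_incl (proj2_trans C) ((p.1, p) : AAA))
    (fun p q f v => erefl).

Definition rho : nat_trans summed C := nat_comp rho2 rho1.
Definition eta : nat_trans C summed := nat_comp eta1 eta2.

Lemma comparison_coboundary (B : kfun k AA) (P : resolution B) n c :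
  AP_functor B -> AP_functor C -> proj_resolution P ->
  c \in smem (cocycles P summed n) ->
  c - nat_comp eta (nat_comp rho c) \in smem (coboundaries P summed n).
Proof.
move=> BAP CAP Pp cc.
have h1 : c - nat_comp eta1 (nat_comp rho1 c)
  \in smem (coboundaries P summed n).
  apply: (split_coboundary (kappa := kappa1) rho1_eta1) cc => //.
  - by move=> p; exact: (nat_ker_exact (proj1_trans C) (x := (p.2, p))).
  - exact: orth_ker1.
have h2 : nat_comp rho1 c - nat_comp eta2 (nat_comp rho2 (nat_comp rho1 c))
    \in smem (coboundaries P sheared n).
  apply: (split_coboundary (kappa := kappa2) rho2_eta2) (cocycle_post rho1 cc)
    => //.
  - by move=> p; exact: (nat_ker_exact (proj2_trans C) (x := (p.1, p))).
  - exact: orth_ker2.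
have := rpredD h1 (coboundary_post eta1 h2).
rewrite [X in _ + X](linearB (hom_post _ eta1)) /= addrA subrK.
have -> : nat_comp eta (nat_comp rho c)
  = nat_comp eta1 (nat_comp eta2 (nat_comp rho2 (nat_comp rho1 c))).
  exact: nat_ext.
by [].
Qed.

(** Under [adj_plus_diag], restriction along the diagonal is composition with
    [eta]. *)
Lemma adj_un_eta (X : kfun k AA) (c : nat_trans X C) :
  adj_un adj_plus_diag (nat_comp eta c) = pull_nat (diag A) c.
Proof.
apply: nat_ext => a v; rewrite /= -!kmapM -[RHS](@kmap1 _ _ C).
congr (kmap C _ _); congr pair => /=.
  by rewrite acmpm1 codiag_in1.
by rewrite acmpm1 codiag_in2.
Qed.

Lemma rho_tr (X : kfun k AA) (c : nat_trans X C) :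
  nat_comp rho (adj_tr adj_plus_diag (pull_nat (diag A) c)) = c.
Proof.
apply: nat_ext => -[x y] v;
  rewrite /= -!ncompN -!kmapM -[in RHS](@kmap1 _ _ X _ v).
congr (c _ (kmap X _ _)); congr pair => /=.
  by rewrite ?acmpm1 ?acmp1m pr1_in1.
by rewrite ?acmpm1 ?acmp1m pr2_in2.
Qed.

End Comparison.
End Separation.

(** * The comparison on Ext *)

Lemma linear_bijective (k : pzRingType) (M N : lmodType k) (f :
  {linear M -> N}) :
  (forall x, f x = 0 -> x = 0) -> (forall y, exists x, f x = y) -> bijective f.
Proof.
move=> f0 fs; have fi : injective f.
  move=> x y e; apply/eqP; rewrite -subr_eq0; apply/eqP/f0.
  by rewrite linearB /= e subrr.
exists (fun y => sval (cid (fs y))) => x; last exact: svalP (cid (fs x)).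
exact/fi/(svalP (cid (fs (f x)))).
Qed.

Lemma subquot_map_bijective (k : comPzRingType) (M N : lmodType k)
    (Z B : submod M) (Z' B' : submod N) (h : {linear M -> N})
    (hZ : forall x, x \in smem Z -> h x \in smem Z')
    (hB : forall x, x \in smem B -> h x \in smem B') :
  (forall x, x \in smem Z -> h x \in smem B' -> x \in smem B) ->
  (forall y, y \in smem Z' -> exists2 x, x \in smem Z & y - h x \in smem B') ->
  bijective (subquot_map hZ hB).
Proof.
move=> inj surj.
pose cls x (xZ : x \in smem Z) : subquot Z B :=
  quotm_pi (preim_submod (sub_incl Z) B) (exist _ x xZ : submodT Z).
pose cls' y (yZ : y \in smem Z') : subquot Z' B' :=
  quotm_pi (preim_submod (sub_incl Z') B') (exist _ y yZ : submodT Z').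
have E x xZ : subquot_map hZ hB (@cls x xZ) = cls' (h x) (hZ x xZ).
  rewrite /subquot_map [LHS]quotm_liftE.
  by congr (quotm_pi _ _); exact: val_inj.
apply: linear_bijective => [q|q].
  have [[x xZ] <-] := quotm_pi_surj q; rewrite (E x xZ) => e.
  apply: (quotm_pi_eq0 (preim_submod (sub_incl Z) B) _).2; apply: inj => //.
  exact: (quotm_pi_eq0 (preim_submod (sub_incl Z') B') _).1 e.
have [[y yZ] <-] := quotm_pi_surj q; have [x xZ xy] := surj y yZ.
exists (cls x xZ); rewrite E; apply/eqP; rewrite eq_sym -subr_eq0; apply/eqP.
rewrite -[LHS](linearB (quotm_pi (preim_submod (sub_incl Z') B'))).
exact: (quotm_pi_eq0 (preim_submod (sub_incl Z') B') _).2.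
Qed.

Section ExtDiagonal.
Context {k : comPzRingType} {A : addcat}.
Let AA := prodc A A.
Variables (B C : kfun k AA).
Hypotheses (B_AP : AP_functor B) (C_AP : AP_functor C).

Section Resolutions.
Variables (P : resolution B) (Q : resolution (pull (diag A) B)).
Hypotheses (Pp : proj_resolution P) (Qp : proj_resolution Q).
Variable f : forall n, nat_trans (Q n) (pull_resolution (diag A) P n).
Hypothesis fl : chain_lift f.

Let DP := pull_resolution (diag A) P.
Let DPp : proj_resolution DP := proj_resolution_pull_adj adj_plus_diag Pp.
Let fd : chain_map f.
Proof. by move=> n x v; exact: (congr1 (fun e => ncomp e x v) (fl.2 n)). Qed.
Let fa x v : resa DP x (f 0 x v) = resa Q x v.
Proof. exact: (congr1 (fun e => ncomp e x v) fl.1). Qed.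

Lemma pull_cocycle n (c : nat_trans (P n) C) : c \in smem (cocycles P C n) ->
  pull_nat (diag A) c \in smem (cocycles DP (pull (diag A) C) n).
Proof. by move=> /mem_cocycles cc; apply/mem_cocycles => x v; exact: cc. Qed.

(** Transposing the restriction of [c] and composing with [rho] gives [c]. *)
Lemma Ext_diag_inj n (c : nat_trans (P n) C) : c \in smem (cocycles P C n) ->
  nat_comp (pull_nat (diag A) c) (f n)
    \in smem (coboundaries Q (pull (diag A) C) n) ->
  c \in smem (coboundaries P C n).
Proof.
move=> cc cfB; have [g [gd ga]] := chain_map_exists Q DPp (nat_id _).
set c' := pull_nat (diag A) c in cfB *.
have c'B : c' \in smem (coboundaries DP (pull (diag A) C) n).
  have h : nat_comp c' (nat_id (DP n)) - nat_comp c' (nat_comp (f n) (g n))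
      \in smem (coboundaries DP (pull (diag A) C) n).
    apply: (chain_map_homotopic DPp (f := fun n => nat_id (DP n))
      (g := fun n => nat_comp (f n) (g n))) => //.
    - by move=> m x v; rewrite !nat_compE fd gd.
    - by move=> x v; rewrite nat_compE fa ga.
    - exact: pull_cocycle.
  have := rpredD h (chain_map_coboundary gd cfB).
  have -> : nat_comp (nat_comp c' (f n)) (g n)
    = nat_comp c' (nat_comp (f n) (g n)).
    exact: nat_ext.
  by rewrite subrK; have -> :
    nat_comp c' (nat_id (DP n)) = c' by exact: nat_ext.
rewrite -[c]rho_tr; apply: coboundary_post.
exact: adj_tr_coboundary.
Qed.

(** The transpose of [y] takes values in [summed C], so that it is cohomologous
    to a cocycle that factors through [eta]. *)
Lemma Ext_diag_surj n (y : nat_trans (Q n) (pull (diag A) C)) :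
  y \in smem (cocycles Q (pull (diag A) C) n) ->
  exists2 c, c \in smem (cocycles P C n) &
    y - nat_comp (pull_nat (diag A) c) (f n)
      \in smem (coboundaries Q (pull (diag A) C) n).
Proof.
move=> yc; have [g [gd ga]] := chain_map_exists Q DPp (nat_id _).
have ygc := chain_map_cocycle gd yc.
pose b := adj_tr adj_plus_diag (nat_comp y (g n) :
  nat_trans (pull (diag A) (P n)) _).
have bc : b \in smem (cocycles P (summed C) n) by exact: adj_tr_cocycle.
exists (nat_comp (rho C) b); first exact: cocycle_post.
have := adj_un_coboundary adj_plus_diag
  (comparison_coboundary B_AP C_AP Pp bc).
set d := nat_comp _ _.
have -> : adj_un adj_plus_diag (b - nat_comp (eta C) (nat_comp (rho C) b))
    = nat_comp y (g n) - pull_nat (diag A) (nat_comp (rho C) b).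
  by rewrite -adj_un_eta adj_unB adj_trK.
move=> /(chain_map_coboundary fd) h1.
have h2 : nat_comp y (nat_id (Q n)) - nat_comp y (nat_comp (g n) (f n))
    \in smem (coboundaries Q (pull (diag A) C) n).
  apply: (chain_map_homotopic Qp (f := fun n => nat_id (Q n))
    (g := fun n => nat_comp (g n) (f n))) => //.
  - by move=> m x v; rewrite !nat_compE gd fd.
  - by move=> x v; rewrite nat_compE ga fa.
have := rpredD h2 h1; rewrite [X in _ + X](linearB (hom_pre _ (f n))) /=.
have -> : nat_comp y (nat_id (Q n)) = y by exact: nat_ext.
have -> : nat_comp (nat_comp y (g n)) (f n) = nat_comp y (nat_comp (g n) (f n)).
  exact: nat_ext.
by rewrite addrA subrK.
Qed.

End Resolutions.

Lemma Ext_diag_bijective n : bijective (Ext_restr (diag A) n B C).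
Proof.
have Pp := @std_resolution_proj _ _ B.
have Qp := @std_resolution_proj _ _ (pull (diag A) B).
apply: subquot_map_bijective => [c cc cB|y yc].
  exact: (Ext_diag_inj Pp (std_liftP (diag A) B)).
have [c cc cy] := Ext_diag_surj Pp Qp (std_liftP (diag A) B) yc.
by exists c.
Qed.

End ExtDiagonal.

(** * Detecting quasi-isomorphisms by duality *)

Section DualDetection.
Context {k : comPzRingType}.
Variables (X Y : nat -> lmodType k).
Variables (dX : forall n, {linear X n.+1 -> X n}) (dY :
  forall n, {linear Y n.+1 -> Y n}).
Variable T : forall n, {linear Y n -> X n}.
Hypothesis TdY : forall n u, dX n (T n.+1 u) = T n (dY n u).
Hypothesis dXX : forall n u, dX n (dX n.+1 u) = 0.

Definition dual_cocycle (Z : nat -> lmodType k)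
    (d : forall n, {linear Z n.+1 -> Z n}) (J : lmodType k) n (c : Z n -> J) :=
  forall u, c (d n u) = 0.

Definition dual_coboundary (Z : nat -> lmodType k)
    (d : forall n, {linear Z n.+1 -> Z n}) (J : lmodType k) n :
      (Z n -> J) -> Prop :=
  match n with
  | 0 => fun c => forall u, c u = 0
  | m.+1 => fun c => exists b : {linear Z m -> J}, forall u, c u = b (d m u)
  end.

Definition cycle (Z : nat -> lmodType k)
    (d : forall n, {linear Z n.+1 -> Z n}) n : Z n -> Prop :=
  match n with
  | 0 => fun _ => True
  | m.+1 => fun z => d m z = 0
  end.

(* [Hom (T, J)] is a quasi-isomorphism for every [J]. *)
Hypothesis dual_inj : forall (J : lmodType k) n (c : {linear X n -> J}),
  dual_cocycle dX c -> dual_coboundary dY (fun u => c (T n u)) ->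
  dual_coboundary dX c.
Hypothesis dual_surj : forall (J : lmodType k) n (y : {linear Y n -> J}),
  dual_cocycle dY y -> exists2 c : {linear X n -> J}, dual_cocycle dX c &
    dual_coboundary dY (fun u => y u - c (T n u)).

Lemma dual_coboundary_cycle (J : lmodType k) n (c : Y n -> J) y :
  dual_coboundary dY c -> cycle dY y -> c y = 0.
Proof.
by case: n c y => [|n] c y /=; [move=> c0 _|case=> b -> ->; rewrite linear0].
Qed.

(** Exactness of the mapping cone of [T] in positive degrees. Take for [J] the
    chains of the cone modulo its boundaries. The projection is a cocycle of
    the dual cone, so it is a coboundary and vanishes on cycles. Bijectivity of
    [Hom (T, J)] on cohomology for this [J] replaces the exactness of
    [Hom (-, J)], which would require [J] injective. *)
Lemma cone_cycle_boundary n (z : X n.+1) (y : Y n) : dX n z = T n y ->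
  cycle dY y -> exists u w, y = dY n u /\ z = T n.+1 u + dX n.+1 w.
Proof.
move=> zy yc.
have phi_lin : linear (fun p : (Y n.+1 * X n.+2)%type =>
    (T n.+1 p.1 + dX n.+1 p.2, dY n p.1) : (X n.+1 * Y n)%type).
  move=> a [u w] [u' w'] /=; rewrite !linearP.
  rewrite -[RHS]/(a *: (T n.+1 u + dX n.+1 w) + (T n.+1 u' + dX n.+1 w'),
    a *: dY n u + dY n u').
  by congr pair; rewrite scalerDr addrACA.
pose S := imm (mklin phi_lin); pose pi := quotm_pi S.
have c_lin : linear (fun z : X n.+1 => pi (z, 0)).
  move=> a u v; rewrite -[RHS](linearP pi); congr (pi (_, _)).
  by change (0 = a *: (0 : Y n) + 0); rewrite scaler0 addr0.
have b_lin : linear (fun y : Y n => pi (0, y)).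
  move=> a u v; rewrite -[RHS](linearP pi); congr (pi (_, _)).
  by change (0 = a *: (0 : X n.+1) + 0); rewrite scaler0 addr0.
pose c := mklin c_lin; pose b := mklin b_lin.
have piE z' y' : pi (z', y') = c z' + b y'.
  by rewrite -[RHS](linearD pi); congr (pi (_, _)); rewrite /= ?addr0 ?add0r.
have pi0 u w : c (T n.+1 u + dX n.+1 w) + b (dY n u) = 0.
  rewrite -piE; apply: (quotm_pi_eq0 S _).2; apply/mem_imm.
  by exists (u, w).
have cc : dual_cocycle dX c.
  by move=> w; have := pi0 0 w; rewrite !linear0 add0r addr0.
have cT u : c (T n.+1 u) + b (dY n u) = 0.
  by have := pi0 u 0; rewrite linear0 addr0.
have [|c' c'E] := dual_inj cc.
  have nb_lin : linear (fun y => - b y).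
    by move=> a u v; rewrite linearP opprD scalerN.
  exists (mklin nb_lin) => u; apply/eqP; rewrite -subr_eq0 opprK; apply/eqP.
  exact: cT.
have e_lin : linear (fun y => b y + c' (T n y)).
  by move=> a u v; rewrite !linearP scalerDr addrACA.
have [u|c'' c''c eB] := @dual_surj _ n (mklin e_lin).
  by rewrite /= -TdY -c'E addrC; exact: cT.
have := dual_coboundary_cycle eB yc.
rewrite /= -zy c''c subr0 -c'E addrC => e.
have /mem_imm[[u w] /= [zE yE]] : (z, y) \in smem S.
  by apply: (quotm_pi_eq0 S _).1; rewrite -[LHS]/(pi _) piE.
by exists u, w.
Qed.

Lemma cone_boundary0 (z : X 0) : exists u w, z = T 0 u + dX 0 w.
Proof.
have phi_lin : linear (fun p : (Y 0 * X 1)%type => T 0 p.1 + dX 0 p.2).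
  by move=> a u v; rewrite /= !linearP scalerDr addrACA.
pose S := imm (mklin phi_lin); pose c := quotm_pi S.
have c0 u w : c (T 0 u + dX 0 w) = 0.
  by apply: (quotm_pi_eq0 S _).2; apply/mem_imm; exists (u, w).
have cz : c z = 0.
  apply: (dual_inj (c := c)) => [w|u].
    by have := c0 0 w; rewrite linear0 add0r.
  by have := c0 u 0; rewrite linear0 addr0.
have /mem_imm[[u w] /= zE] := (quotm_pi_eq0 S z).1 cz.
by exists u, w.
Qed.

Lemma homology_inj n (u : Y n) w : cycle dY u -> T n u = dX n w ->
  exists u', dY n u' = u.
Proof. by move=> uc /esym e; have [u' [_ [-> _]]] := cone_cycle_boundary e uc;
  exists u'. Qed.

Lemma homology_surj n (z : X n) : cycle dX z ->
  exists2 u, cycle dY u & exists w, dX n w = z - T n u.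
Proof.
case: n z => [|n] z /= zc.
  have [u [w ->]] := cone_boundary0 z; exists u => //; exists w.
  by rewrite addrC addKr.
have zy : dX n z = T n 0 by rewrite zc linear0.
have [|u [w [u0 ->]]] := cone_cycle_boundary zy; first by case: (n) => //= m;
  exact: linear0.
by exists u => //; exists w; rewrite addrC addKr.
Qed.

End DualDetection.

(** * The dual of a functor *)

Section LinearMaps.
Context {k : comPzRingType}.
Variables M N : lmodType k.

Lemma homm_closed : submod_closed (fun phi :
  prodmod (fun _ : M => N) => `[< linear (phi : M -> N) >]).
Proof.
split=> [|a u v]; rewrite !unfold_in.
  by apply/asboolP => a x y; rewrite !prodmod_0E scaler0 addr0.
move=> /asboolP ul /asboolP vl; apply/asboolP => b x y.
by rewrite !prodmod_linP ul vl !scalerDr !scalerA (mulrC a b) addrACA.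
Qed.
Definition homm : lmodType k := submodT (Submod homm_closed).

Lemma homm_linear (phi : homm) : linear (val phi : M -> N).
Proof. by have /asboolP := valP phi. Qed.
Definition homm_fun (phi : homm) : {linear M -> N} := mklin (homm_linear phi).

Lemma homm_of_mem (f : {linear M -> N}) :
  (f : prodmod (fun _ : M => N)) \in smem (Submod homm_closed).
Proof. by rewrite unfold_in; apply/asboolP => a x y; exact: linearP. Qed.
Definition homm_of (f : {linear M -> N}) : homm :=
  exist _ (f : prodmod _) (homm_of_mem f).

Lemma homm_ext (phi psi : homm) : (forall x, homm_fun phi x = homm_fun psi x) ->
  phi = psi.
Proof. by move=> e; apply: val_inj; exact: prodmod_ext. Qed.
Lemma homm_linP a (phi psi : homm) x :
  homm_fun (a *: phi + psi) x = a *: homm_fun phi x + homm_fun psi x.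
Proof. by []. Qed.
End LinearMaps.

Section Dual.
Context {k : comPzRingType} {D : category}.
Variable J : lmodType k.

Section DualFunctor.
Variable F : kfun k (opc D).

Lemma dual_map_linear (x y : D) (f : @hom D x y) :
  linear (fun phi : homm (F x) J =>
    homm_of (lin_comp (homm_fun phi) (@kmap _ _ F y x f)) : homm (F y) J).
Proof. by move=> a u v; apply: homm_ext. Qed.
Lemma dual_map1 (x : D) v : mklin (dual_map_linear (idm x)) v = v.
Proof. by apply: homm_ext => s; rewrite /= (@kmap1 _ _ F). Qed.
Lemma dual_mapM (x y z : D) (g : @hom D y z) (f : @hom D x y) v :
  mklin (dual_map_linear (cmp g f)) v
  = mklin (dual_map_linear g) (mklin (dual_map_linear f) v).
Proof. by apply: homm_ext => s; rewrite /= (@kmapM _ _ F). Qed.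

Definition dualk : kfun k D :=
  @KFun k D (fun x => homm (F x) J) (fun x y f => mklin (dual_map_linear f))
    dual_map1 dual_mapM.

Lemma dual_mapE (x y : D) (f : @hom D x y) (phi : dualk x) s :
  homm_fun (kmap dualk f phi) s = homm_fun phi (@kmap _ _ F y x f s).
Proof. by []. Qed.

Variable G : kfun k D.

Section ToNat.
Variable c : {linear coend F G -> J}.
Lemma to_nat_linear (x : D) (t : G x) :
  linear (fun s : F x => c (coend_tens s t)).
Proof. by move=> a u v; rewrite coend_tens_linl linearP. Qed.
Lemma to_nat_linear2 (x : D) :
  linear (fun t : G x => homm_of (mklin (to_nat_linear t)) : dualk x).
Proof.
by move=> a u v; apply: homm_ext => s;
  rewrite homm_linP /= coend_tens_linr linearP.
Qed.
Lemma to_natN (x y : D) (f : hom x y) t :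
  mklin (@to_nat_linear2 y) (kmap G f t)
    = kmap dualk f (mklin (@to_nat_linear2 x) t).
Proof. by apply: homm_ext => s; rewrite dual_mapE /= coend_tens_balance. Qed.
Definition to_nat : nat_trans G dualk :=
  @NatTrans k D G dualk (fun x => mklin (@to_nat_linear2 x)) to_natN.
Lemma to_natE x t s : homm_fun (to_nat x t) s = c (coend_tens s t).
Proof. by []. Qed.
End ToNat.

Section OfNat.
Variable a : nat_trans G dualk.
Let h (x : D) (s : F x) (t : G x) : J := homm_fun (a x t) s.
Lemma of_nat_linl x t : linear (fun s => @h x s t).
Proof. by move=> b u v; rewrite /h linearP. Qed.
Lemma of_nat_linr x s : linear (@h x s).
Proof. by move=> b u v; rewrite /h linearP homm_linP. Qed.
Lemma of_nat_balance (x y : D) (f : hom x y) (s : F y) (t : G x) :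
  h (@kmap _ _ F y x f s) t = h s (kmap G f t).
Proof. by rewrite /h ncompN dual_mapE. Qed.
Definition of_nat : {linear coend F G -> J} :=
  coend_lift of_nat_linl of_nat_linr of_nat_balance.
Lemma of_natE (x : D) (s : F x) (t : G x) :
  of_nat (coend_tens s t) = homm_fun (a x t) s.
Proof. exact: coend_liftE. Qed.
End OfNat.

End DualFunctor.
End Dual.

Lemma sub_linear (k : pzRingType) (M N : lmodType k) (f g : {linear M -> N}) :
  linear (fun u => f u - g u).
Proof. by move=> a u v;
  rewrite (linearP f) (linearP g) opprD addrACA scalerBr. Qed.

(** * The comparison on Tor *)

Section TorDiagonal.
Context {k : comPzRingType} {A : addcat}.
Let AA := prodc A A.
Variables (F : kfun k (opc AA)) (C : kfun k AA).
Hypothesis C_AP : AP_functor C.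
Implicit Types J : lmodType k.
Hypothesis F_AP : forall J, AP_functor (dualk J F).

Let F' := pull (opf (diag A)) F.

Lemma dual_pullN J (x y : A) (f : @hom A x y) (v : dualk J F' x) :
  lin_id (dualk J F' y) (kmap (dualk J F') f v)
  = kmap (pull (diag A) (dualk J F)) f (lin_id (dualk J F' x) v).
Proof. exact: homm_ext. Qed.
Definition dual_pull J : nat_trans (dualk J F') (pull (diag A) (dualk J F)) :=
  @NatTrans k A (dualk J F') (pull (diag A) (dualk J F))
    (fun x => lin_id (dualk J F' x)) (@dual_pullN J).

Variables (P : resolution C) (Q : resolution (pull (diag A) C)).
Hypotheses (Pp : proj_resolution P) (Qp : proj_resolution Q).
Variable f : forall n, nat_trans (Q n) (pull_resolution (diag A) P n).
Hypothesis fl : chain_lift f.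

Let X n := coend F (P n).
Let Y n := coend F' (Q n).
Let dX n : {linear X n.+1 -> X n} := coend_map F (resd P n).
Let dY n : {linear Y n.+1 -> Y n} := coend_map F' (resd Q n).
Let T n : {linear Y n -> X n} := Tor_restr_chain F f n.

Let T_tens n (x : A) (s : F' x) (v : Q n x) :
  T n (coend_tens s v) = @coend_tens _ _ F (P n) (diag A x) s (f n x v).
Proof. by rewrite /T /Tor_restr_chain lin_compE coend_mapE coend_restrE. Qed.

Let dX_tens n (x : AA) (s : F x) (v : P n.+1 x) :
  dX n (coend_tens s v) = coend_tens s (resd P n x v).
Proof. exact: coend_mapE. Qed.
Let dY_tens n (x : A) (s : F' x) (v : Q n.+1 x) :
  dY n (coend_tens s v) = coend_tens s (resd Q n x v).
Proof. exact: coend_mapE. Qed.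

Let to_nat' (J : lmodType k) n (b : {linear Y n -> J}) :
  nat_trans (Q n) (pull (diag A) (dualk J F)) :=
    nat_comp (dual_pull J) (to_nat b).

Lemma to_nat_cocycle J n (c : {linear X n -> J}) :
  dual_cocycle dX c -> to_nat c \in smem (cocycles P (dualk J F) n).
Proof.
move=> cc; apply/mem_cocycles => x v; apply: homm_ext => s.
by rewrite to_natE -dX_tens cc.
Qed.

Lemma dual_coboundary_of_nat J n (c : {linear X n -> J}) :
  to_nat c \in smem (coboundaries P (dualk J F) n) -> dual_coboundary dX c.
Proof.
case: n c => [|n] c.
  move=> /mem_zero_submod c0 u /=.
  have zl : linear (fun _ : X 0 => 0 : J) by move=> a v w;
    rewrite scaler0 addr0.
  rewrite -[RHS]/(mklin zl u); move: u; apply: coend_ext => x s v.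
  by rewrite -to_natE c0.
move=> /mem_coboundariesS[b bE]; exists (of_nat b) => u.
rewrite -[RHS]/(lin_comp (of_nat b) (dX n) u); move: u;
  apply: coend_ext => x s v.
by rewrite lin_compE dX_tens of_natE -bE to_natE.
Qed.

Lemma to_nat_coboundary J n (b : {linear Y n -> J}) :
  dual_coboundary dY b ->
    to_nat' b \in smem (coboundaries Q (pull (diag A) (dualk J F)) n).
Proof.
case: n b => [|n] b.
  move=> b0; apply/mem_zero_submod; apply: nat_ext => x v.
  by apply: homm_ext => s; exact: b0.
case=> b' b'E; apply/mem_coboundariesS; exists (to_nat' b') => x v.
by apply: homm_ext => s; apply: etrans (b'E _) _; rewrite dY_tens.
Qed.

Lemma dual_coboundary_to_nat J n (b : {linear Y n -> J}) :
  to_nat' b \in smem (coboundaries Q (pull (diag A) (dualk J F)) n) ->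
  dual_coboundary dY b.
Proof.
case: n b => [|n] b.
  move=> /mem_zero_submod b0 u.
  have zl : linear (fun _ : Y 0 => 0 : J) by move=> a v w;
    rewrite scaler0 addr0.
  rewrite -[RHS]/(mklin zl u); move: u; apply: coend_ext => x s v.
  by rewrite -[LHS]/(homm_fun (to_nat' b x v) s) b0.
move=> /mem_coboundariesS[e eE].
have eN (x y : A) (g : @hom A x y) v :
    e y (kmap (Q n) g v) = kmap (dualk J F') g (e x v).
  by rewrite ncompN; exact: homm_ext.
pose e' := @NatTrans k A (Q n) (dualk J F') (fun x => e x) eN.
exists (of_nat e') => u.
rewrite -[RHS]/(lin_comp (of_nat e') (dY n) u); move: u;
  apply: coend_ext => x s v.
rewrite lin_compE dY_tens of_natE.
exact: (congr1 (fun w => homm_fun w s) (eE x v)).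
Qed.

(** Through [to_nat], the dual of the comparison map of complexes is the
    restriction map of cochains from [C] to the dual of [F]. *)
Lemma Tor_diag_dual_inj J n (c : {linear X n -> J}) : dual_cocycle dX c ->
  dual_coboundary dY (fun u => c (T n u)) -> dual_coboundary dX c.
Proof.
move=> cc cT; apply: dual_coboundary_of_nat.
apply: (Ext_diag_inj Pp fl (to_nat_cocycle cc)).
suff -> : nat_comp (pull_nat (diag A) (to_nat c)) (f n)
  = to_nat' (lin_comp c (T n)).
  exact: to_nat_coboundary.
apply: nat_ext => x v; apply: homm_ext => s.
by rewrite -[RHS]/(c (T n (@coend_tens _ _ F' (Q n) x s v))) T_tens.
Qed.

Lemma Tor_diag_dual_surj J n (y : {linear Y n -> J}) : dual_cocycle dY y ->
  exists2 c : {linear X n -> J}, dual_cocycle dX c &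
    dual_coboundary dY (fun u => y u - c (T n u)).
Proof.
move=> yc; have y'c :
  to_nat' y \in smem (cocycles Q (pull (diag A) (dualk J F)) n).
  apply/mem_cocycles => x v; apply: homm_ext => s.
  by rewrite -[LHS]/(y (@coend_tens _ _ F' (Q n) x s (resd Q n x v))) -dY_tens
    yc.
have [c cc cy] := Ext_diag_surj C_AP (F_AP J) Pp Qp fl y'c.
exists (of_nat c).
  move=> u; have zl : linear (fun _ : X n.+1 => 0 : J).
    by move=> a v w; rewrite scaler0 addr0.
  rewrite -[LHS]/(lin_comp (of_nat c) (dX n) u) -[RHS]/(mklin zl u).
  move: u; apply: coend_ext => x s v; rewrite lin_compE dX_tens of_natE.
  by have /mem_cocycles-> := cc.
have ycl := sub_linear y (lin_comp (of_nat c) (T n)).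
apply: (@dual_coboundary_to_nat J n (mklin ycl)).
suff -> : to_nat' (mklin ycl) = to_nat' y
  - nat_comp (pull_nat (diag A) c) (f n) by [].
apply: nat_ext => x v; apply: homm_ext => s.
rewrite nat_subE -[LHS]/(y (@coend_tens _ _ F' (Q n) x s v)
  - of_nat c (T n (@coend_tens _ _ F' (Q n) x s v))).
by rewrite T_tens of_natE.
Qed.

Lemma Tor_of_diag_bijective n : bijective (Tor_of_restr F fl n).
Proof.
have TdY m u : dX m (T m.+1 u) = T m (dY m u) by exact: Tor_restr_chainN.
have dXX m u : dX m (dX m.+1 u) = 0.
  have zl : linear (fun _ : X m.+2 => 0 : X m).
    by move=> a v w; rewrite scaler0 addr0.
  rewrite -[LHS]/(lin_comp (dX m) (dX m.+1) u) -[RHS]/(mklin zl u).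
  move: u; apply: coend_ext => x s v; rewrite lin_compE !dX_tens resdd.
  exact: (linear0 (mklin (coend_tens_linr s))).
have cycY m u : u \in smem (cycles F' Q m) -> cycle dY u.
  by case: m u => [|m] u; last by move=> /mem_kerm.
have cycX m u : u \in smem (cycles F P m) -> cycle dX u.
  by case: m u => [|m] u; last by move=> /mem_kerm.
apply: subquot_map_bijective => [u uc /mem_imm[w wE]|z zc].
  have [u' u'E] := homology_inj TdY Tor_diag_dual_inj Tor_diag_dual_surj
    (cycY _ _ uc) (esym wE).
  by apply/mem_imm; exists u'.
have [u uc [w wE]] := homology_surj TdY Tor_diag_dual_inj Tor_diag_dual_surj
  (cycX _ _ zc).
exists u; last by apply/mem_imm; exists w.
by case: n u uc {z zc w wE} => [|n] u uc;
  [exact: mem_full_submod|exact/mem_kerm].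
Qed.

End TorDiagonal.

(** * Functors of AP-type *)

Lemma AP_type_functor (k : comPzRingType) (A : addcat) (B :
  kfun k (prodc A A)) :
  AP_type B -> AP_functor B.
Proof.
move=> BAP x; have [anti poly] := BAP x.
by split; [exact: antipolynomial_factors|exact: polynomial_on_lines].
Qed.

Lemma AP_functor_dual (k : comPzRingType) (A : addcat)
    (B : kfun k (prodc (addop A) (addop A))) (J : lmodType k) :
  AP_functor B -> AP_functor (dualk J (pull (op_prod A A) B)).
Proof.
move=> BAP x; have [[I [uI BI]] [d Bd]] := BAP x; split.
  exists (@Ideal A (fun x y => imem I y x)
    (fun x y z g f => @ideal_r _ I z y x f g)
    (fun x y z g f => @ideal_l _ I z y x f g)); split=> //.
  move=> y z f g fg v; apply: homm_ext => s.
  rewrite !dual_mapE; congr (homm_fun v _).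
  exact: (BI z y f g fg s).
exists d => y z a b v t; apply: homm_ext => s.
have ev_lin : linear (fun phi : homm (B (x, z)) J => homm_fun phi s) by [].
rewrite -[LHS]/(mklin ev_lin _) -iter_diff_linear.
rewrite -[RHS](linear0 (homm_fun v)) -(Bd z y a b s t) -iter_diff_linear.
exact: iter_diff_ext.
Qed.

Theorem theorem4p4 (k : comPzRingType) (A : addcat)
    (B C : kfun k (prodc A A)) (B' : kfun k (prodc (addop A) (addop A)))
    (B_AP : AP_type B) (C_AP : AP_type C) (B'_AP : AP_type B') :
  (forall n : nat, bijective (Ext_restr (diag A) n B C)) /\
  (forall n : nat,
    bijective (Tor_restr (diag A) n (pull (op_prod A A) B') C)).
Proof.
have BF := AP_type_functor B_AP; have CF := AP_type_functor C_AP.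
have B'F := AP_type_functor B'_AP.
split=> n; first exact: Ext_diag_bijective.
apply: Tor_of_diag_bijective => //; try exact: std_resolution_proj.
by move=> J; exact: AP_functor_dual.
Qed.
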